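(* Let $\mathbb{C}$ be a monoidal double category with a monoidal functor $(-)^{*}:\mathbb{C}^{\bullet}\to\mathbb{C}$, a cap $\eta$ and a cup $\varepsilon$. Then there are (proarrow-dimension pseudo) natural transformations $$S:\mathrm{Id}_{\mathbb{C}}\overset{\bullet}{\to}\mathrm{Id}_{\mathbb{C}}\ \ (\text{of functors }\mathbb{C}\to\mathbb{C})\qquad\text{and}\qquad Z:(-)^{*}\overset{\bullet}{\to}(-)^{*}\ \ (\text{of functors }\mathbb{C}^{\bullet}\to\mathbb{C}),$$ called zigzags, with the following structure. - For each object $A$: $\ SA=(\iota A\otimes\eta A)\odot(\varepsilon A\otimes\iota A):A\overset{\bullet}{\to}A$ and $ZA=(\eta A\otimes\iota^{*}A)\odot(\iota^{*}A\otimes\varepsilon A):A^{*}\overset{\bullet}{\to}A^{*}$. - For each arrow $f:A\to B$ of $\mathbb{C}$: $\ Sf=(\iota f\otimes\eta f)\odot(\varepsilon f\otimes\iota f)$ and $Zf=(\eta f\otimes\iota^{*}f)\odot(\iota^{*}f\otimes\varepsilon f)$. - For each proarrow $m:A\overset{\bullet}{\to}B$ of $\mathbb{C}$, the proarrow-component of $S$ is the disk $Sm:m\odot SB\to SA\odot m$ which, up to coherators, is the composite $$m\odot(B\otimes\eta B)\odot(\varepsilon B\otimes B)\;\cong\;(A\otimes\eta B)\odot(m\otimes B^{*}\otimes B)\odot(\varepsilon B\otimes B)\xrightarrow{(A\otimes\eta B)\odot(\varepsilon m\otimes B)}(A\otimes\eta B)\odot(A\otimes m^{*}\otimes B)\odot(\varepsilon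 A\otimes B)$$ $$\xrightarrow{(A\otimes\eta m)\odot(\varepsilon A\otimes B)}(A\otimes\eta A)\odot(A\otimes A^{*}\otimes m)\odot(\varepsilon A\otimes B)\;\cong\;(A\otimes\eta A)\odot(\varepsilon A\otimes A)\odot m ,$$ and the proarrow-component of $Z$ is given (as a lax-direction disk $ZB\odot m^{*}\to m^{*}\odot ZA$, whose inverse is the component in the oplax direction) up to coherators by the composite $$(\eta B\otimes B^{*})\odot(B^{*}\otimes\varepsilon B)\odot m^{*}\;\cong\;(\eta B\otimes B^{*})\odot(m^{*}\otimes B\otimes B^{*})\odot(A^{*}\otimes\varepsilon B)\xrightarrow{(\eta m\otimes B^{*})\odot(A^{*}\otimes\varepsilon B)}(\eta A\otimes B^{*})\odot(A^{*}\otimes m\otimes B^{*})\odot(A^{*}\otimes\varepsilon B)$$ $$\xrightarrow{(\eta A\otimes B^{*})\odot(A^{*}\otimes\varepsilon m)}(\eta A\otimes B^{*})\odot(A^{*}\otimes A\otimes m^{*})\odot(A^{*}\otimes\varepsilon A)\;\cong\;m^{*}\odot(\eta A\otimes A^{*})\odot(A^{*}\otimes\varepsilon A).$$ Here the unlabelled $\cong$'s are the interchange identifications given by functoriality of $\otimes$, i.e. the identity disks on $m\otimes\eta B$, $\varepsilon A\otimes m$, $m^{*}\otimes\varepsilon B$ and $\eta A\otimes m^{*}$ respectively, up to coherators.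
   Context: **Double categories.** A (weak) double category $\mathbb{C}$ has objects, arrows $f : A \to B$, proarrows $m : A \overset{\bullet}{\to} B$, and squares. A square $\varphi$ has a left proarrow $m : A \overset{\bullet}{\to} C$, a right proarrow $n : B \overset{\bullet}{\to} D$, a top arrow $f : A \to B$ and a bottom arrow $g : C \to D$. All composites are written in left-to-right (diagrammatic) order. Arrow-dimension composition, written $\cdot$ with units $\mathrm{id}$, composes arrows, and composes squares horizontally ($\varphi\cdot\psi$ is defined when the right proarrow of $\varphi$ is the left proarrow of $\psi$); it is strictly associative and unital. Proarrow-dimension composition, written $\odot$ with units $\mathrm{U}$, composes proarrows, and composes squares vertically ($\varphi\odot\psi$ is defined when the bottom arrow of $\varphi$ is the top arrow of $\psi$); it is associative and unital only up to coherent isomorphism. A proarrow disk $m \to n$ is a square with left proarrow $m$, right proarrow $n$, and identity top and bottom arrows; it is invertible if it has a two-sided inverse for $\cdot$. Associators and unitors for $\odot$ are suppressed, as are bracketings; an equation that holds after inserting the appropriate coherators is written with $\cong$ instead of $=$. Dimensional promotion: a lower-dimensional cell appearing where a higher-dimensional one is expected denotes the corresponding identity (e.g. in $F(A,m)$ or $A\otimes m$ with $A$ an object and $m$ a proarrow, $A$ stands for $\mathrm{U}_A$; in $F(g,\varphi)$ with $g$ an arrow and $\varphi$ a square, $g$ stands for $\mathrm{U}_g$; a proarrow in a composite of squares stands for its $\mathrm{id}$). Products of double categories are componentwise. A functor is strict: it preserves boundaries and all composition structure in both dimensions. A monoidal double category is a double category $\mathbb{C}$ with functors $\otimes:\mathbb{C}\times\mathbb{C}\to\mathbb{C}$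 and $I:\mathbb{1}\to\mathbb{C}$ (from the singleton double category) obeying the monoid laws; a monoidal functor is a functor respecting this structure. **Natural transformations.** For functors $F,G:\mathbb{E}\to\mathbb{D}$, a (proarrow-dimension pseudo) natural transformation $\alpha : F \overset{\bullet}{\to} G$ consists of: for each object $A$ a proarrow $\alpha A : FA \overset{\bullet}{\to} GA$; for each arrow $f : A \to B$ a square $\alpha f$ with left $\alpha A$, right $\alpha B$, top $Ff$, bottom $Gf$; for each proarrow $m : A \overset{\bullet}{\to} B$ an invertible proarrow disk $\alpha m : Fm \odot \alpha B \to \alpha A \odot Gm$; such that (i) $\alpha(\mathrm{id}_A)=\mathrm{id}_{\alpha A}$ and $\alpha(f\cdot g)=\alpha f\cdot\alpha g$; (ii) $\alpha(\mathrm{U}_A)\cong \mathrm{id}_{\alpha A}$ and $\alpha(m\odot n)\cong (Fm\odot\alpha n)\cdot(\alpha m\odot Gn)$; (iii) for each square $\varphi$ with left $m$, right $n$, top $f$, bottom $g$: $(F\varphi\odot\alpha g)\cdot\alpha n=\alpha m\cdot(\alpha f\odot G\varphi)$. (The disks above are in the oplax direction; disks in the reverse direction are in the lax direction.) **Difunctors and dinatural transformations.** $\mathbb{C}^{\bullet}$ denotes the proarrow-dimension reflection of $\mathbb{C}$: it has the same objects, arrows, proarrows and squares, but with boundaries in the proarrow dimension transposed (a proarrow $m:A\overset{\bullet}{\to}B$ of $\mathbb{C}$ is a proarrow $B\overset{\bullet}{\to}A$ of $\mathbb{C}^\bullet$, so $m^{*}:B^{*}\overset{\bullet}{\to}A^{*}$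 in $\mathbb{C}$; squares have top and bottom exchanged) and $\odot$-composition order reversed. A difunctor is a functor with domain $\mathbb{C}^{\bullet}\times\mathbb{C}$. For difunctors $F,G:\mathbb{C}^{\bullet}\times\mathbb{C}\to\mathbb{D}$, a (proarrow-dimension pseudo) dinatural transformation $\alpha$ from $F$ to $G$ consists of: for each object $A$ of $\mathbb{C}$ a proarrow $\alpha A:F(A,A)\overset{\bullet}{\to}G(A,A)$; for each arrow $f:A\to B$ of $\mathbb{C}$ a square $\alpha f$ with left $\alpha A$, right $\alpha B$, top $F(f,f)$, bottom $G(f,f)$; for each proarrow $m:A\overset{\bullet}{\to}B$ of $\mathbb{C}$ an invertible proarrow disk $\alpha m:F(B,m)\odot\alpha B\odot G(m,B)\to F(m,A)\odot\alpha A\odot G(A,m)$; such that (i) $\alpha(\mathrm{id}_A)=\mathrm{id}_{\alpha A}$, $\alpha(f\cdot g)=\alpha f\cdot\alpha g$; (ii) $\alpha(\mathrm{U}_A)\cong\mathrm{id}_{\alpha A}$ and, for $m:A\overset{\bullet}{\to}B$, $n:B\overset{\bullet}{\to}C$, $\alpha(m\odot n)\cong(F(C,m)\odot\alpha n\odot G(m,C))\cdot(F(n,A)\odot\alpha m\odot G(A,n))$; (iii) for each square $\varphi$ with left $m$, right $n$, top $f$, bottom $g$: $(F(g,\varphi)\odot\alpha g\odot G(\varphi,g))\cdot\alpha n\cong\alpha m\cdot(F(\varphi,f)\odot\alpha f\odot G(f,\varphi))$. **Caps, cups, strips.** Given the monoidal functor $(-)^{*}:\mathbb{C}^{\bullet}\to\mathbb{C}$,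 consider three difunctors $\mathbb{C}^{\bullet}\times\mathbb{C}\to\mathbb{C}$: the constant functor at the monoidal unit $I$; ${}^{*}\otimes$, sending $(\psi,\varphi)\mapsto\psi^{*}\otimes\varphi$; and $\otimes^{*}$, sending $(\psi,\varphi)\mapsto\varphi\otimes\psi^{*}$ (and likewise on lower cells). A cap is a dinatural transformation $\eta$ from $I$ to ${}^{*}\otimes$, and a cup is a dinatural transformation $\varepsilon$ from $\otimes^{*}$ to $I$. Thus $\eta A:I\overset{\bullet}{\to}A^{*}\otimes A$ and $\varepsilon A:A\otimes A^{*}\overset{\bullet}{\to}I$; for $f:A\to B$, $\eta f$ has left $\eta A$, right $\eta B$, top $\mathrm{id}_I$, bottom $f^{*}\otimes f$, and $\varepsilon f$ has left $\varepsilon A$, right $\varepsilon B$, top $f\otimes f^{*}$, bottom $\mathrm{id}_I$; for $m:A\overset{\bullet}{\to}B$, (up to unitors) $\eta m:\eta B\odot(m^{*}\otimes B)\to\eta A\odot(A^{*}\otimes m)$ and $\varepsilon m:(m\otimes B^{*})\odot\varepsilon B\to(A\otimes m^{*})\odot\varepsilon A$. The strips $\iota,\iota^{*}$ have components $\iota A=\mathrm{U}_A$, $\iota f=\mathrm{U}_f$, $\iota^{*}A=\mathrm{U}_{A^{*}}$, $\iota^{*}f=\mathrm{U}_{f^{*}}$, and proarrow-components isomorphic to $\mathrm{id}_m$ and $\mathrm{id}_{m^{*}}$. *)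

(* Defs.v *)
From Corelib Require Import ssreflect ssrfun ssrbool.

Set Implicit Arguments.
Unset Strict Implicit.
Unset Printing Implicit Defensive.

(** Cells of each of the four kinds form a single type, with boundary maps, so
    that a strict equation between boundaries never has to be transported
    along.  Partial composition operations are represented by total functions:
    their values on non-composable cells are unspecified, no law mentions those
    values, and functors need not preserve them. *)

Record dcData := DCData {
  Ob : Type;  Ar : Type;  Pr : Type;  Sq : Type;
  asrc : Ar -> Ob;  atgt : Ar -> Ob;
  psrc : Pr -> Ob;  ptgt : Pr -> Ob;
  lft : Sq -> Pr;  rgt : Sq -> Pr;  top : Sq -> Ar;  bot : Sq -> Ar;
  (* arrow dimension, strict: [aid], [acomp] on arrows, [sid], [hcomp] on squares *)
  aid : Ob -> Ar;  acomp : Ar -> Ar -> Ar;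
  sid : Pr -> Sq;  hcomp : Sq -> Sq -> Sq;
  (* proarrow dimension, weak: [pU], [procomp] on proarrows, [sU], [vcomp] on squares *)
  pU : Ob -> Pr;  procomp : Pr -> Pr -> Pr;
  sU : Ar -> Sq;  vcomp : Sq -> Sq -> Sq;
  assoc : Pr -> Pr -> Pr -> Sq;  (* (m ⊙ n) ⊙ p  ->  m ⊙ (n ⊙ p) *)
  assocI : Pr -> Pr -> Pr -> Sq;
  lam : Pr -> Sq;                (* U ⊙ m  ->  m *)
  lamI : Pr -> Sq;
  rho : Pr -> Sq;                (* m ⊙ U  ->  m *)
  rhoI : Pr -> Sq
}.

Declare Scope dc_scope.
Delimit Scope dc_scope with dc.
Open Scope dc_scope.

(* Subscripts: a for arrows, s for squares, o for objects, none for proarrows. *)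
Notation "f ·ₐ g" := (acomp f g) (at level 45, left associativity) : dc_scope.
Notation "φ ·ₛ ψ" := (hcomp φ ψ) (at level 45, left associativity) : dc_scope.
Notation "m ⊙ n" := (procomp m n) (at level 38, left associativity) : dc_scope.
Notation "φ ⊙ₛ ψ" := (vcomp φ ψ) (at level 38, left associativity) : dc_scope.

Definition disk (C : dcData) (m n : Pr C) (φ : Sq C) : Prop :=
  [/\ lft φ = m, rgt φ = n, top φ = aid (psrc m) & bot φ = aid (ptgt m)].

Definition inverse (C : dcData) (φ ψ : Sq C) : Prop :=
  [/\ lft ψ = rgt φ, rgt ψ = lft φ,
      φ ·ₛ ψ = sid (lft φ) & ψ ·ₛ φ = sid (rgt φ)].

Definition invertible (C : dcData) (φ : Sq C) : Prop :=
  exists ψ, inverse φ ψ.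

Record isDoubleCat (C : dcData) : Prop := IsDoubleCat {
  asrc_top (φ : Sq C) : asrc (top φ) = psrc (lft φ);
  atgt_top (φ : Sq C) : atgt (top φ) = psrc (rgt φ);
  asrc_bot (φ : Sq C) : asrc (bot φ) = ptgt (lft φ);
  atgt_bot (φ : Sq C) : atgt (bot φ) = ptgt (rgt φ);
  asrc_id (A : Ob C) : asrc (aid A) = A;
  atgt_id (A : Ob C) : atgt (aid A) = A;
  asrc_comp (f g : Ar C) : atgt f = asrc g -> asrc (f ·ₐ g) = asrc f;
  atgt_comp (f g : Ar C) : atgt f = asrc g -> atgt (f ·ₐ g) = atgt g;
  aidl (f : Ar C) : aid (asrc f) ·ₐ f = f;
  aidr (f : Ar C) : f ·ₐ aid (atgt f) = f;
  acompA (f g h : Ar C) : atgt f = asrc g -> atgt g = asrc h ->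
    f ·ₐ g ·ₐ h = f ·ₐ (g ·ₐ h);
  lft_id (m : Pr C) : lft (sid m) = m;
  rgt_id (m : Pr C) : rgt (sid m) = m;
  top_id (m : Pr C) : top (sid m) = aid (psrc m);
  bot_id (m : Pr C) : bot (sid m) = aid (ptgt m);
  lft_comp (φ ψ : Sq C) : rgt φ = lft ψ -> lft (φ ·ₛ ψ) = lft φ;
  rgt_comp (φ ψ : Sq C) : rgt φ = lft ψ -> rgt (φ ·ₛ ψ) = rgt ψ;
  top_comp (φ ψ : Sq C) : rgt φ = lft ψ -> top (φ ·ₛ ψ) = top φ ·ₐ top ψ;
  bot_comp (φ ψ : Sq C) : rgt φ = lft ψ -> bot (φ ·ₛ ψ) = bot φ ·ₐ bot ψ;
  sidl (φ : Sq C) : sid (lft φ) ·ₛ φ = φ;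
  sidr (φ : Sq C) : φ ·ₛ sid (rgt φ) = φ;
  hcompA (φ ψ χ : Sq C) : rgt φ = lft ψ -> rgt ψ = lft χ ->
    φ ·ₛ ψ ·ₛ χ = φ ·ₛ (ψ ·ₛ χ);
  psrc_U (A : Ob C) : psrc (pU A) = A;
  ptgt_U (A : Ob C) : ptgt (pU A) = A;
  psrc_comp (m n : Pr C) : ptgt m = psrc n -> psrc (m ⊙ n) = psrc m;
  ptgt_comp (m n : Pr C) : ptgt m = psrc n -> ptgt (m ⊙ n) = ptgt n;
  top_U (f : Ar C) : top (sU f) = f;
  bot_U (f : Ar C) : bot (sU f) = f;
  lft_U (f : Ar C) : lft (sU f) = pU (asrc f);
  rgt_U (f : Ar C) : rgt (sU f) = pU (atgt f);
  top_vcomp (φ ψ : Sq C) : bot φ = top ψ -> top (φ ⊙ₛ ψ) = top φ;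
  bot_vcomp (φ ψ : Sq C) : bot φ = top ψ -> bot (φ ⊙ₛ ψ) = bot ψ;
  lft_vcomp (φ ψ : Sq C) : bot φ = top ψ -> lft (φ ⊙ₛ ψ) = lft φ ⊙ lft ψ;
  rgt_vcomp (φ ψ : Sq C) : bot φ = top ψ -> rgt (φ ⊙ₛ ψ) = rgt φ ⊙ rgt ψ;
  sU_id (A : Ob C) : sU (aid A) = sid (pU A);
  sU_comp (f g : Ar C) : atgt f = asrc g -> sU (f ·ₐ g) = sU f ·ₛ sU g;
  vcomp_id (m n : Pr C) : ptgt m = psrc n -> sid m ⊙ₛ sid n = sid (m ⊙ n);
  interchange (φ φ' ψ ψ' : Sq C) :
    rgt φ = lft φ' -> rgt ψ = lft ψ' -> bot φ = top ψ -> bot φ' = top ψ' ->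
    (φ ·ₛ φ') ⊙ₛ (ψ ·ₛ ψ') = (φ ⊙ₛ ψ) ·ₛ (φ' ⊙ₛ ψ');
  assoc_disk (m n p : Pr C) : ptgt m = psrc n -> ptgt n = psrc p ->
    disk (m ⊙ n ⊙ p) (m ⊙ (n ⊙ p)) (assoc m n p);
  assoc_inverse (m n p : Pr C) : ptgt m = psrc n -> ptgt n = psrc p ->
    inverse (assoc m n p) (assocI m n p);
  lam_disk (m : Pr C) : disk (pU (psrc m) ⊙ m) m (lam m);
  lam_inverse (m : Pr C) : inverse (lam m) (lamI m);
  rho_disk (m : Pr C) : disk (m ⊙ pU (ptgt m)) m (rho m);
  rho_inverse (m : Pr C) : inverse (rho m) (rhoI m);
  assoc_nat (φ ψ χ : Sq C) : bot φ = top ψ -> bot ψ = top χ ->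
    (φ ⊙ₛ ψ ⊙ₛ χ) ·ₛ assoc (rgt φ) (rgt ψ) (rgt χ)
    = assoc (lft φ) (lft ψ) (lft χ) ·ₛ (φ ⊙ₛ (ψ ⊙ₛ χ));
  lam_nat (φ : Sq C) :
    (sU (top φ) ⊙ₛ φ) ·ₛ lam (rgt φ) = lam (lft φ) ·ₛ φ;
  rho_nat (φ : Sq C) :
    (φ ⊙ₛ sU (bot φ)) ·ₛ rho (rgt φ) = rho (lft φ) ·ₛ φ;
  pentagon (m n p q : Pr C) :
    ptgt m = psrc n -> ptgt n = psrc p -> ptgt p = psrc q ->
    assoc (m ⊙ n) p q ·ₛ assoc m n (p ⊙ q)
    = (assoc m n p ⊙ₛ sid q) ·ₛ assoc m (n ⊙ p) q ·ₛ (sid m ⊙ₛ assoc n p q);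
  triangle (m n : Pr C) : ptgt m = psrc n ->
    assoc m (pU (ptgt m)) n ·ₛ (sid m ⊙ₛ lam n) = rho m ⊙ₛ sid n
}.

Record doubleCat := DoubleCat {
  dc_data :> dcData;
  dc_laws : isDoubleCat dc_data
}.

Section DiskLemmas.
Variable C : doubleCat.
Let L := dc_laws C.

Lemma disk_id (m : Pr C) : disk m m (sid m).
Proof. split; [exact: lft_id|exact: rgt_id|exact: top_id|exact: bot_id]. Qed.

Lemma disk_bdy (m n : Pr C) φ : disk m n φ -> psrc m = psrc n /\ ptgt m = ptgt n.
Proof.
case=> hl hr ht hb.
move: (atgt_top L φ) (atgt_bot L φ).
by rewrite ht hb hr !(atgt_id L).
Qed.

Lemma disk_hcomp (m n p : Pr C) φ ψ :
  disk m n φ -> disk n p ψ -> disk m p (φ ·ₛ ψ).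
Proof.
move=> D1 D2; have [e1 e2] := disk_bdy D1.
case: D1 => h1 h2 h3 h4; case: D2 => k1 k2 k3 k4.
have e : rgt φ = lft ψ by rewrite h2 k1.
split.
- by rewrite (lft_comp L e).
- by rewrite (rgt_comp L e).
- rewrite (top_comp L e) h3 k3 -e1.
  by have := aidl L (aid (psrc m)); rewrite (asrc_id L).
- rewrite (bot_comp L e) h4 k4 -e2.
  by have := aidl L (aid (ptgt m)); rewrite (asrc_id L).
Qed.

Lemma disk_vcomp (m m' n n' : Pr C) φ ψ : ptgt m = psrc n ->
  disk m m' φ -> disk n n' ψ -> disk (m ⊙ n) (m' ⊙ n') (φ ⊙ₛ ψ).
Proof.
move=> hmn [h1 h2 h3 h4] [k1 k2 k3 k4].
have e : bot φ = top ψ by rewrite h4 k3 hmn.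
split.
- by rewrite (lft_vcomp L e) h1 k1.
- by rewrite (rgt_vcomp L e) h2 k2.
- by rewrite (top_vcomp L e) h3 (psrc_comp L hmn).
- by rewrite (bot_vcomp L e) k4 (ptgt_comp L hmn).
Qed.

Lemma disk_inverse (m n : Pr C) φ ψ : disk m n φ -> inverse φ ψ -> disk n m ψ.
Proof.
move=> D [i1 i2 i3 _]; have [e1 e2] := disk_bdy D.
case: D => h1 h2 h3 h4.
have e : rgt φ = lft ψ by rewrite i1.
split; [by rewrite i1|by rewrite i2| |].
- have := top_comp L e; rewrite i3 (top_id L) h1 h3 => E.
  have := aidl L (top ψ).
  by rewrite (asrc_top L) -e h2 -e1 -E.
- have := bot_comp L e; rewrite i3 (bot_id L) h1 h4 => E.
  have := aidl L (bot ψ).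
  by rewrite (asrc_bot L) -e h2 -e2 -E.
Qed.

Lemma inverse_sym (φ ψ : Sq C) : inverse φ ψ -> inverse ψ φ.
Proof. by case=> i1 i2 i3 i4; split=> //; rewrite ?i1 ?i2. Qed.

Lemma inverse_uniq (φ ψ ψ' : Sq C) : inverse φ ψ -> inverse φ ψ' -> ψ = ψ'.
Proof.
case=> i1 i2 i3 i4 [j1 j2 j3 j4].
rewrite -(sidr L ψ) i2 -j3 -(hcompA L) ?i1 ?j1 // i4.
by rewrite -j1 (sidl L).
Qed.

Lemma inverse_hcomp (φ φ' ψ ψ' : Sq C) : rgt φ = lft ψ ->
  inverse φ φ' -> inverse ψ ψ' -> inverse (φ ·ₛ ψ) (ψ' ·ₛ φ').
Proof.
move=> e [i1 i2 i3 i4] [j1 j2 j3 j4].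
have e' : rgt ψ' = lft φ' by rewrite j2 i1.
split.
- by rewrite (lft_comp L e') (rgt_comp L e).
- by rewrite (rgt_comp L e') (lft_comp L e).
- rewrite (lft_comp L e) (hcompA L) ?(lft_comp L e') //.
  have <- : ψ ·ₛ ψ' ·ₛ φ' = ψ ·ₛ (ψ' ·ₛ φ') by apply: (hcompA L).
  by rewrite j3 -e -i1 (sidl L).
- rewrite (rgt_comp L e) (hcompA L) ?(lft_comp L e) ?i2 //.
  have <- : φ' ·ₛ φ ·ₛ ψ = φ' ·ₛ (φ ·ₛ ψ) by apply: (hcompA L).
  by rewrite i4 e (sidl L).
Qed.

Lemma inverse_id (m : Pr C) : inverse (sid m) (sid m).
Proof.
split; rewrite ?(lft_id L) ?(rgt_id L) //.
all: by have := sidl L (sid m); rewrite (lft_id L).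
Qed.

Lemma inverse_vcomp (m n m' n' : Pr C) φ φ' ψ ψ' : ptgt m = psrc n ->
  disk m m' φ -> disk n n' ψ ->
  inverse φ φ' -> inverse ψ ψ' -> inverse (φ ⊙ₛ ψ) (φ' ⊙ₛ ψ').
Proof.
move=> hmn D E I J.
have [d1 d2] := disk_bdy D; have [e1 e2] := disk_bdy E.
have hmn' : ptgt m' = psrc n' by rewrite -d2 -e1.
have [a1 a2 a3 a4] := D; have [b1 b2 b3 b4] := E.
have [a1' a2' a3' a4'] := disk_inverse D I.
have [b1' b2' b3' b4'] := disk_inverse E J.
have [i1 i2 i3 i4] := I; have [j1 j2 j3 j4] := J.
have e : bot φ = top ψ by rewrite a4 b3 hmn.
have e' : bot φ' = top ψ' by rewrite a4' b3' hmn'.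
split.
- by rewrite (lft_vcomp L e') (rgt_vcomp L e) i1 j1.
- by rewrite (lft_vcomp L e) (rgt_vcomp L e') i2 j2.
- by rewrite -(interchange L) // i3 j3 (vcomp_id L) ?(lft_vcomp L e) ?a1 ?b1.
- by rewrite -(interchange L) // i4 j4 (vcomp_id L) ?(rgt_vcomp L e) ?a2 ?b2.
Qed.

End DiskLemmas.

Definition oneData : dcData := {|
  Ob := unit; Ar := unit; Pr := unit; Sq := unit;
  asrc f := f; atgt f := f; psrc m := m; ptgt m := m;
  lft φ := φ; rgt φ := φ; top φ := φ; bot φ := φ;
  aid A := A; acomp f g := tt; sid m := m; hcomp φ ψ := tt;
  pU A := A; procomp m n := tt; sU f := f; vcomp φ ψ := tt;
  assoc m n p := tt; assocI m n p := tt;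
  lam m := m; lamI m := m; rho m := m; rhoI m := m |}.

Lemma one_laws : isDoubleCat oneData.
Proof.
by split; repeat (first [case | move=> ?]); rewrite /disk /inverse /=.
Qed.

Definition oneDC : doubleCat := DoubleCat one_laws.

Definition prodData (C D : dcData) : dcData := {|
  Ob := Ob C * Ob D; Ar := Ar C * Ar D; Pr := Pr C * Pr D; Sq := Sq C * Sq D;
  asrc f := (asrc f.1, asrc f.2);  atgt f := (atgt f.1, atgt f.2);
  psrc m := (psrc m.1, psrc m.2);  ptgt m := (ptgt m.1, ptgt m.2);
  lft φ := (lft φ.1, lft φ.2);  rgt φ := (rgt φ.1, rgt φ.2);
  top φ := (top φ.1, top φ.2);  bot φ := (bot φ.1, bot φ.2);
  aid A := (aid A.1, aid A.2);
  acomp f g := (f.1 ·ₐ g.1, f.2 ·ₐ g.2);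
  sid m := (sid m.1, sid m.2);
  hcomp φ ψ := (φ.1 ·ₛ ψ.1, φ.2 ·ₛ ψ.2);
  pU A := (pU A.1, pU A.2);
  procomp m n := (m.1 ⊙ n.1, m.2 ⊙ n.2);
  sU f := (sU f.1, sU f.2);
  vcomp φ ψ := (φ.1 ⊙ₛ ψ.1, φ.2 ⊙ₛ ψ.2);
  assoc m n p := (assoc m.1 n.1 p.1, assoc m.2 n.2 p.2);
  assocI m n p := (assocI m.1 n.1 p.1, assocI m.2 n.2 p.2);
  lam m := (lam m.1, lam m.2);  lamI m := (lamI m.1, lamI m.2);
  rho m := (rho m.1, rho m.2);  rhoI m := (rhoI m.1, rhoI m.2) |}.

Lemma disk_pair (C D : dcData) (m n : Pr C) (m' n' : Pr D) φ φ' :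
  disk m n φ -> disk m' n' φ' ->
  disk (C := prodData C D) (m, m') (n, n') (φ, φ').
Proof.
case=> h1 h2 h3 h4 [k1 k2 k3 k4]; split => /=.
all: by rewrite ?h1 ?h2 ?h3 ?h4 ?k1 ?k2 ?k3 ?k4.
Qed.

Lemma inverse_pair (C D : dcData) (φ ψ : Sq C) (φ' ψ' : Sq D) :
  inverse φ ψ -> inverse φ' ψ' ->
  inverse (C := prodData C D) (φ, φ') (ψ, ψ').
Proof.
case=> h1 h2 h3 h4 [k1 k2 k3 k4]; split => /=.
all: by rewrite ?h1 ?h2 ?h3 ?h4 ?k1 ?k2 ?k3 ?k4.
Qed.

Lemma prod_laws (C D : doubleCat) : isDoubleCat (prodData C D).
Proof.
case: C => C L; case: D => D M.
split=> /=; repeat (case=> ? ?); move=> /=;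
  repeat (let h := fresh in let k := fresh in case=> h k);
  try (by congr pair; [apply L|apply M]);
  first [ by apply: disk_pair; [apply L|apply M]
        | by apply: inverse_pair; [apply L|apply M] ].
Qed.

Definition prodDC (C D : doubleCat) : doubleCat := DoubleCat (prod_laws C D).

(* The proarrow-dimension reflection: its associator is the inverse one, and
   its left and right unitors are exchanged. *)
Definition reflectData (C : dcData) : dcData := {|
  Ob := Ob C; Ar := Ar C; Pr := Pr C; Sq := Sq C;
  asrc f := asrc f; atgt f := atgt f;
  psrc m := ptgt m; ptgt m := psrc m;
  lft φ := lft φ; rgt φ := rgt φ; top φ := bot φ; bot φ := top φ;
  aid A := aid A; acomp f g := f ·ₐ g; sid m := sid m; hcomp φ ψ := φ ·ₛ ψ;
  pU A := pU A; procomp m n := n ⊙ m; sU f := sU f; vcomp φ ψ := ψ ⊙ₛ φ;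
  assoc m n p := assocI p n m; assocI m n p := assoc p n m;
  lam m := rho m; lamI m := rhoI m; rho m := lam m; rhoI m := lamI m |}.

Lemma disk_reflect (C : dcData) (m n : Pr C) φ :
  disk m n φ -> disk (C := reflectData C) m n φ.
Proof. by case. Qed.

Lemma inverse_reflect (C : dcData) (φ ψ : Sq C) :
  inverse φ ψ -> inverse (C := reflectData C) φ ψ.
Proof. by case. Qed.

Lemma inverse_swap (C : doubleCat) (a a' b b' φ ψ : Sq C) :
  rgt φ = lft a -> rgt b = lft ψ -> inverse a a' -> inverse b b' ->
  φ ·ₛ a = b ·ₛ ψ -> ψ ·ₛ a' = b' ·ₛ φ.
Proof.
pose L := dc_laws C.
move=> e1 e2 [i1 i2 i3 i4] [j1 j2 j3 j4] E.
have e3 : rgt ψ = rgt a by rewrite -(rgt_comp L e2) -E (rgt_comp L e1).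
have e4 : lft φ = lft b by rewrite -(lft_comp L e1) E (lft_comp L e2).
have -> : ψ = b' ·ₛ (φ ·ₛ a).
  rewrite E; have <- : b' ·ₛ b ·ₛ ψ = b' ·ₛ (b ·ₛ ψ) by apply: (hcompA L).
  by rewrite j4 e2 (sidl L).
rewrite (hcompA L) ?(lft_comp L e1) ?(rgt_comp L e1) ?j2 //.
have -> : φ ·ₛ a ·ₛ a' = φ ·ₛ (a ·ₛ a') by apply: (hcompA L).
by rewrite i3 -e1 (sidr L).
Qed.

Lemma reflect_laws (C : doubleCat) : isDoubleCat (reflectData C).
Proof.
pose L := dc_laws C.
split=> /=.
all: try by [apply L|move=> *; apply L|move=> *; symmetry; apply L].
- move=> m n p h k; apply: disk_reflect.
  by apply: disk_inverse (assoc_inverse L _ _); try apply: (assoc_disk L).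
- move=> m n p h k; apply/inverse_reflect/inverse_sym/(assoc_inverse L) => //.
- by move=> m; apply/disk_reflect/(rho_disk L).
- by move=> m; apply/disk_reflect/(lam_disk L).
- move=> φ ψ χ h k.
  have hl : ptgt (lft χ) = psrc (lft ψ) by rewrite -(asrc_bot L) -k (asrc_top L).
  have hr : ptgt (rgt χ) = psrc (rgt ψ) by rewrite -(atgt_bot L) -k (atgt_top L).
  have kl : ptgt (lft ψ) = psrc (lft φ) by rewrite -(asrc_bot L) -h (asrc_top L).
  have kr : ptgt (rgt ψ) = psrc (rgt φ) by rewrite -(atgt_bot L) -h (atgt_top L).
  have [a1 a2 a3 a4] := assoc_disk L hl kl.
  have [b1 b2 b3 b4] := assoc_disk L hr kr.
  have e1 : bot (χ ⊙ₛ ψ) = top φ by rewrite (bot_vcomp L).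
  have e2 : bot χ = top (ψ ⊙ₛ φ) by rewrite (top_vcomp L).
  apply: inverse_swap (assoc_inverse L hr kr) (assoc_inverse L hl kl) _.
  + by rewrite (rgt_vcomp L) // (rgt_vcomp L) // b1.
  + by rewrite (lft_vcomp L) // (lft_vcomp L) // a2.
  + exact: (assoc_nat L).
- move=> d c b a e3 e2 e1.
  symmetry in e1, e2, e3.
  have p12 : ptgt (a ⊙ b) = psrc c by rewrite (ptgt_comp L).
  have p23 : ptgt (b ⊙ c) = psrc d by rewrite (ptgt_comp L).
  have s23 : ptgt a = psrc (b ⊙ c) by rewrite (psrc_comp L).
  have s34 : ptgt b = psrc (c ⊙ d) by rewrite (psrc_comp L).
  have p123 : ptgt (a ⊙ b ⊙ c) = psrc d by rewrite (ptgt_comp L).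
  have s234 : ptgt a = psrc (b ⊙ c ⊙ d) by rewrite (psrc_comp L).
  have D1 := disk_vcomp p123 (assoc_disk L e1 e2) (disk_id d).
  have I1 := inverse_vcomp p123 (assoc_disk L e1 e2) (disk_id d)
               (assoc_inverse L e1 e2) (inverse_id d).
  have D2 := assoc_disk L s23 p23; have I2 := assoc_inverse L s23 p23.
  have D3 := disk_vcomp s234 (disk_id a) (assoc_disk L e2 e3).
  have I3 := inverse_vcomp s234 (disk_id a) (assoc_disk L e2 e3)
               (inverse_id a) (assoc_inverse L e2 e3).
  have E1 := assoc_disk L p12 e3; have J1 := assoc_inverse L p12 e3.
  have E2 := assoc_disk L e1 s34; have J2 := assoc_inverse L e1 s34.
  have P := pentagon L e1 e2 e3.
  have cmp x y z φ ψ : @disk C x y φ -> @disk C y z ψ -> rgt φ = lft ψ.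
    by case=> _ -> _ _ [-> _ _ _].
  have JJ := inverse_hcomp (cmp _ _ _ _ _ E1 E2) J1 J2.
  have II := inverse_hcomp (cmp _ _ _ _ _ (disk_hcomp D1 D2) D3)
    (inverse_hcomp (cmp _ _ _ _ _ D1 D2) I1 I2) I3.
  rewrite P in JJ; rewrite (inverse_uniq JJ II).
  symmetry; apply: (hcompA L).
  + exact: (cmp _ _ _ _ _) (disk_inverse D3 I3) (disk_inverse D2 I2).
  + exact: (cmp _ _ _ _ _) (disk_inverse D2 I2) (disk_inverse D1 I1).
- move=> m n e; symmetry in e; rewrite -e.
  change (assocI n (pU (ptgt n)) m ·ₛ (rho n ⊙ₛ sid m) = sid n ⊙ₛ lam m).
  have s : ptgt n = psrc (pU (ptgt n)) by rewrite (psrc_U L).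
  have t : ptgt (pU (ptgt n)) = psrc m by rewrite (ptgt_U L).
  have [a1 a2 a3 a4] := assoc_disk L s t.
  have [i1 i2 i3 i4] := assoc_inverse L s t.
  rewrite -(triangle L e).
  have [l1 l2 l3 l4] := lam_disk L m; rewrite -e in l1.
  have h : rgt (assoc n (pU (ptgt n)) m) = lft (sid n ⊙ₛ lam m).
    rewrite a2 (lft_vcomp L) ?l1 ?(lft_id L) // (bot_id L) l3.
    by rewrite (psrc_comp L) ?(psrc_U L) ?(ptgt_U L) ?e.
  have <- : assocI n (pU (ptgt n)) m ·ₛ assoc n (pU (ptgt n)) m ·ₛ (sid n ⊙ₛ lam m)
    = assocI n (pU (ptgt n)) m ·ₛ (assoc n (pU (ptgt n)) m ·ₛ (sid n ⊙ₛ lam m)).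
    by apply: (hcompA L).
  by rewrite i4 h (sidl L).
Qed.

Definition reflectDC (C : doubleCat) : doubleCat := DoubleCat (reflect_laws C).

Record functor (C D : doubleCat) := Functor {
  fob : Ob C -> Ob D;  far : Ar C -> Ar D;
  fpr : Pr C -> Pr D;  fsq : Sq C -> Sq D;
  far_src f : asrc (far f) = fob (asrc f);
  far_tgt f : atgt (far f) = fob (atgt f);
  fpr_src m : psrc (fpr m) = fob (psrc m);
  fpr_tgt m : ptgt (fpr m) = fob (ptgt m);
  fsq_lft φ : lft (fsq φ) = fpr (lft φ);
  fsq_rgt φ : rgt (fsq φ) = fpr (rgt φ);
  fsq_top φ : top (fsq φ) = far (top φ);
  fsq_bot φ : bot (fsq φ) = far (bot φ);
  far_id A : far (aid A) = aid (fob A);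
  far_comp f g : atgt f = asrc g -> far (f ·ₐ g) = far f ·ₐ far g;
  fsq_id m : fsq (sid m) = sid (fpr m);
  fsq_hcomp φ ψ : rgt φ = lft ψ -> fsq (φ ·ₛ ψ) = fsq φ ·ₛ fsq ψ;
  fpr_U A : fpr (pU A) = pU (fob A);
  fpr_comp m n : ptgt m = psrc n -> fpr (m ⊙ n) = fpr m ⊙ fpr n;
  fsq_U f : fsq (sU f) = sU (far f);
  fsq_vcomp φ ψ : bot φ = top ψ -> fsq (φ ⊙ₛ ψ) = fsq φ ⊙ₛ fsq ψ;
  fsq_assoc m n p : ptgt m = psrc n -> ptgt n = psrc p ->
    fsq (assoc m n p) = assoc (fpr m) (fpr n) (fpr p);
  fsq_lam m : fsq (lam m) = lam (fpr m);
  fsq_rho m : fsq (rho m) = rho (fpr m)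
}.

Lemma fsq_inverse (C D : doubleCat) (F : functor C D) φ ψ :
  inverse φ ψ -> inverse (fsq F φ) (fsq F ψ).
Proof.
case=> i1 i2 i3 i4; split.
- by rewrite fsq_lft fsq_rgt i1.
- by rewrite fsq_lft fsq_rgt i2.
- by rewrite -fsq_hcomp // i3 fsq_id fsq_lft.
- by rewrite -fsq_hcomp // i4 fsq_id fsq_rgt.
Qed.

Lemma fsq_assocI (C D : doubleCat) (F : functor C D) m n p :
  ptgt m = psrc n -> ptgt n = psrc p ->
  fsq F (assocI m n p) = assocI (fpr F m) (fpr F n) (fpr F p).
Proof.
move=> h k.
have h' : ptgt (fpr F m) = psrc (fpr F n) by rewrite fpr_src fpr_tgt h.
have k' : ptgt (fpr F n) = psrc (fpr F p) by rewrite fpr_src fpr_tgt k.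
have I := fsq_inverse F (assoc_inverse (dc_laws C) h k).
rewrite fsq_assoc // in I.
exact: inverse_uniq I (assoc_inverse (dc_laws D) h' k').
Qed.

Definition idF (C : doubleCat) : functor C C.
Proof.
by refine {| fob A := A; far f := f; fpr m := m; fsq φ := φ |}.
Defined.

Definition compF (C D E : doubleCat) (F : functor C D) (G : functor D E) :
  functor C E.
Proof.
refine {| fob A := fob G (fob F A);  far f := far G (far F f);
          fpr m := fpr G (fpr F m);  fsq φ := fsq G (fsq F φ) |};
  try by (case: G; case: F => /=; intros; congruence).
- by move=> f g h; rewrite !far_comp // far_src far_tgt h.
- by move=> φ ψ h; rewrite !fsq_hcomp // fsq_lft fsq_rgt h.
- by move=> m n h; rewrite !fpr_comp // fpr_src fpr_tgt h.
- by move=> φ ψ h; rewrite !fsq_vcomp // fsq_top fsq_bot h.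
- by move=> m n p h k; rewrite !fsq_assoc // ?fpr_src ?fpr_tgt ?h ?k.
Defined.

Definition pairF (C D E : doubleCat) (F : functor C D) (G : functor C E) :
  functor C (prodDC D E).
Proof.
by refine {| fob A := (fob F A, fob G A) : Ob (prodDC D E);
             far f := (far F f, far G f) : Ar (prodDC D E);
             fpr m := (fpr F m, fpr G m) : Pr (prodDC D E);
             fsq φ := (fsq F φ, fsq G φ) : Sq (prodDC D E) |};
  move=> * /=; congr pair; (apply F || apply G).
Defined.

Definition fstF (C D : doubleCat) : functor (prodDC C D) C.
Proof.
refine {| fob (A : Ob (prodDC C D)) := A.1;  far (f : Ar (prodDC C D)) := f.1;
          fpr (m : Pr (prodDC C D)) := m.1;  fsq (φ : Sq (prodDC C D)) := φ.1 |}.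
all: by [].
Defined.

Definition sndF (C D : doubleCat) : functor (prodDC C D) D.
Proof.
refine {| fob (A : Ob (prodDC C D)) := A.2;  far (f : Ar (prodDC C D)) := f.2;
          fpr (m : Pr (prodDC C D)) := m.2;  fsq (φ : Sq (prodDC C D)) := φ.2 |}.
all: by [].
Defined.

Definition toOne (C : doubleCat) : functor C oneDC.
Proof.
refine {| fob _ := tt : Ob oneDC;  far _ := tt : Ar oneDC;
          fpr _ := tt : Pr oneDC;  fsq _ := tt : Sq oneDC |}.
all: by [].
Defined.

Definition reflectF (C D : doubleCat) (F : functor C D) :
  functor (reflectDC C) (reflectDC D).
Proof.
refine {| fob (A : Ob (reflectDC C)) := fob F A : Ob (reflectDC D);
          far (f : Ar (reflectDC C)) := far F f : Ar (reflectDC D);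
          fpr (m : Pr (reflectDC C)) := fpr F m : Pr (reflectDC D);
          fsq (φ : Sq (reflectDC C)) := fsq F φ : Sq (reflectDC D) |}
  => /=; try by [apply F|move=> *; apply F].
by move=> m n p h k; rewrite fsq_assocI.
Defined.

Record monoidalDC := MonoidalDC {
  mdc :> doubleCat;
  tens : functor (prodDC mdc mdc) mdc;
  munit : functor oneDC mdc;
  tens_obA A B C : fob tens (fob tens (A, B), C) = fob tens (A, fob tens (B, C));
  tens_arA f g h : far tens (far tens (f, g), h) = far tens (f, far tens (g, h));
  tens_prA m n p : fpr tens (fpr tens (m, n), p) = fpr tens (m, fpr tens (n, p));
  tens_sqA φ ψ χ : fsq tens (fsq tens (φ, ψ), χ) = fsq tens (φ, fsq tens (ψ, χ));
  tens_obl A : fob tens (fob munit tt, A) = A;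
  tens_arl f : far tens (far munit tt, f) = f;
  tens_prl m : fpr tens (fpr munit tt, m) = m;
  tens_sql φ : fsq tens (fsq munit tt, φ) = φ;
  tens_obr A : fob tens (A, fob munit tt) = A;
  tens_arr f : far tens (f, far munit tt) = f;
  tens_prr m : fpr tens (m, fpr munit tt) = m;
  tens_sqr φ : fsq tens (φ, fsq munit tt) = φ
}.

Notation "A ⊗ₒ B" := (fob (tens _) (A, B)) (at level 36, left associativity) : dc_scope.
Notation "f ⊗ₐ g" := (far (tens _) (f, g)) (at level 36, left associativity) : dc_scope.
Notation "m ⊗ n" := (fpr (tens _) (m, n)) (at level 36, left associativity) : dc_scope.
Notation "φ ⊗ₛ ψ" := (fsq (tens _) (φ, ψ)) (at level 36, left associativity) : dc_scope.

Definition reflect_swapF (C D : doubleCat) :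
  functor (prodDC (reflectDC C) (reflectDC D)) (reflectDC (prodDC C D)).
Proof.
by refine {|
  fob (A : Ob (prodDC (reflectDC C) (reflectDC D))) :=
    A : Ob (reflectDC (prodDC C D));
  far (f : Ar (prodDC (reflectDC C) (reflectDC D))) :=
    f : Ar (reflectDC (prodDC C D));
  fpr (m : Pr (prodDC (reflectDC C) (reflectDC D))) :=
    m : Pr (reflectDC (prodDC C D));
  fsq (φ : Sq (prodDC (reflectDC C) (reflectDC D))) :=
    φ : Sq (reflectDC (prodDC C D)) |}.
Defined.

Definition reflect_oneF : functor oneDC (reflectDC oneDC).
Proof.
refine {| fob _ := tt : Ob (reflectDC oneDC);
          far _ := tt : Ar (reflectDC oneDC);
          fpr _ := tt : Pr (reflectDC oneDC);
          fsq _ := tt : Sq (reflectDC oneDC) |}.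
all: by [].
Defined.

(* The tensor and the unit of the reflection are those of C, in the same
   order. *)
Definition reflectM (C : monoidalDC) : monoidalDC.
Proof.
refine {|
  mdc := reflectDC C;
  tens := compF (reflect_swapF C C) (reflectF (tens C));
  munit := compF reflect_oneF (reflectF (munit C)) |} => /=; apply C.
Defined.

Record monoidalFunctor (C D : monoidalDC) := MonoidalFunctor {
  mfun :> functor C D;
  mfun_ob A B : fob mfun (A ⊗ₒ B) = fob mfun A ⊗ₒ fob mfun B;
  mfun_ar f g : far mfun (f ⊗ₐ g) = far mfun f ⊗ₐ far mfun g;
  mfun_pr m n : fpr mfun (m ⊗ n) = fpr mfun m ⊗ fpr mfun n;
  mfun_sq φ ψ : fsq mfun (φ ⊗ₛ ψ) = fsq mfun φ ⊗ₛ fsq mfun ψ;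
  mfun_ob1 : fob mfun (fob (munit C) tt) = fob (munit D) tt;
  mfun_ar1 : far mfun (far (munit C) tt) = far (munit D) tt;
  mfun_pr1 : fpr mfun (fpr (munit C) tt) = fpr (munit D) tt;
  mfun_sq1 : fsq mfun (fsq (munit C) tt) = fsq (munit D) tt
}.

(** Disks are oplax-directed.  Where an equation holds only after coherators
    are inserted, they are written out explicitly; composites of three
    proarrows are bracketed to the left. *)

Record natTrans (E D : doubleCat) (F G : functor E D) := NatTrans {
  nt_ob : Ob E -> Pr D;  nt_ar : Ar E -> Sq D;  nt_pr : Pr E -> Sq D;
  nt_ob_src A : psrc (nt_ob A) = fob F A;
  nt_ob_tgt A : ptgt (nt_ob A) = fob G A;
  nt_ar_lft f : lft (nt_ar f) = nt_ob (asrc f);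
  nt_ar_rgt f : rgt (nt_ar f) = nt_ob (atgt f);
  nt_ar_top f : top (nt_ar f) = far F f;
  nt_ar_bot f : bot (nt_ar f) = far G f;
  nt_pr_disk m :
    disk (fpr F m ⊙ nt_ob (ptgt m)) (nt_ob (psrc m) ⊙ fpr G m) (nt_pr m);
  nt_pr_inv m : invertible (nt_pr m);
  nt_ar_id A : nt_ar (aid A) = sid (nt_ob A);
  nt_ar_comp f g : atgt f = asrc g -> nt_ar (f ·ₐ g) = nt_ar f ·ₛ nt_ar g;
  nt_pr_U A : nt_pr (pU A) = lam (nt_ob A) ·ₛ sid (nt_ob A) ·ₛ rhoI (nt_ob A);
  nt_pr_comp m n : ptgt m = psrc n ->
    nt_pr (m ⊙ n)
    = assoc (fpr F m) (fpr F n) (nt_ob (ptgt n))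
      ·ₛ (sid (fpr F m) ⊙ₛ nt_pr n)
      ·ₛ assocI (fpr F m) (nt_ob (ptgt m)) (fpr G n)
      ·ₛ (nt_pr m ⊙ₛ sid (fpr G n))
      ·ₛ assoc (nt_ob (psrc m)) (fpr G m) (fpr G n);
  nt_sq φ :
    (fsq F φ ⊙ₛ nt_ar (bot φ)) ·ₛ nt_pr (rgt φ)
    = nt_pr (lft φ) ·ₛ (nt_ar (top φ) ⊙ₛ fsq G φ)
}.

Definition difunctor (C D : doubleCat) := functor (prodDC (reflectDC C) C) D.

Section Difunctor.
Variables (C D : doubleCat) (F : difunctor C D).

Definition dob (A B : Ob C) : Ob D := fob F (A, B).
Definition dar (f g : Ar C) : Ar D := far F (f, g).
Definition dpr (m n : Pr C) : Pr D := fpr F (m, n).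
Definition dsq (φ ψ : Sq C) : Sq D := fsq F (φ, ψ).

(* F(X, m ⊙ n) -> F(X, m) ⊙ F(X, n) *)
Definition dsplit_r (X : Ob C) (m n : Pr C) : Sq D :=
  dsq (lamI (pU X)) (sid (m ⊙ n)).
(* F(X, m) ⊙ F(X, n) -> F(X, m ⊙ n) *)
Definition dmerge_r (X : Ob C) (m n : Pr C) : Sq D :=
  dsq (lam (pU X)) (sid (m ⊙ n)).
(* F(m ⊙ n, X) -> F(n, X) ⊙ F(m, X) *)
Definition dsplit_l (m n : Pr C) (X : Ob C) : Sq D :=
  dsq (sid (m ⊙ n)) (lamI (pU X)).
(* F(n, X) ⊙ F(m, X) -> F(m ⊙ n, X) *)
Definition dmerge_l (m n : Pr C) (X : Ob C) : Sq D :=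
  dsq (sid (m ⊙ n)) (lam (pU X)).

(* F(D', m) ⊙ F(n, B) -> F(n, m) -> F(n, A) ⊙ F(C', m), for m : A -> B and
   n : C' -> D'.  The first argument being reflected, F(D', m) ⊙ F(n, B) is
   F(n ⊙ U, m ⊙ U) and F(n, A) ⊙ F(C', m) is F(U ⊙ n, U ⊙ m). *)
Definition dswap (m n : Pr C) : Sq D :=
  dsq (rho n) (rho m) ·ₛ dsq (lamI n) (lamI m).

End Difunctor.

(* ((x ⊙ f) ⊙ p) ⊙ (g ⊙ y)  ->  (x ⊙ ((f ⊙ p) ⊙ g)) ⊙ y *)
Definition nest (D : doubleCat) (x f p g y : Pr D) : Sq D :=
  (assoc x f p ⊙ₛ sid (g ⊙ y))
  ·ₛ assocI (x ⊙ (f ⊙ p)) g y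
  ·ₛ (assoc x (f ⊙ p) g ⊙ₛ sid y).

Definition unnest (D : doubleCat) (x f p g y : Pr D) : Sq D :=
  (assocI x (f ⊙ p) g ⊙ₛ sid y)
  ·ₛ assoc (x ⊙ (f ⊙ p)) g y
  ·ₛ (assocI x f p ⊙ₛ sid (g ⊙ y)).

Record dinatTrans (C D : doubleCat) (F G : difunctor C D) := DinatTrans {
  dn_ob : Ob C -> Pr D;  dn_ar : Ar C -> Sq D;  dn_pr : Pr C -> Sq D;
  dn_ob_src A : psrc (dn_ob A) = dob F A A;
  dn_ob_tgt A : ptgt (dn_ob A) = dob G A A;
  dn_ar_lft f : lft (dn_ar f) = dn_ob (asrc f);
  dn_ar_rgt f : rgt (dn_ar f) = dn_ob (atgt f);
  dn_ar_top f : top (dn_ar f) = dar F f f;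
  dn_ar_bot f : bot (dn_ar f) = dar G f f;
  dn_pr_disk m :
    disk (dpr F (pU (ptgt m)) m ⊙ dn_ob (ptgt m) ⊙ dpr G m (pU (ptgt m)))
         (dpr F m (pU (psrc m)) ⊙ dn_ob (psrc m) ⊙ dpr G (pU (psrc m)) m)
         (dn_pr m);
  dn_pr_inv m : invertible (dn_pr m);
  dn_ar_id A : dn_ar (aid A) = sid (dn_ob A);
  dn_ar_comp f g : atgt f = asrc g -> dn_ar (f ·ₐ g) = dn_ar f ·ₛ dn_ar g;
  dn_pr_U A :
    dn_pr (pU A)
    = rho (pU (dob F A A) ⊙ dn_ob A) ·ₛ lam (dn_ob A)
      ·ₛ sid (dn_ob A)
      ·ₛ lamI (dn_ob A) ·ₛ rhoI (pU (dob F A A) ⊙ dn_ob A);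
  dn_pr_comp m n : ptgt m = psrc n ->
    let A := psrc m in let B := ptgt m in let X := ptgt n in
    dn_pr (m ⊙ n)
    = (dsplit_r F X m n ⊙ₛ sid (dn_ob X) ⊙ₛ dsplit_l G m n X)
      ·ₛ nest (dpr F (pU X) m) (dpr F (pU X) n) (dn_ob X)
              (dpr G n (pU X)) (dpr G m (pU X))
      ·ₛ (sid (dpr F (pU X) m) ⊙ₛ dn_pr n ⊙ₛ sid (dpr G m (pU X)))
      ·ₛ unnest (dpr F (pU X) m) (dpr F n (pU B)) (dn_ob B)
                (dpr G (pU B) n) (dpr G m (pU X))
      ·ₛ (dswap F m n ⊙ₛ sid (dn_ob B) ⊙ₛ dswap G n m)
      ·ₛ nest (dpr F n (pU A)) (dpr F (pU B) m) (dn_ob B)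
              (dpr G m (pU B)) (dpr G (pU A) n)
      ·ₛ (sid (dpr F n (pU A)) ⊙ₛ dn_pr m ⊙ₛ sid (dpr G (pU A) n))
      ·ₛ unnest (dpr F n (pU A)) (dpr F m (pU A)) (dn_ob A)
                (dpr G (pU A) m) (dpr G (pU A) n)
      ·ₛ (dmerge_l F m n A ⊙ₛ sid (dn_ob A) ⊙ₛ dmerge_r G A m n);
  dn_sq φ :
    (dsq F (sU (bot φ)) φ ⊙ₛ dn_ar (bot φ) ⊙ₛ dsq G φ (sU (bot φ)))
      ·ₛ dn_pr (rgt φ)
    = dn_pr (lft φ)
      ·ₛ (dsq F φ (sU (top φ)) ⊙ₛ dn_ar (top φ) ⊙ₛ dsq G (sU (top φ)) φ)
}.

Section CapsAndCups.
Variables (C : monoidalDC) (star : monoidalFunctor (reflectM C) C).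

Definition constI : difunctor C C := compF (toOne _) (munit C).

(* (ψ, φ) |-> ψ^* ⊗ φ *)
Definition star_tens : difunctor C C :=
  compF (pairF (compF (fstF (reflectDC C) C) star) (sndF (reflectDC C) C))
        (tens C).

(* (ψ, φ) |-> φ ⊗ ψ^* *)
Definition tens_star : difunctor C C :=
  compF (pairF (sndF (reflectDC C) C) (compF (fstF (reflectDC C) C) star))
        (tens C).

Definition cap := dinatTrans constI star_tens.
Definition cup := dinatTrans tens_star constI.

Definition star_ob (A : Ob C) : Ob C := fob star A.
Definition star_ar (f : Ar C) : Ar C := far star f.
Definition star_pr (m : Pr C) : Pr C := fpr star m.

(* The component at m : A -> B with the unit proarrow on I removed:
   ηB ⊙ (m^* ⊗ B)  ->  ηA ⊙ (A^* ⊗ m) *)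
Definition cap_pr (eta : cap) (m : Pr C) : Sq C :=
  (lamI (dn_ob eta (ptgt m)) ⊙ₛ sid (star_pr m ⊗ pU (ptgt m)))
  ·ₛ dn_pr eta m
  ·ₛ (lam (dn_ob eta (psrc m)) ⊙ₛ sid (pU (star_ob (psrc m)) ⊗ m)).

(* Likewise, (m ⊗ B^* ) ⊙ εB  ->  (A ⊗ m^* ) ⊙ εA *)
Definition cup_pr (eps : cup) (m : Pr C) : Sq C :=
  rhoI (m ⊗ pU (star_ob (ptgt m)) ⊙ dn_ob eps (ptgt m))
  ·ₛ dn_pr eps m
  ·ₛ rho (pU (psrc m) ⊗ star_pr m ⊙ dn_ob eps (psrc m)).

(* The identity disk on m ⊗ n, for m : A -> B and n : A' -> B', as a disk
   (m ⊗ A') ⊙ (B ⊗ n)  ->  (A ⊗ n) ⊙ (m ⊗ B'). *)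
Definition slide (m n : Pr C) : Sq C :=
  (rho m ⊗ₛ lam n) ·ₛ sid (m ⊗ n) ·ₛ (lamI m ⊗ₛ rhoI n).

(* The same, as a disk (A ⊗ n) ⊙ (m ⊗ B')  ->  (m ⊗ A') ⊙ (B ⊗ n). *)
Definition slideI (m n : Pr C) : Sq C :=
  (lam m ⊗ₛ rho n) ·ₛ sid (m ⊗ n) ·ₛ (rhoI m ⊗ₛ lamI n).

(* For φ : m ⊙ n -> p ⊙ q, the disk X ⊗ φ as a disk
   (X ⊗ m) ⊙ (X ⊗ n)  ->  (X ⊗ p) ⊙ (X ⊗ q). *)
Definition whisker_l (X : Ob C) (φ : Sq C) : Sq C :=
  (lam (pU X) ⊗ₛ sid (lft φ)) ·ₛ (sid (pU X) ⊗ₛ φ)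
  ·ₛ (lamI (pU X) ⊗ₛ sid (rgt φ)).

Definition whisker_r (φ : Sq C) (X : Ob C) : Sq C :=
  (sid (lft φ) ⊗ₛ lam (pU X)) ·ₛ (φ ⊗ₛ sid (pU X))
  ·ₛ (sid (rgt φ) ⊗ₛ lamI (pU X)).

Section Zigzags.
Variables (eta : cap) (eps : cup).

(* The proarrow-component m ⊙ SB -> SA ⊙ m of S. *)
Definition zigzagS_pr (m : Pr C) : Sq C :=
  let A := psrc m in let B := ptgt m in
  let A' := star_ob A in let B' := star_ob B in let m' := star_pr m in
  let etaA := dn_ob eta A in let etaB := dn_ob eta B in
  let epsA := dn_ob eps A in let epsB := dn_ob eps B in
  assocI m (pU B ⊗ etaB) (epsB ⊗ pU B)
  ·ₛ (slide m etaB ⊙ₛ sid (epsB ⊗ pU B))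
  ·ₛ assoc (pU A ⊗ etaB) (m ⊗ pU B' ⊗ pU B) (epsB ⊗ pU B)
  ·ₛ (sid (pU A ⊗ etaB) ⊙ₛ whisker_r (cup_pr eps m) B)
  ·ₛ assocI (pU A ⊗ etaB) (pU A ⊗ m' ⊗ pU B) (epsA ⊗ pU B)
  ·ₛ (whisker_l A (cap_pr eta m) ⊙ₛ sid (epsA ⊗ pU B))
  ·ₛ assoc (pU A ⊗ etaA) (pU A ⊗ pU A' ⊗ m) (epsA ⊗ pU B)
  ·ₛ (sid (pU A ⊗ etaA) ⊙ₛ slideI epsA m)
  ·ₛ assocI (pU A ⊗ etaA) (epsA ⊗ pU A) m.

(* The lax-direction proarrow-component ZB ⊙ m^* -> m^* ⊙ ZA of Z. *)
Definition zigzagZ_pr (m : Pr C) : Sq C :=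
  let A := psrc m in let B := ptgt m in
  let A' := star_ob A in let B' := star_ob B in let m' := star_pr m in
  let etaA := dn_ob eta A in let etaB := dn_ob eta B in
  let epsA := dn_ob eps A in let epsB := dn_ob eps B in
  assoc (etaB ⊗ pU B') (pU B' ⊗ epsB) m'
  ·ₛ (sid (etaB ⊗ pU B') ⊙ₛ slideI m' epsB)
  ·ₛ assocI (etaB ⊗ pU B') (m' ⊗ pU B ⊗ pU B') (pU A' ⊗ epsB)
  ·ₛ (whisker_r (cap_pr eta m) B' ⊙ₛ sid (pU A' ⊗ epsB))
  ·ₛ assoc (etaA ⊗ pU B') (pU A' ⊗ m ⊗ pU B') (pU A' ⊗ epsB)
  ·ₛ (sid (etaA ⊗ pU B') ⊙ₛ whisker_l A' (cup_pr eps m))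
  ·ₛ assocI (etaA ⊗ pU B') (pU A' ⊗ pU A ⊗ m') (pU A' ⊗ epsA)
  ·ₛ (slide etaA m' ⊙ₛ sid (pU A' ⊗ epsA))
  ·ₛ assoc m' (etaA ⊗ pU A') (pU A' ⊗ epsA).

End Zigzags.
End CapsAndCups.

(* Main.v *)
(* For a proarrow m, the disk Sm is a composite of four steps: m slides past ηB,
   then εm, then ηm, then εA slides past m; each step is natural in squares,
   hence so is S.  For a composite m ⊙ n, expanding the disks of η and ε by
   dinaturality gives ten steps, and they are rearranged into Sn followed by Sm
   with the interchange law and two instances of "a proarrow slides past a disk"
   (m past ηn, n past εm).

   This calculation takes place in a double category strictified along paths:
   any disk between bracketed composites of proarrows is conjugated with the
   canonical disks to left-nested composites, which turns every coherator into an
   identity.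

   The second zigzag is the first one for other data: reflect C, reverse its
   tensor, exchange the roles of the identity and of ( )^*, and invert the disks
   of the cap and the cup. *)
From mathcomp Require Import ssreflect ssrfun ssrbool seq.
From Stdlib Require Import ClassicalEpsilon.
Require Import Defs.

Set Implicit Arguments.
Unset Strict Implicit.
Unset Printing Implicit Defensive.

(** * Coherence *)

(** Boundaries are propositional equations, so every law on squares carries side conditions. Almost
    all squares below are disks, and the predicate [disk], being closed under both compositions,
    discharges these conditions. The obstacle is that a slide mixes two structures: it is a
    coherator in each tensor factor, but not a composite of coherators for ⊙, so coherence for ⊙
    alone says nothing about it. The calculation is therefore separated. Facts about slides are
    proved factor by factor, where only coherators and at most one other disk occur; afterwards
    slides and whiskered disks are opaque generators, and the composition law becomes a reordering
    of layers. Naturality in squares is out of reach of this method, since general squares are not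
    disks; it is pasted from commuting squares instead. Caps and cups are formulated for a pair of
    functors on a domain E kept apart from the target V, because the symmetry that yields the second
    zigzag reflects E only: in V the tensor is reversed, while ⊙ keeps its direction. *)

Section Disks.
Variable C : doubleCat.
Let L := dc_laws C.
Implicit Types (m n p M : Pr C) (φ ψ χ : Sq C).

Lemma disk_cmp m n p φ ψ : disk m n φ -> disk n p ψ -> rgt φ = lft ψ.
Proof. by case=> _ -> _ _ [-> _ _ _]. Qed.

Lemma disk_hcompA m n p q φ ψ χ :
  disk m n φ -> disk n p ψ -> disk p q χ -> φ ·ₛ ψ ·ₛ χ = φ ·ₛ (ψ ·ₛ χ).
Proof. by move=> ? D ?; apply: (hcompA L); apply: disk_cmp; eassumption. Qed.

Lemma disk_idl m n φ : disk m n φ -> sid m ·ₛ φ = φ.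
Proof. by case=> <- _ _ _; apply: (sidl L). Qed.

Lemma disk_idr m n φ : disk m n φ -> φ ·ₛ sid n = φ.
Proof. by case=> _ <- _ _; apply: (sidr L). Qed.

Lemma disk_interchange m n p m' n' p' φ ψ φ' ψ' : ptgt m = psrc m' ->
  disk m n φ -> disk n p ψ -> disk m' n' φ' -> disk n' p' ψ' ->
  (φ ·ₛ ψ) ⊙ₛ (φ' ·ₛ ψ') = (φ ⊙ₛ φ') ·ₛ (ψ ⊙ₛ ψ').
Proof.
move=> e D1 D2 D3 D4.
have [e1 e2] := disk_bdy D1; have [e3 e4] := disk_bdy D3.
apply: (interchange L); [exact: disk_cmp D1 D2|exact: disk_cmp D3 D4| |].
- by case: D1 => _ _ _ ->; case: D3 => _ _ -> _; rewrite e.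
- by case: D2 => _ _ _ ->; case: D4 => _ _ -> _; rewrite -e2 -e3 e.
Qed.

Lemma assocI_disk m n p : ptgt m = psrc n -> ptgt n = psrc p ->
  disk (m ⊙ (n ⊙ p)) (m ⊙ n ⊙ p) (assocI m n p).
Proof. by move=> h k; apply: disk_inverse (assoc_disk L h k) (assoc_inverse L h k). Qed.

Lemma lamI_disk m : disk m (pU (psrc m) ⊙ m) (lamI m).
Proof. exact: disk_inverse (lam_disk L m) (lam_inverse L m). Qed.

Lemma rhoI_disk m : disk m (m ⊙ pU (ptgt m)) (rhoI m).
Proof. exact: disk_inverse (rho_disk L m) (rho_inverse L m). Qed.

Lemma inv_cancel m n φ ψ : disk m n φ -> inverse φ ψ -> φ ·ₛ ψ = sid m.
Proof. by case=> <- _ _ _ []. Qed.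

Lemma inv_cancelI m n φ ψ : disk m n φ -> inverse φ ψ -> ψ ·ₛ φ = sid n.
Proof. by case=> _ <- _ _ []. Qed.

Lemma disk_cancell m n p φ ψ χ : disk m n φ -> invertible φ ->
  disk n p ψ -> disk n p χ -> φ ·ₛ ψ = φ ·ₛ χ -> ψ = χ.
Proof.
move=> D [φ' I] E F e; have D' := disk_inverse D I.
rewrite -(disk_idl E) -(disk_idl F) -(inv_cancelI D I).
by rewrite (disk_hcompA D' D E) (disk_hcompA D' D F) e.
Qed.

Lemma disk_cancelr m n p φ ψ χ : disk n p φ -> invertible φ ->
  disk m n ψ -> disk m n χ -> ψ ·ₛ φ = χ ·ₛ φ -> ψ = χ.
Proof.
move=> D [φ' I] E F e; have D' := disk_inverse D I.
rewrite -(disk_idr E) -(disk_idr F) -(inv_cancel D I).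
by rewrite -(disk_hcompA E D D') -(disk_hcompA F D D') e.
Qed.

Lemma psrcU (A : Ob C) : psrc (pU A) = A.
Proof. exact: (psrc_U L). Qed.

Lemma ptgtU (A : Ob C) : ptgt (pU A) = A.
Proof. exact: (ptgt_U L). Qed.

Lemma lamU_disk (A : Ob C) : disk (pU A ⊙ pU A) (pU A) (lam (pU A)).
Proof. by have := lam_disk L (pU A); rewrite psrcU. Qed.

Lemma lamIU_disk (A : Ob C) : disk (pU A) (pU A ⊙ pU A) (lamI (pU A)).
Proof. by have := lamI_disk (pU A); rewrite psrcU. Qed.

End Disks.

(* Composability [ptgt m = psrc n] of proarrows. *)
Ltac ob := solve [ done | congruence
  | rewrite (psrc_comp (dc_laws _)); ob
  | rewrite (ptgt_comp (dc_laws _)); ob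
  | rewrite (psrc_U (dc_laws _)); ob
  | rewrite (ptgt_U (dc_laws _)); ob ].

(** Hypotheses are tried before the structural rules: a boundary recorded in the context in
    simplified form takes precedence over the generic one. *)
Ltac dk := first [eassumption | dk_struct] with dk_struct := lazymatch goal with
  | |- disk _ _ (_ ·ₛ _) => eapply disk_hcomp; [dk|dk]
  | |- disk _ _ (_ ⊙ₛ _) => eapply disk_vcomp; [|dk|dk]; [ob]
  | |- disk _ _ (sid _) => apply: disk_id
  | |- disk _ _ (assoc _ _ _) => apply: (assoc_disk (dc_laws _)); ob
  | |- disk _ _ (assocI _ _ _) => apply: assocI_disk; ob
  | |- disk _ _ (lam (pU _)) => apply: lamU_disk
  | |- disk _ _ (lamI (pU _)) => apply: lamIU_disk
  | |- disk _ _ (lam _) => apply: (lam_disk (dc_laws _))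
  | |- disk _ _ (lamI _) => apply: lamI_disk
  | |- disk _ _ (rho _) => apply: (rho_disk (dc_laws _))
  | |- disk _ _ (rhoI _) => apply: rhoI_disk
  end.

(* Composability [rgt φ = lft ψ] of disks. *)
Ltac cmp := solve [eapply disk_cmp; dk].
Ltac hA := repeat (rewrite (hcompA (dc_laws _)); [|cmp|cmp]).

(** * Kelly's triangle for the right unitor *)

Section Kelly.
Variable C : doubleCat.
Let L := dc_laws C.
Implicit Types (m n p M : Pr C) (φ ψ χ : Sq C).

Lemma vcomp_hcompl M m n p φ ψ : ptgt M = psrc m -> disk m n φ -> disk n p ψ ->
  sid M ⊙ₛ (φ ·ₛ ψ) = (sid M ⊙ₛ φ) ·ₛ (sid M ⊙ₛ ψ).
Proof.
move=> h D E; rewrite -(disk_interchange h (disk_id M) (disk_id M) D E).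
by rewrite (disk_idl (disk_id M)).
Qed.

Lemma vcomp_hcompr M m n p φ ψ : ptgt m = psrc M -> disk m n φ -> disk n p ψ ->
  (φ ·ₛ ψ) ⊙ₛ sid M = (φ ⊙ₛ sid M) ·ₛ (ψ ⊙ₛ sid M).
Proof.
move=> h D E; rewrite -(disk_interchange h D E (disk_id M) (disk_id M)).
by rewrite (disk_idl (disk_id M)).
Qed.

Lemma vcomp_lr m n m' n' φ ψ : ptgt m = psrc m' -> disk m n φ -> disk m' n' ψ ->
  φ ⊙ₛ ψ = (φ ⊙ₛ sid m') ·ₛ (sid n ⊙ₛ ψ).
Proof.
move=> h D E; rewrite -(disk_interchange h D (disk_id n) (disk_id m') E).
by rewrite (disk_idr D) (disk_idl E).
Qed.

Lemma vcomp_rl m n m' n' φ ψ : ptgt m = psrc m' -> disk m n φ -> disk m' n' ψ ->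
  φ ⊙ₛ ψ = (sid m ⊙ₛ ψ) ·ₛ (φ ⊙ₛ sid n').
Proof.
move=> h D E; rewrite -(disk_interchange h (disk_id m) D E (disk_id n')).
by rewrite (disk_idl D) (disk_idr E).
Qed.

Lemma assoc_nat_disk m m' n n' p p' φ ψ χ : ptgt m = psrc n -> ptgt n = psrc p ->
  disk m m' φ -> disk n n' ψ -> disk p p' χ ->
  (φ ⊙ₛ ψ ⊙ₛ χ) ·ₛ assoc m' n' p' = assoc m n p ·ₛ (φ ⊙ₛ (ψ ⊙ₛ χ)).
Proof.
move=> h k [a1 a2 _ a4] [b1 b2 b3 b4] [c1 c2 c3 _]; subst; apply: (assoc_nat L).
- by rewrite a4 b3 h.
- by rewrite b4 c3 k.
Qed.

Lemma assocI_nat_disk m m' n n' p p' φ ψ χ : ptgt m = psrc n -> ptgt n = psrc p ->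
  disk m m' φ -> disk n n' ψ -> disk p p' χ ->
  (φ ⊙ₛ (ψ ⊙ₛ χ)) ·ₛ assocI m' n' p' = assocI m n p ·ₛ (φ ⊙ₛ ψ ⊙ₛ χ).
Proof.
move=> h k D E F.
have [d1 d2] := disk_bdy D; have [e1 e2] := disk_bdy E; have [f1 f2] := disk_bdy F.
apply: (inverse_swap (a := assoc m' n' p') (b := assoc m n p)).
- by cmp.
- by cmp.
- by apply: (assoc_inverse L); congruence.
- by apply: (assoc_inverse L); congruence.
- exact: assoc_nat_disk.
Qed.

Lemma rho_nat_disk m n φ : disk m n φ ->
  (φ ⊙ₛ sid (pU (ptgt m))) ·ₛ rho n = rho m ·ₛ φ.
Proof. by case=> <- <- _ h4; rewrite -(rho_nat L) h4 (sU_id L). Qed.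

Lemma lam_nat_disk m n φ : disk m n φ ->
  (sid (pU (psrc m)) ⊙ₛ φ) ·ₛ lam n = lam m ·ₛ φ.
Proof. by case=> <- <- h3 _; rewrite -(lam_nat L) h3 (sU_id L). Qed.

(** Whiskering by a unit is conjugation by the natural isomorphism [rho], hence faithful. *)
Lemma disk_whisk_U_inj m n φ ψ : disk m n φ -> disk m n ψ ->
  φ ⊙ₛ sid (pU (ptgt m)) = ψ ⊙ₛ sid (pU (ptgt m)) -> φ = ψ.
Proof.
move=> D E e; apply: (disk_cancell (rho_disk L m) _ D E).
  by exists (rhoI m); apply: (rho_inverse L).
by rewrite -(rho_nat_disk D) -(rho_nat_disk E) e.
Qed.

(** Kelly's argument: this triangle follows from the pentagon and the middle [triangle]. After
    whiskering by U, the pentagon for m, n, U, U relates two instances of [triangle]. *)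
Lemma rho_comp m n : ptgt m = psrc n ->
  rho (m ⊙ n) = assoc m n (pU (ptgt n)) ·ₛ (sid m ⊙ₛ rho n).
Proof.
move=> h; set U := pU _.
have s1 : psrc U = ptgt n by apply: (psrc_U L).
have s2 : ptgt U = ptgt n by apply: (ptgt_U L).
have s3 := esym s1.
have t1 : ptgt (m ⊙ n) = ptgt n by apply: (ptgt_comp L).
have t2 : ptgt (n ⊙ U) = ptgt n by rewrite (ptgt_comp L).
have t3 : psrc (n ⊙ U) = psrc n by rewrite (psrc_comp L).
have t4 : psrc (U ⊙ U) = ptgt n by rewrite (psrc_comp L) ?s1.
have t5 : ptgt (m ⊙ (n ⊙ U)) = ptgt n by rewrite (ptgt_comp L) ?t3.
have t6 : psrc (n ⊙ (U ⊙ U)) = psrc n by rewrite (psrc_comp L) ?t4.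
have t7 : psrc (n ⊙ U ⊙ U) = psrc n by rewrite (psrc_comp L) ?t2 ?t3.
have eR : disk (m ⊙ n ⊙ U) (m ⊙ n) (rho (m ⊙ n)) by have := rho_disk L (m ⊙ n); rewrite t1.
have eN : disk (n ⊙ U) n (rho n) by exact: rho_disk.
have eL : disk (U ⊙ U) U (lam U) by have := lam_disk L U; rewrite s1.
apply: (disk_whisk_U_inj eR); first by dk.
have -> : pU (ptgt (m ⊙ n ⊙ U)) = U by rewrite (ptgt_comp L) ?t1 ?s2.
(* Appending an invertible associator moves the common target to m ⊙ (n ⊙ U), where both sides can
   be expressed by [lam U] on the innermost factor. *)
apply: (disk_cancelr (n := m ⊙ n ⊙ U) (assoc_disk L h s3)).
- by exists (assocI m n U); apply: (assoc_inverse L).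
- by dk.
- by dk.
have T1 : assoc (m ⊙ n) U U ·ₛ (sid (m ⊙ n) ⊙ₛ lam U) = rho (m ⊙ n) ⊙ₛ sid U.
  by have := triangle L (m := m ⊙ n) (n := U); rewrite t1; apply.
have T2 : assoc n U U ·ₛ (sid n ⊙ₛ lam U) = rho n ⊙ₛ sid U by exact: triangle.
have P : assoc (m ⊙ n) U U ·ₛ assoc m n (U ⊙ U)
    = (assoc m n U ⊙ₛ sid U) ·ₛ assoc m (n ⊙ U) U ·ₛ (sid m ⊙ₛ assoc n U U).
  by apply: (pentagon L); congruence.
have -> : rho (m ⊙ n) ⊙ₛ sid U ·ₛ assoc m n U
    = assoc (m ⊙ n) U U ·ₛ assoc m n (U ⊙ U) ·ₛ (sid m ⊙ₛ (sid n ⊙ₛ lam U)).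
  rewrite -T1; hA; congr hcomp.
  have -> : sid (m ⊙ n) = sid m ⊙ₛ sid n by rewrite (vcomp_id L).
  by apply: assoc_nat_disk; first [ob|dk].
rewrite P; hA.
rewrite -(vcomp_hcompl (m := n ⊙ U ⊙ U) (n := n ⊙ (U ⊙ U)) (p := n ⊙ U)); [|ob|dk|dk].
rewrite T2 -(assoc_nat_disk (m' := m) (n' := n) (p' := U)); [|ob|ob|dk|dk|dk].
rewrite -(hcompA L); [|cmp|cmp].
by rewrite -(vcomp_hcompr (m := m ⊙ n ⊙ U) (n := m ⊙ (n ⊙ U)) (p := m ⊙ n)); [|ob|dk|dk].
Qed.
End Kelly.

(** * Bracketed composites and their normalisation *)

Inductive ptree (C : dcData) := At of Pr C | Un of Ob C | Cp of ptree C & ptree C.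
Arguments Un {C}.

Section Trees.
Variable C : doubleCat.
Let L := dc_laws C.
Implicit Types (m n p M : Pr C) (φ ψ χ : Sq C) (a b c e : ptree C) (l : seq (Pr C)).

Fixpoint ev e : Pr C :=
  match e with At m => m | Un A => pU A | Cp a b => ev a ⊙ ev b end.
Fixpoint esrc e : Ob C :=
  match e with At m => psrc m | Un A => A | Cp a _ => esrc a end.
Fixpoint etgt e : Ob C :=
  match e with At m => ptgt m | Un A => A | Cp _ b => etgt b end.
Fixpoint wfe e : Prop :=
  match e with Cp a b => [/\ wfe a, wfe b & etgt a = esrc b] | _ => True end.
Fixpoint flat e : seq (Pr C) :=
  match e with At m => [:: m] | Un _ => [::] | Cp a b => flat a ++ flat b end.

Fixpoint pth M l : Pr C := if l is m :: l' then pth (M ⊙ m) l' else M.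
Fixpoint suf φ l : Sq C := if l is m :: l' then suf (φ ⊙ₛ sid m) l' else φ.
Fixpoint composable (A : Ob C) l : Prop :=
  if l is m :: l' then A = psrc m /\ composable (ptgt m) l' else True.
Fixpoint pend (A : Ob C) l : Ob C := if l is m :: l' then pend (ptgt m) l' else A.

(* The disk M ⊙ ev e -> (..(M ⊙ m1) ⊙ ..) ⊙ mk for flat e = [m1; ..; mk].  With
   an arbitrary proarrow M in front, left-nested composites can be appended to
   each other on the nose. *)
Fixpoint nrm M e : Sq C :=
  match e with
  | At m => sid (M ⊙ m)
  | Un _ => rho M
  | Cp a b => assocI M (ev a) (ev b) ·ₛ (nrm M a ⊙ₛ sid (ev b))
              ·ₛ nrm (pth M (flat a)) b
  end.
(** Bracketed in the shape that [inverse_hcomp] gives to the inverse of [nrm]. *)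
Fixpoint nrmI M e : Sq C :=
  match e with
  | At m => sid (M ⊙ m)
  | Un _ => rhoI M
  | Cp a b => nrmI (pth M (flat a)) b
              ·ₛ ((nrmI M a ⊙ₛ sid (ev b)) ·ₛ assoc M (ev a) (ev b))
  end.

Lemma bdy_ev e : wfe e -> psrc (ev e) = esrc e /\ ptgt (ev e) = etgt e.
Proof.
elim: e => [//|A|a IHa b IHb] /=; first by rewrite (psrc_U L) (ptgt_U L).
case=> /IHa[h1 h2] /IHb[k1 k2] e.
by rewrite (psrc_comp L) ?(ptgt_comp L) ?h2 ?k1.
Qed.

Lemma composable_cat A l l' :
  composable A (l ++ l') <-> composable A l /\ composable (pend A l) l'.
Proof.
elim: l A => [|m l IH] A /=; first by split=> [|[]].
have [f g] := IH (ptgt m).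
by split=> [[? /f[]]|[[? ?] ?]]; do !split=> //; apply: g.
Qed.

Lemma pend_cat A l l' : pend A (l ++ l') = pend (pend A l) l'.
Proof. by elim: l A => /=. Qed.

Lemma pth_cat M l l' : pth M (l ++ l') = pth (pth M l) l'.
Proof. by elim: l M => /=. Qed.

Lemma suf_cat φ l l' : suf φ (l ++ l') = suf (suf φ l) l'.
Proof. by elim: l φ => /=. Qed.

Lemma flat_ev e : wfe e -> composable (esrc e) (flat e) /\ pend (esrc e) (flat e) = etgt e.
Proof.
elim: e => [//|//|a IHa b IHb] /= [/IHa[h1 h2] /IHb[k1 k2] e].
by rewrite pend_cat h2 e; split=> //; apply/composable_cat; rewrite h2 e.
Qed.

Lemma bdy_pth M l : composable (ptgt M) l ->
  psrc (pth M l) = psrc M /\ ptgt (pth M l) = pend (ptgt M) l.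
Proof.
elim: l M => [//|m l IH] M /= [h k].
by have [] := IH (M ⊙ m); rewrite ?(ptgt_comp L) ?(psrc_comp L).
Qed.

Lemma suf_disk m n φ l : composable (ptgt m) l -> disk m n φ ->
  disk (pth m l) (pth n l) (suf φ l).
Proof.
elim: l m n φ => [//|p l IH] m n φ /= [h k] D.
by apply: IH; [rewrite (ptgt_comp L)|dk].
Qed.

Lemma suf_id m l : composable (ptgt m) l -> suf (sid m) l = sid (pth m l).
Proof.
elim: l m => [//|p l IH] m /= [h k].
by rewrite (vcomp_id L) // IH ?(ptgt_comp L).
Qed.

Lemma suf_hcomp m n p φ ψ l : composable (ptgt m) l -> disk m n φ -> disk n p ψ ->
  suf (φ ·ₛ ψ) l = suf φ l ·ₛ suf ψ l.
Proof.
elim: l m n p φ ψ => [//|q l IH] m n p φ ψ /= [h k] D E.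
have [e1 e2] := disk_bdy D.
rewrite (vcomp_hcompr h D E) (IH (m ⊙ q) (n ⊙ q) (p ⊙ q)) //; try dk.
by rewrite (ptgt_comp L).
Qed.

Lemma pth_flat M e : wfe e -> ptgt M = esrc e ->
  psrc (pth M (flat e)) = psrc M /\ ptgt (pth M (flat e)) = etgt e.
Proof.
move=> w h; have [c1 c2] := flat_ev w; rewrite -h in c1 c2.
by have [-> ->] := bdy_pth c1.
Qed.

Lemma nrm_spec M e : wfe e -> ptgt M = esrc e ->
  disk (M ⊙ ev e) (pth M (flat e)) (nrm M e) /\ inverse (nrm M e) (nrmI M e).
Proof.
elim: e M => [m|A|a IHa b IHb] M /=.
- by move=> _ _; split; [apply: disk_id|apply: inverse_id].
- by move=> _ <-; split; [apply: (rho_disk L)|apply: (rho_inverse L)].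
case=> wa wb e h; have [a1 a2] := IHa M wa h.
have [e1 e2] := bdy_ev wa; have [e3 e4] := bdy_ev wb.
have [p1 p2] := pth_flat wa h; rewrite -p2 in e.
have [b1 b2] := IHb _ wb e; rewrite pth_cat.
have D1 : disk (M ⊙ (ev a ⊙ ev b)) (M ⊙ ev a ⊙ ev b) (assocI M (ev a) (ev b)) by dk.
have D2 : disk (M ⊙ ev a ⊙ ev b) (pth M (flat a) ⊙ ev b) (nrm M a ⊙ₛ sid (ev b)) by dk.
split; first by dk.
apply: inverse_hcomp b2; first by cmp.
apply: inverse_hcomp; first by cmp.
  by apply: inverse_sym; apply: (assoc_inverse L); congruence.
by apply: inverse_vcomp a1 (disk_id _) a2 (inverse_id _); ob.
Qed.

Lemma nrm_disk M e : wfe e -> ptgt M = esrc e ->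
  disk (M ⊙ ev e) (pth M (flat e)) (nrm M e).
Proof. by move=> w h; case: (nrm_spec w h). Qed.

Lemma nrm_inverse M e : wfe e -> ptgt M = esrc e -> inverse (nrm M e) (nrmI M e).
Proof. by move=> w h; case: (nrm_spec w h). Qed.

Lemma nrmI_disk M e : wfe e -> ptgt M = esrc e ->
  disk (pth M (flat e)) (M ⊙ ev e) (nrmI M e).
Proof. by move=> w h; apply: disk_inverse (nrm_disk w h) (nrm_inverse w h). Qed.

(** Lets a disk on the left factor of a ⊙-composite, which is part of the prefix from the point of
    view of the right factor, pass the normalisation of that right factor. *)
Lemma nrm_nat M M' e μ : wfe e -> ptgt M = esrc e -> disk M M' μ ->
  (μ ⊙ₛ sid (ev e)) ·ₛ nrm M' e = nrm M e ·ₛ suf μ (flat e).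
Proof.
elim: e M M' μ => [m|A|a IHa b IHb] M M' μ /=.
- move=> _ h D; have D2 : disk (M ⊙ m) (M' ⊙ m) (μ ⊙ₛ sid m) by dk.
  by rewrite (disk_idr D2) (disk_idl D2).
- by move=> _ <- D; apply: rho_nat_disk.
case=> wa wb e h D; have [h1 h2] := disk_bdy D.
have [e1 e2] := bdy_ev wa; have [e3 e4] := bdy_ev wb.
have h' : ptgt M' = esrc a by congruence.
have [p1 p2] := pth_flat wa h; have [p1' p2'] := pth_flat wa h'.
have wl := flat_ev wa; have w1 : composable (ptgt M) (flat a) by rewrite h; case: wl.
have N1 := nrm_disk wa h; have N2 := nrm_disk wa h'.
have D1 := suf_disk w1 D.
have h3 : ptgt (pth M (flat a)) = esrc b by congruence.
have h4 : ptgt (pth M' (flat a)) = esrc b by congruence.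
have w2 : composable (ptgt (pth M (flat a))) (flat b) by rewrite h3; case: (flat_ev wb).
have D2 := suf_disk w2 D1.
have N3 := nrm_disk wb h3; have N4 := nrm_disk wb h4.
rewrite suf_cat; hA.
rewrite -(IHb _ (pth M' (flat a))) //.
rewrite -!(hcompA L); try cmp.
congr hcomp.
transitivity (assocI M (ev a) (ev b) ·ₛ ((μ ⊙ₛ sid (ev a)) ·ₛ nrm M' a) ⊙ₛ sid (ev b)).
  rewrite (vcomp_hcompr (m := M ⊙ ev a) (n := M' ⊙ ev a) (p := pth M' (flat a))); try first [ob|dk].
  rewrite -!(hcompA L); try cmp. congr hcomp.
  rewrite -(vcomp_id L); last ob.
  by apply: assocI_nat_disk; first [ob|dk].
rewrite (IHa M) //.
rewrite (vcomp_hcompr (m := M ⊙ ev a) (n := pth M (flat a)) (p := pth M' (flat a))); try first [ob|dk].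
by rewrite -!(hcompA L); try cmp.
Qed.
End Trees.

(* A disk lsq acting on a segment of a path, between the prefix lpre and the
   suffix lsuf. *)
Record layer (C : dcData) := Layer {
  lpre : seq (Pr C); ldom : ptree C; lsq : Sq C; lcod : ptree C; lsuf : seq (Pr C) }.

(* Vlr and Vrl both denote ⊙ₛ, but their normal forms apply the left, resp. the
   right factor first: this encodes the interchange law. *)
Inductive term (C : dcData) :=
  | Gen of ptree C & Sq C & ptree C
  | Idt of ptree C
  | Asc of ptree C & ptree C & ptree C
  | AscI of ptree C & ptree C & ptree C
  | Lam of ptree C | LamI of ptree C | Rho of ptree C | RhoI of ptree C
  | Hc of term C & term C
  | Vlr of term C & term C
  | Vrl of term C & term C.

(** * Layers and the coherence theorem *)

Section Terms.
Variable C : doubleCat.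
Let L := dc_laws C.
Implicit Types (m n M : Pr C) (φ ψ χ : Sq C) (a b c e : ptree C) (p q : seq (Pr C)).
Implicit Types (l : layer C) (s : seq (layer C)) (t u : term C).

Fixpoint tdom t : ptree C :=
  match t with
  | Gen a _ _ => a | Idt a => a
  | Asc a b c => Cp (Cp a b) c | AscI a b c => Cp a (Cp b c)
  | Lam a => Cp (Un (esrc a)) a | LamI a => a
  | Rho a => Cp a (Un (etgt a)) | RhoI a => a
  | Hc t _ => tdom t
  | Vlr t u => Cp (tdom t) (tdom u) | Vrl t u => Cp (tdom t) (tdom u)
  end.

Fixpoint tcod t : ptree C :=
  match t with
  | Gen _ _ b => b | Idt a => a
  | Asc a b c => Cp a (Cp b c) | AscI a b c => Cp (Cp a b) c
  | Lam a => a | LamI a => Cp (Un (esrc a)) a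
  | Rho a => a | RhoI a => Cp a (Un (etgt a))
  | Hc _ u => tcod u
  | Vlr t u => Cp (tcod t) (tcod u) | Vrl t u => Cp (tcod t) (tcod u)
  end.

Fixpoint sem t : Sq C :=
  match t with
  | Gen _ φ _ => φ | Idt a => sid (ev a)
  | Asc a b c => assoc (ev a) (ev b) (ev c)
  | AscI a b c => assocI (ev a) (ev b) (ev c)
  | Lam a => lam (ev a) | LamI a => lamI (ev a)
  | Rho a => rho (ev a) | RhoI a => rhoI (ev a)
  | Hc t u => sem t ·ₛ sem u
  | Vlr t u => sem t ⊙ₛ sem u | Vrl t u => sem t ⊙ₛ sem u
  end.

Fixpoint wft t : Prop :=
  match t with
  | Gen a φ b => [/\ wfe a, wfe b & disk (ev a) (ev b) φ]
  | Asc a b c | AscI a b c => wfe (Cp (Cp a b) c)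
  | Idt a | Lam a | LamI a | Rho a | RhoI a => wfe a
  | Hc t u => [/\ wft t, wft u & tcod t = tdom u]
  | Vlr t u | Vrl t u => [/\ wft t, wft u & etgt (tdom t) = esrc (tdom u)]
  end.

Definition addpre p l := Layer (p ++ lpre l) (ldom l) (lsq l) (lcod l) (lsuf l).
Definition addsuf q l := Layer (lpre l) (ldom l) (lsq l) (lcod l) (lsuf l ++ q).

Fixpoint nf t : seq (layer C) :=
  match t with
  | Gen a φ b => [:: Layer [::] a φ b [::]]
  | Hc t u => nf t ++ nf u
  | Vlr t u => map (addsuf (flat (tdom u))) (nf t) ++ map (addpre (flat (tcod t))) (nf u)
  | Vrl t u => map (addpre (flat (tdom t))) (nf u) ++ map (addsuf (flat (tcod u))) (nf t)
  | _ => [::]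
  end.

Lemma wft_spec t : wft t ->
  [/\ wfe (tdom t), wfe (tcod t), esrc (tdom t) = esrc (tcod t),
      etgt (tdom t) = etgt (tcod t) & disk (ev (tdom t)) (ev (tcod t)) (sem t)].
Proof.
elim: t => //=.
- move=> a φ b [wa wb D]; have [h k] := disk_bdy D.
  have [h1 h2] := bdy_ev wa; have [h3 h4] := bdy_ev wb.
  by split=> //; congruence.
- by move=> a w; split=> //; apply: disk_id.
- move=> a b c [[wa wb e1] wc e2].
  have [h1 h2] := bdy_ev wa; have [h3 h4] := bdy_ev wb; have [h5 h6] := bdy_ev wc.
  by split; [| | | |dk].
- move=> a b c [[wa wb e1] wc e2].
  have [h1 h2] := bdy_ev wa; have [h3 h4] := bdy_ev wb; have [h5 h6] := bdy_ev wc.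
  by split; [| | | |dk].
- by move=> a w; have [h1 h2] := bdy_ev w; split=> //; rewrite -h1; apply: lam_disk.
- by move=> a w; have [h1 h2] := bdy_ev w; split=> //; rewrite -h1; apply: lamI_disk.
- by move=> a w; have [h1 h2] := bdy_ev w; split=> //; rewrite -h2; apply: rho_disk.
- by move=> a w; have [h1 h2] := bdy_ev w; split=> //; rewrite -h2; apply: rhoI_disk.
- move=> t IHt u IHu [/IHt[a1 a2 a3 a4 a5] /IHu[b1 b2 b3 b4 b5] e].
  rewrite -e in b1 b3 b4 b5; split=> //; [congruence|congruence|dk].
- move=> t IHt u IHu [/IHt[a1 a2 a3 a4 a5] /IHu[b1 b2 b3 b4 b5] e].
  have [_ h1] := bdy_ev a1; have [h2 _] := bdy_ev b1.
  by split; [|split| | |dk]=> //; congruence.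
- move=> t IHt u IHu [/IHt[a1 a2 a3 a4 a5] /IHu[b1 b2 b3 b4 b5] e].
  have [_ h1] := bdy_ev a1; have [h2 _] := bdy_ev b1.
  by split; [|split| | |dk]=> //; congruence.
Qed.

(** Conjugation by normalisations gives a disk between left-nested paths, whatever bracketing [lsq]
    came with. *)
Definition lay M l : Sq C :=
  let N := pth M (lpre l) in
  suf (nrmI N (ldom l) ·ₛ ((sid N ⊙ₛ lsq l) ·ₛ nrm N (lcod l))) (lsuf l).

Fixpoint lsem M p s : Sq C :=
  if s is l :: s' then lay M l ·ₛ lsem M (lpre l ++ flat (lcod l) ++ lsuf l) s'
  else sid (pth M p).

Fixpoint chain (A : Ob C) p s q : Prop :=
  if s is l :: s' then
    [/\ p = lpre l ++ flat (ldom l) ++ lsuf l,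
        [/\ wfe (ldom l), wfe (lcod l) & disk (ev (ldom l)) (ev (lcod l)) (lsq l)],
        pend A (lpre l) = esrc (ldom l)
      & chain A (lpre l ++ flat (lcod l) ++ lsuf l) s' q]
  else p = q.

Lemma lay_disk M l : composable (ptgt M) (lpre l ++ flat (ldom l) ++ lsuf l) ->
  wfe (ldom l) -> wfe (lcod l) -> disk (ev (ldom l)) (ev (lcod l)) (lsq l) ->
  pend (ptgt M) (lpre l) = esrc (ldom l) ->
  composable (ptgt M) (lpre l ++ flat (lcod l) ++ lsuf l) /\
  disk (pth M (lpre l ++ flat (ldom l) ++ lsuf l))
       (pth M (lpre l ++ flat (lcod l) ++ lsuf l)) (lay M l).
Proof.
case: l => p a φ b q /= c wa wb D e.
have /composable_cat[c1 /composable_cat[c2 c3]] := c.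
have [f1 f2] := flat_ev wb; have [f3 f4] := flat_ev wa.
have [h1 h2] := bdy_ev wa; have [h3 h4] := bdy_ev wb; have [h5 h6] := disk_bdy D.
have [_ k] := bdy_pth c1; rewrite e in k.
have e' : esrc a = esrc b by congruence.
have e'' : etgt a = etgt b by congruence.
split.
  apply/composable_cat; split=> //; apply/composable_cat.
  by rewrite e e' f2 -e'' -f4 -e.
rewrite !pth_cat /lay /=; apply: suf_disk.
  have [_ ->] := pth_flat wa k; by rewrite -f4 -e.
have k' : ptgt (pth M p) = esrc b by congruence.
have N1 := nrmI_disk wa k; have N2 := nrm_disk wb k'.
by dk.
Qed.

Lemma lsem_disk M p s q : composable (ptgt M) p -> chain (ptgt M) p s q ->
  composable (ptgt M) q /\ disk (pth M p) (pth M q) (lsem M p s).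
Proof.
elim: s p => [|l s IH] p c /=; first by move=> <-; split=> //; apply: disk_id.
case=> e [wa wb D] h /IH{}IH; rewrite e in c *.
have [/IH[c' E] E'] := lay_disk c wa wb D h.
by split=> //; dk.
Qed.

Lemma chain_cat A p s q s' q' : chain A p s q -> chain A q s' q' ->
  chain A p (s ++ s') q'.
Proof. by elim: s p => [|l s IH] p /=; [move=> ->|case=> ? ? ? /IH h /h]. Qed.

Lemma lsem_cat M p s q s' q' : composable (ptgt M) p ->
  chain (ptgt M) p s q -> chain (ptgt M) q s' q' ->
  lsem M p (s ++ s') = lsem M p s ·ₛ lsem M q s'.
Proof.
elim: s p => [|l s IH] p c /=.
  by move=> <- k; have [_ D] := lsem_disk c k; rewrite (disk_idl D).
case=> e [wa wb D] h k k'; rewrite e in c *.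
have [c1 E] := lay_disk c wa wb D h.
rewrite (IH _ c1 k k'); have [c2 E2] := lsem_disk c1 k; have [c3 E3] := lsem_disk c2 k'.
by rewrite (disk_hcompA E E2 E3).
Qed.

Lemma chain_addsuf A p s q r : chain A p s q -> chain A (p ++ r) (map (addsuf r) s) (q ++ r).
Proof.
elim: s p => [|l s IH] p /=; first by move=> ->.
by case=> -> w e /IH; rewrite !catA.
Qed.

Lemma chain_addpre A p s q r : chain (pend A r) p s q ->
  chain A (r ++ p) (map (addpre r) s) (r ++ q).
Proof.
elim: s p => [|l s IH] p /=; first by move=> ->.
by case=> -> w e /IH; rewrite pend_cat !catA.
Qed.

(** Here left-nesting pays off: a prefix is merely a longer M, with no coherator in between. *)
Lemma lsem_addpre M p s r :
  lsem M (r ++ p) (map (addpre r) s) = lsem (pth M r) p s.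
Proof.
elim: s p => [|l s IH] p /=; first by rewrite pth_cat.
by rewrite -IH /lay /= pth_cat !catA.
Qed.

Lemma lsem_addsuf M p s q r : composable (ptgt M) (p ++ r) -> chain (ptgt M) p s q ->
  lsem M (p ++ r) (map (addsuf r) s) = suf (lsem M p s) r.
Proof.
elim: s p => [|l s IH] p /= c.
  case/composable_cat: c => c1 c2 _; rewrite pth_cat suf_id //.
  by have [_ ->] := bdy_pth c1.
case=> e [wa wb D] h k; rewrite e in c.
have /composable_cat[c1 c2] := c.
have [c3 E] := lay_disk c1 wa wb D h; have [c4 E'] := lsem_disk c3 k.
have cr : composable (ptgt (pth M (lpre l ++ flat (ldom l) ++ lsuf l))) r.
  by have [_ ->] := bdy_pth c1.
rewrite (suf_hcomp cr E E') -IH //; last first.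
  apply/composable_cat; split=> //.
  have [_ e1] := disk_bdy E; rewrite e1 in cr.
  by have [_ e2] := bdy_pth c3; rewrite e2 in cr.
by rewrite /lay /= suf_cat !catA.
Qed.

Lemma nf_chain t : wft t -> chain (esrc (tdom t)) (flat (tdom t)) (nf t) (flat (tcod t)).
Proof.
elim: t => //=.
- by move=> a φ b [wa wb D]; rewrite !cats0.
- by move=> a b c _; rewrite catA.
- by move=> a b c _; rewrite catA.
- by move=> a _; rewrite cats0.
- by move=> a _; rewrite cats0.
- move=> t IHt u IHu [wt wu e]; apply: chain_cat (IHt wt) _.
  have [_ _ h _ _] := wft_spec wt; rewrite e h e; exact: IHu.
- move=> t IHt u IHu [wt wu e].
  have [w1 w2 h1 h2 _] := wft_spec wt; have [w3 w4 h3 h4 _] := wft_spec wu.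
  apply: chain_cat (chain_addsuf _ (IHt wt)) _; apply: chain_addpre.
  by have [_] := flat_ev w2; rewrite -h1 -h2 e => ->; apply: IHu.
- move=> t IHt u IHu [wt wu e].
  have [w1 w2 h1 h2 _] := wft_spec wt; have [w3 w4 h3 h4 _] := wft_spec wu.
  apply: chain_cat (chain_addsuf _ (IHt wt)); apply: chain_addpre.
  by have [_] := flat_ev w1; rewrite e => ->; apply: IHu.
Qed.

(* Up to the normalisations of a and b, the disk φ with M in front is Φ. *)
Definition rep M a φ b Φ := (sid M ⊙ₛ φ) ·ₛ nrm M b = nrm M a ·ₛ Φ.

(** Reduces the inverse coherators to the direct ones, whose representatives are identities. *)
Lemma rep_inv M a b φ ψ : wfe a -> wfe b -> ptgt M = esrc a -> disk (ev a) (ev b) φ ->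
  flat a = flat b -> inverse φ ψ ->
  rep M a φ b (sid (pth M (flat a))) -> rep M b ψ a (sid (pth M (flat b))).
Proof.
rewrite /rep => wa wb h D e I.
have [h1 h2] := bdy_ev wa; have [h3 h4] := bdy_ev wb; have [h5 h6] := disk_bdy D.
have k : ptgt M = esrc b by congruence.
have N1 := nrm_disk wa h; have N2 := nrm_disk wb k.
have D' := disk_inverse D I; have M1 : ptgt M = psrc (ev a) by congruence.
rewrite (disk_idr N1) (disk_idr N2) => <-.
have A1 := disk_vcomp M1 (disk_id M) D.
have M2 : ptgt M = psrc (ev b) by congruence.
have A2 := disk_vcomp M2 (disk_id M) D'.
rewrite -(disk_hcompA A2 A1 N2) -(vcomp_hcompl M2 D' D) (inv_cancelI D I).
by rewrite (vcomp_id L) // (disk_idl N2).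
Qed.

Lemma rep_hcomp M a b c φ ψ Φ Ψ : wfe a -> wfe b -> wfe c -> ptgt M = esrc a ->
  disk (ev a) (ev b) φ -> disk (ev b) (ev c) ψ ->
  disk (pth M (flat a)) (pth M (flat b)) Φ -> disk (pth M (flat b)) (pth M (flat c)) Ψ ->
  rep M a φ b Φ -> rep M b ψ c Ψ -> rep M a (φ ·ₛ ψ) c (Φ ·ₛ Ψ).
Proof.
rewrite /rep => wa wb wc h D E D' E' e e'.
have [h1 h2] := bdy_ev wa; have [h3 h4] := bdy_ev wb; have [h5 h6] := bdy_ev wc.
have [k1 k2] := disk_bdy D; have [k3 k4] := disk_bdy E.
have h' : ptgt M = esrc b by congruence.
have h'' : ptgt M = esrc c by congruence.
have N1 := nrm_disk wa h; have N2 := nrm_disk wb h'; have N3 := nrm_disk wc h''.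
have M1 : ptgt M = psrc (ev a) by congruence.
have M2 : ptgt M = psrc (ev b) by congruence.
rewrite (vcomp_hcompl M1 D E).
have A1 := disk_vcomp M1 (disk_id M) D; have A2 := disk_vcomp M2 (disk_id M) E.
rewrite (disk_hcompA A1 A2 N3) e' -(disk_hcompA A1 N2 E') e.
by rewrite (disk_hcompA N1 D' E').
Qed.

(** By interchange φ acts first and ψ second; φ is carried past the normalisation of [a'] by
    [nrm_nat], which turns it into a suffixed disk. This order is the one of [Vlr]. *)
Lemma rep_vcomp M a b a' b' φ ψ Φ Ψ :
  wfe (Cp a a') -> wfe (Cp b b') -> ptgt M = esrc a ->
  disk (ev a) (ev b) φ -> disk (ev a') (ev b') ψ ->
  disk (pth M (flat a)) (pth M (flat b)) Φ ->
  disk (pth M (flat b ++ flat a')) (pth M (flat b ++ flat b')) Ψ ->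
  rep M a φ b Φ -> rep (pth M (flat b)) a' ψ b' Ψ ->
  rep M (Cp a a') (φ ⊙ₛ ψ) (Cp b b') (suf Φ (flat a') ·ₛ Ψ).
Proof.
rewrite /rep => /=.
move=> [wa wa' ea] [wb wb' eb] h D E D' E' e e'; rewrite !pth_cat in E'.
have [h1 h2] := bdy_ev wa; have [h3 h4] := bdy_ev wb.
have [h1' h2'] := bdy_ev wa'; have [h3' h4'] := bdy_ev wb'.
have [k1 k2] := disk_bdy D; have [k3 k4] := disk_bdy E.
have h' : ptgt M = esrc b by congruence.
have N1 := nrm_disk wa h; have N2 := nrm_disk wb h'.
have [p1 p2] := pth_flat wa h; have [p3 p4] := pth_flat wb h'.
have q1 : ptgt (pth M (flat a)) = esrc a' by congruence.
have q2 : ptgt (pth M (flat b)) = esrc b' by congruence.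
have q3 : ptgt (pth M (flat b)) = esrc a' by congruence.
have N3 := nrm_disk wa' q1; have N4 := nrm_disk wb' q2; have N5 := nrm_disk wa' q3.
have c1 : composable (ptgt (pth M (flat a))) (flat a').
  by rewrite q1; case: (flat_ev wa').
have S1 := suf_disk c1 D'.
have M1 : ptgt M = psrc (ev a) by congruence.
have M2 : ptgt M = psrc (ev b) by congruence.
have A1 := disk_vcomp M1 (disk_id M) D.
hA.
rewrite -(hcompA L); [|cmp|cmp].
rewrite (assocI_nat_disk (m := M) (n := ev a) (p := ev a') (m' := M) (n' := ev b) (p' := ev b'));
  try first [ob|dk].
hA; congr hcomp.
rewrite -(hcompA L); [|cmp|cmp].
transitivity ((((sid M ⊙ₛ φ) ·ₛ nrm M b) ⊙ₛ ψ) ·ₛ nrm (pth M (flat b)) b').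
  congr hcomp; rewrite -(disk_interchange (m := M ⊙ ev a) (m' := ev a')
    (n := M ⊙ ev b) (n' := ev b') (p := pth M (flat b)) (p' := ev b')); try first [ob|dk].
  by rewrite (disk_idr E).
rewrite e (vcomp_lr (m := M ⊙ ev a) (n := pth M (flat b)) (m' := ev a') (n' := ev b'));
  try first [ob|dk].
hA; rewrite e' -(hcompA L); [|cmp|cmp].
rewrite (vcomp_hcompr (m := M ⊙ ev a) (n := pth M (flat a)) (p := pth M (flat b)));
  try first [ob|dk].
hA; rewrite -(hcompA L (ψ := nrm _ a')); [|cmp|cmp].
by rewrite (nrm_nat wa' q1 D'); hA.
Qed.

(** The pentagon with four of its five associators inverted, which is the shape that the two
    normalisations produce in [rep_assoc]. *)
Lemma pentagonI m n (p q : Pr C) : ptgt m = psrc n -> ptgt n = psrc p -> ptgt p = psrc q ->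
  (sid m ⊙ₛ assoc n p q) ·ₛ assocI m n (p ⊙ q) ·ₛ assocI (m ⊙ n) p q
  = assocI m (n ⊙ p) q ·ₛ (assocI m n p ⊙ₛ sid q).
Proof.
move=> h1 h2 h3.
have P := pentagon L h1 h2 h3.
have I1 : inverse (assoc m n p ⊙ₛ sid q) (assocI m n p ⊙ₛ sid q).
  apply: (inverse_vcomp (m := m ⊙ n ⊙ p) (m' := m ⊙ (n ⊙ p)) (n := q) (n' := q)).
  - by ob.
  - by dk.
  - by dk.
  - exact: (assoc_inverse L).
  - exact: inverse_id.
have I2 : inverse (assoc m (n ⊙ p) q) (assocI m (n ⊙ p) q) by apply: (assoc_inverse L); ob.
have I3 : inverse (assoc (m ⊙ n) p q) (assocI (m ⊙ n) p q) by apply: (assoc_inverse L); ob.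
have I4 : inverse (assoc m n (p ⊙ q)) (assocI m n (p ⊙ q)) by apply: (assoc_inverse L); ob.
have D1 : disk (m ⊙ n ⊙ p ⊙ q) (m ⊙ (n ⊙ p ⊙ q))
  ((assoc m n p ⊙ₛ sid q) ·ₛ assoc m (n ⊙ p) q) by dk.
apply: (disk_cancell (p := m ⊙ n ⊙ p ⊙ q) D1).
- by exists (assocI m (n ⊙ p) q ·ₛ (assocI m n p ⊙ₛ sid q)); apply: inverse_hcomp => //; cmp.
- by dk.
- by dk.
rewrite (inv_cancel D1 (inverse_hcomp _ I1 I2)); last by cmp.
rewrite -!(hcompA L); try cmp.
rewrite -P (hcompA L (ψ := assoc m n (p ⊙ q))); [|cmp|cmp].
rewrite (inv_cancel (m := m ⊙ n ⊙ (p ⊙ q)) (n := m ⊙ (n ⊙ (p ⊙ q))) _ I4); last by dk.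
rewrite (disk_idr (m := m ⊙ n ⊙ p ⊙ q) (n := m ⊙ n ⊙ (p ⊙ q))); last by dk.
by rewrite (inv_cancel (m := m ⊙ n ⊙ p ⊙ q) (n := m ⊙ n ⊙ (p ⊙ q)) _ I3); last by dk.
Qed.

(** This is the pentagon with M as its first proarrow; the rest is naturality of [assocI]. *)
Lemma rep_assoc M a b c : wfe (Cp (Cp a b) c) -> ptgt M = esrc a ->
  rep M (Cp (Cp a b) c) (assoc (ev a) (ev b) (ev c)) (Cp a (Cp b c))
    (sid (pth M (flat (Cp (Cp a b) c)))).
Proof.
move=> w h; have /= [[wa wb e1] wc e2] := w; rewrite /rep (disk_idr (nrm_disk w h)) /=.
have [h1 h2] := bdy_ev wa; have [h3 h4] := bdy_ev wb; have [h5 h6] := bdy_ev wc.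
have [p1 p2] := pth_flat wa h.
have q1 : ptgt (pth M (flat a)) = esrc b by congruence.
have [p3 p4] := pth_flat wb q1.
have q2 : ptgt (pth (pth M (flat a)) (flat b)) = esrc c by congruence.
have N1 := nrm_disk wa h; have N2 := nrm_disk wb q1; have N3 := nrm_disk wc q2.
rewrite !pth_cat.
rewrite (vcomp_hcompr (m := M ⊙ (ev a ⊙ ev b)) (n := pth M (flat a) ⊙ ev b)
  (p := pth (pth M (flat a)) (flat b))); try first [ob|dk].
rewrite (vcomp_hcompr (m := M ⊙ (ev a ⊙ ev b)) (n := M ⊙ ev a ⊙ ev b)
  (p := pth M (flat a) ⊙ ev b)); try first [ob|dk].
hA.
rewrite -!(hcompA L); try cmp.
do 2!congr hcomp.
rewrite (hcompA L) -?(vcomp_id L); try first [ob|cmp].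
rewrite (assocI_nat_disk (m := M ⊙ ev a) (m' := pth M (flat a))
  (n := ev b) (p := ev c) (n' := ev b) (p' := ev c));
  try first [ob|dk].
rewrite -!(hcompA L); try cmp.
by rewrite pentagonI; try ob.
Qed.

(** With M in front, the left unitor stands between two proarrows, so the middle [triangle]
    applies. *)
Lemma rep_lam M a : wfe a -> ptgt M = esrc a ->
  rep M (Cp (Un (esrc a)) a) (lam (ev a)) a (sid (pth M (flat a))).
Proof.
move=> w h; have [h1 h2] := bdy_ev w; have N := nrm_disk w h.
have N' : disk (M ⊙ (pU (esrc a) ⊙ ev a)) (pth M (flat a)) (nrm M (Cp (Un (esrc a)) a)).
  by apply: nrm_disk.
rewrite /rep (disk_idr N') /= -h.
rewrite -(triangle L); last by ob.
have k : ptgt M = psrc (pU (ptgt M)) by ob.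
have k' : ptgt (pU (ptgt M)) = psrc (ev a) by ob.
have D : disk (pU (ptgt M) ⊙ ev a) (ev a) (lam (ev a)).
  by rewrite h -h1; apply: lam_disk.
rewrite -!(hcompA L); try cmp.
rewrite (inv_cancelI (assoc_disk L k k') (assoc_inverse L k k')).
by rewrite (disk_idl (m := M ⊙ (pU (ptgt M) ⊙ ev a)) (n := M ⊙ ev a)); last by dk.
Qed.

(** The unit stands at the right end here, so the triangle needed is the derived one, [rho_comp]. *)
Lemma rep_rho M a : wfe a -> ptgt M = esrc a ->
  rep M (Cp a (Un (etgt a))) (rho (ev a)) a (sid (pth M (flat a ++ [::]))).
Proof.
rewrite cats0.
move=> w h; have [h1 h2] := bdy_ev w; have N := nrm_disk w h.
have [k1 k2] := pth_flat w h.
have N' : disk (M ⊙ (ev a ⊙ pU (etgt a))) (pth M (flat a)) (nrm M (Cp a (Un (etgt a)))).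
  by rewrite -[X in disk _ (pth M X)]cats0; apply: nrm_disk.
rewrite /rep (disk_idr N') /=.
have s : ptgt (M ⊙ ev a) = etgt a by ob.
have t : ptgt M = psrc (ev a) by ob.
have R := rho_nat_disk N; rewrite s in R.
have R1 : disk (M ⊙ ev a ⊙ pU (etgt a)) (M ⊙ ev a) (rho (M ⊙ ev a)).
  by rewrite -s; apply: rho_disk.
have R2 : disk (pth M (flat a) ⊙ pU (etgt a)) (pth M (flat a)) (rho (pth M (flat a))).
  by rewrite -k2; apply: rho_disk.
have R3 : disk (ev a ⊙ pU (etgt a)) (ev a) (rho (ev a)).
  by rewrite -h2; apply: rho_disk.
rewrite (hcompA L) ?R; try cmp.
rewrite rho_comp // h2 -!(hcompA L); try cmp.
have q : ptgt (ev a) = psrc (pU (etgt a)) by ob.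
rewrite (inv_cancelI (assoc_disk L t q) (assoc_inverse L t q)).
by rewrite (disk_idl (m := M ⊙ (ev a ⊙ pU (etgt a))) (n := M ⊙ ev a)); last by dk.
Qed.

Lemma rep_id M a : wfe a -> ptgt M = esrc a ->
  rep M a (sid (ev a)) a (sid (pth M (flat a))).
Proof.
move=> w h; have [h1 h2] := bdy_ev w; have N := nrm_disk w h.
by rewrite /rep (vcomp_id L) ?(disk_idl N) ?(disk_idr N) //; congruence.
Qed.

(** Soundness of [nf]. Only the generators contribute layers; every coherator case is one of the
    lemmas above with an identity as representative. *)
Lemma sem_rep t M : wft t -> ptgt M = esrc (tdom t) ->
  rep M (tdom t) (sem t) (tcod t) (lsem M (flat (tdom t)) (nf t)).
Proof.
elim: t M => [a φ b|a|a b c|a b c|a|a|a|a|t IHt u IHu|t IHt u IHu|t IHt u IHu] M w h.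
- case: w => wa wb D; rewrite /rep /= !cats0 /lay /=.
  have [h1 h2] := bdy_ev wa; have [h3 h4] := bdy_ev wb; have [k1 k2] := disk_bdy D.
  have h' : ptgt M = esrc b by rewrite h /=; congruence.
  have N1 := nrm_disk wa h; have N2 := nrm_disk wb h'; have N3 := nrm_inverse wa h.
  have N4 := nrm_disk wa h; have N5 := nrmI_disk wa h.
  rewrite (disk_idr (m := pth M (flat a)) (n := pth M (flat b))); last by dk.
  rewrite -!(hcompA L); try cmp.
  rewrite (inv_cancel N4 N3) (disk_idl (m := M ⊙ ev a) (n := M ⊙ ev b)) //.
  by dk.
- by apply: rep_id.
- exact: rep_assoc.
- case: (w) => /= [[wa wb e1] wc e2].
  have [h1 h2] := bdy_ev wa; have [h3 h4] := bdy_ev wb; have [h5 h6] := bdy_ev wc.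
  apply: rep_inv (rep_assoc w h) => //=.
  + by dk.
  + by rewrite catA.
  + by apply: (assoc_inverse L); congruence.
- exact: rep_lam.
- have /= e := h; apply: rep_inv (rep_lam w h) => //=.
  + by have [_ _ _ _] := wft_spec (t := Lam a) w.
  + exact: lam_inverse.
- exact: rep_rho.
- have /= e := h; apply: rep_inv (rep_rho w h) => //=.
  + by have [_ _ _ _] := wft_spec (t := Rho a) w.
  + by rewrite cats0.
  + exact: rho_inverse.
- case: w => wt wu e.
  have [t1 t2 t3 t4 t5] := wft_spec wt; have [u1 u2 u3 u4 u5] := wft_spec wu.
  have h' : ptgt M = esrc (tdom u) by rewrite -e h /= t3.
  have ct := nf_chain wt; have cu := nf_chain wu.
  have [f1 _] := flat_ev t1; have [f2 _] := flat_ev u1.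
  rewrite -[esrc _]h in ct f1; rewrite -h' in cu f2.
  have [_ Dt] := lsem_disk f1 ct; have [_ Du] := lsem_disk f2 cu.
  have rt := IHt M wt h; have ru := IHu M wu h'; rewrite e in t2 t5 Dt rt ct.
  by rewrite /= (lsem_cat f1 ct cu); apply: rep_hcomp rt ru.
- case: w => wt wu e.
  have [t1 t2 t3 t4 t5] := wft_spec wt; have [u1 u2 u3 u4 u5] := wft_spec wu.
  have {}h : ptgt M = esrc (tdom t) := h.
  have h0 : ptgt M = esrc (tcod t) by rewrite -t3.
  have [p1 p2] := pth_flat t2 h0.
  have h' : ptgt (pth M (flat (tcod t))) = esrc (tdom u) by rewrite p2 -t4.
  have ct := nf_chain wt; have cu := nf_chain wu.
  have [f1 g1] := flat_ev t1; have [f2 _] := flat_ev u1; have [f3 g3] := flat_ev t2.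
  rewrite -h in ct f1 g1; rewrite -h' in cu f2; rewrite -h0 in f3 g3.
  have [_ Dt] := lsem_disk f1 ct; have [_ Du] := lsem_disk f2 cu.
  have [_ q2] := bdy_pth f3.
  have f4 : composable (ptgt M) (flat (tdom t) ++ flat (tdom u)).
    by apply/composable_cat; split=> //; rewrite g1 e -h'.
  rewrite /= (lsem_cat f4 (chain_addsuf _ ct) (chain_addpre (q := flat (tcod u)) _)); last first.
    by rewrite -q2; exact: cu.
  rewrite (lsem_addsuf f4 ct) lsem_addpre.
  by apply: rep_vcomp (IHt _ wt h) (IHu _ wu h') => //; [split=> //; congruence|rewrite !pth_cat].
- case: w => wt wu e.
  have [t1 t2 t3 t4 t5] := wft_spec wt; have [u1 u2 u3 u4 u5] := wft_spec wu.
  have [e1 e2] := bdy_ev t1; have [e3 e4] := bdy_ev u1.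
  have {}h : ptgt M = esrc (tdom t) := h.
  have [p1 p2] := pth_flat t1 h.
  have h' : ptgt (pth M (flat (tdom t))) = esrc (tdom u) by rewrite p2.
  have ct := nf_chain wt; have cu := nf_chain wu.
  have [f1 g1] := flat_ev t1; have [f2 _] := flat_ev u1; have [f3 g3] := flat_ev u2.
  rewrite -h in ct f1 g1; rewrite -h' in cu f2.
  have [c1 Dt] := lsem_disk f1 ct; have [c2 Du] := lsem_disk f2 cu.
  have [_ q2] := bdy_pth f1.
  have f4 : composable (ptgt M) (flat (tdom t) ++ flat (tdom u)).
    by apply/composable_cat; split=> //; rewrite g1 e -h'.
  have f5 : composable (ptgt M) (flat (tdom t) ++ flat (tcod u)).
    by apply/composable_cat; split=> //; rewrite -q2.
  have f6 : composable (ptgt (pth M (flat (tdom t)))) (flat (tcod u)) by [].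
  have ep : etgt (tdom t) = esrc (tcod u) by congruence.
  rewrite /= (lsem_cat f4 (chain_addpre (q := flat (tcod u)) _) (chain_addsuf _ ct)); last first.
    by rewrite -q2; exact: cu.
  rewrite (lsem_addsuf f5 ct) lsem_addpre.
  rewrite (vcomp_rl (m := ev (tdom t)) (n := ev (tcod t)) (m' := ev (tdom u)) (n' := ev (tcod u)));
    try first [ob|dk].
  have S1 : disk (pth M (flat (tdom t) ++ flat (tdom u))) (pth M (flat (tdom t) ++ flat (tcod u)))
     (lsem (pth M (flat (tdom t))) (flat (tdom u)) (nf u)) by rewrite !pth_cat.
  have S2 := suf_disk f6 Dt.
  (* The right factor acts first, through the intermediate bracketing [Cp (tdom t) (tcod u)]; both
     halves are instances of [rep_vcomp] with an identity as the other factor. *)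
  apply: (rep_hcomp (b := Cp (tdom t) (tcod u))) => //=.
  + by split=> //; congruence.
  + by have [? ?] := bdy_ev u2; dk.
  + by have [? ?] := bdy_ev u2; dk.
  + by rewrite !pth_cat.
  + rewrite -(disk_idl S1) pth_cat -suf_id //.
    apply: rep_vcomp (rep_id t1 h) (IHu _ wu h') => //; apply: disk_id.
  + have k : ptgt (pth M (flat (tcod t))) = esrc (tcod u).
      by have [_ ->] := pth_flat t2 (etrans h t3); congruence.
    rewrite -(disk_idr S2) -pth_cat; apply: rep_vcomp (IHt _ wt h) _ => //.
    * by split=> //; congruence.
    * by apply: disk_id.
    * by rewrite !pth_cat; apply: disk_id.
    * by rewrite pth_cat; apply: rep_id.
Qed.

(** Typing of [s'] is a conclusion rather than a hypothesis, so successive rewritings compose and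
    only the first list has to be typed. *)
Definition eqv (A : Ob C) p q s s' := chain A p s q ->
  chain A p s' q /\
  forall M, ptgt M = A -> composable A p -> lsem M p s = lsem M p s'.

Lemma eqv_refl A p q s : eqv A p q s s.
Proof. by []. Qed.

Lemma eqv_trans A p q s s' s'' : eqv A p q s s' -> eqv A p q s' s'' -> eqv A p q s s''.
Proof.
by move=> h k /h[/k[c e] e']; split=> // M hM hc; rewrite e' // e.
Qed.

(** The converse direction to coherence: an equation of squares is transported to layers by
    cancelling the invertible normalisation of the domain in [sem_rep]. *)
Lemma lsem_ext M t u : wft t -> wft u -> tdom t = tdom u -> tcod t = tcod u ->
  sem t = sem u -> ptgt M = esrc (tdom t) ->
  lsem M (flat (tdom t)) (nf t) = lsem M (flat (tdom t)) (nf u).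
Proof.
move=> wt wu e1 e2 e h; have [t1 t2 t3 _ _] := wft_spec wt.
have ct := nf_chain wt; have cu := nf_chain wu; rewrite -e1 -e2 in cu.
have [f1 _] := flat_ev t1; rewrite -h in ct cu f1.
have [_ D1] := lsem_disk f1 ct; have [_ D2] := lsem_disk f1 cu.
apply: (disk_cancell (nrm_disk t1 h) _ D1 D2).
  by exists (nrmI M (tdom t)); apply: nrm_inverse.
have R := sem_rep wt h; rewrite e1 in h.
by have := sem_rep wu h; rewrite -e1 -e2 -e -R.
Qed.

Lemma chain_split A p s s' q : chain A p (s ++ s') q ->
  exists r, chain A p s r /\ chain A r s' q.
Proof.
elim: s p => [|l s IH] p /=; first by exists p.
by case=> e w h /IH[r [c1 c2]]; exists r.
Qed.

Definition addctx p q l := addpre p (addsuf q l).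

(** Makes an equation of squares available in the middle of a list of layers: [lsem_addpre] and
    [lsem_addsuf] strip the context, and [lsem_ext] compares what is left. *)
Lemma eqv_step A p q s1 s2 p' q' t u : wft t -> wft u ->
  tdom t = tdom u -> tcod t = tcod u -> sem t = sem u ->
  chain A p s1 (p' ++ flat (tdom t) ++ q') -> pend A p' = esrc (tdom t) ->
  eqv A p q (s1 ++ map (addctx p' q') (nf t) ++ s2) (s1 ++ map (addctx p' q') (nf u) ++ s2).
Proof.
move=> wt wu e1 e2 e c1 h c.
have {c} c2 : chain A (p' ++ flat (tdom t) ++ q') (map (addctx p' q') (nf t) ++ s2) q.
  have [r [d1 d2]] := chain_split c.
  (* The end of a chain is determined by its start and its layers. *)
  suff -> : p' ++ flat (tdom t) ++ q' = r by [].
  by elim: s1 p {c} c1 d1 => [|l s IH] p0 /= => [-> ->|[_ _ _ c1] [_ _ _ d1]] //; apply: IH d1.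
have ct := nf_chain wt; have cu := nf_chain wu; rewrite -e1 -e2 in cu.
have K v : chain (esrc (tdom t)) (flat (tdom t)) (nf v) (flat (tcod t)) ->
    chain A (p' ++ flat (tdom t) ++ q') (map (addctx p' q') (nf v)) (p' ++ flat (tcod t) ++ q').
  move=> cv; rewrite [map _ _](map_comp (addpre p')); apply: chain_addpre.
  by apply: chain_addsuf; rewrite h.
have [r [d1 d2]] := chain_split c2.
have er : r = p' ++ flat (tcod t) ++ q'.
  move: (K t ct) d1; move: (map _ _) (p' ++ flat (tdom t) ++ q') => s p0.
  by elim: s p0 => [|l s IH] p0 /= => [-> ->|[_ _ _ k1] [_ _ _ k2]] //; apply: IH k2.
rewrite {r}er in d1 d2.
have d3 := K u cu; have c3 := chain_cat d3 d2.
split; first by apply: chain_cat c1 c3.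
move=> M hM cM; rewrite -hM in c1 c2 c3 d1 d2 d3 h cM.
rewrite (lsem_cat cM c1 c2) (lsem_cat cM c1 c3); congr hcomp.
have [cP _] := lsem_disk cM c1.
rewrite (lsem_cat cP d1 d2) (lsem_cat cP d3 d2); congr hcomp.
have /composable_cat[k1 k2] := cP.
have [_ eP] := bdy_pth k1; rewrite h in eP.
have k2' : composable (ptgt (pth M p')) (flat (tdom t) ++ q') by rewrite eP -h.
rewrite [map _ (nf t)](map_comp (addpre p')) [map _ (nf u)](map_comp (addpre p')) !lsem_addpre.
rewrite (lsem_addsuf (q := flat (tcod t)) k2') ?eP //.
rewrite (lsem_addsuf (q := flat (tcod t)) k2') ?eP //.
by rewrite (lsem_ext wt wu).
Qed.

(* Coherators have the empty normal form, so an equation between composites of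
   disks and coherators only depends on the layers of its disks. *)
Theorem coherence t u : wft t -> wft u -> tdom t = tdom u -> tcod t = tcod u ->
  eqv (esrc (tdom t)) (flat (tdom t)) (flat (tcod t)) (nf t) (nf u) -> sem t = sem u.
Proof.
move=> wt wu e1 e2 e3; set A := esrc (tdom t).
(* The prefix M is specialised to a unit, which naturality of [lam] removes at the end. *)
have s : ptgt (pU A) = esrc (tdom t) by apply: (ptgt_U L).
have [t1 t2 t3 t4 t5] := wft_spec wt; have [_ _ _ _ u5] := wft_spec wu.
have [_ E0] := e3 (nf_chain wt); have {}E0 := E0 _ s (proj1 (flat_ev t1)).
have := sem_rep wt s; have := sem_rep wu; rewrite -e1 -e2 E0 => /(_ _ s).
rewrite /rep => <-.
rewrite -e1 -e2 in u5; have [h1 h2] := bdy_ev t1; have [h3 h4] := bdy_ev t2.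
have s' : ptgt (pU A) = esrc (tcod t) by rewrite s.
have q : ptgt (pU A) = psrc (ev (tdom t)) by rewrite s.
have D1 := disk_vcomp q (disk_id _) t5; have D2 := disk_vcomp q (disk_id _) u5.
move/(disk_cancelr (nrm_disk t2 s') (ex_intro _ _ (nrm_inverse t2 s')) D1 D2) => E.
apply: (disk_cancell (lam_disk L (ev (tdom t))) _ t5 u5).
  by exists (lamI (ev (tdom t))); apply: (lam_inverse L).
by rewrite -(lam_nat_disk t5) -(lam_nat_disk u5) h1 -/A E.
Qed.
End Terms.

(** * Reification tactics *)

Ltac rex m := lazymatch m with
  | ?a ⊙ ?b => let x := rex a in let y := rex b in constr:(Cp x y)
  | pU ?A => constr:(Un A)
  | _ => constr:(At m)
  end.

(** The bracketings at the two ends of an opaque disk are read off its [disk] hypothesis; this is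
    why the proofs below put such a hypothesis into the context for each generator before calling
    [coh]. *)
Ltac rterm f := lazymatch f with
  | ?x ·ₛ ?y => let t := rterm x in let u := rterm y in constr:(Hc t u)
  | ?x ⊙ₛ ?y => let t := rterm x in let u := rterm y in constr:(Vlr t u)
  | sid ?m => let a := rex m in constr:(Idt a)
  | assoc ?m ?n ?p =>
      let a := rex m in let b := rex n in let c := rex p in constr:(Asc a b c)
  | assocI ?m ?n ?p =>
      let a := rex m in let b := rex n in let c := rex p in constr:(AscI a b c)
  | lam ?m => let a := rex m in constr:(Lam a)
  | lamI ?m => let a := rex m in constr:(LamI a)
  | rho ?m => let a := rex m in constr:(Rho a)
  | rhoI ?m => let a := rex m in constr:(RhoI a)
  | ?g => lazymatch goal with H : disk ?m ?n g |- _ =>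
      let a := rex m in let b := rex n in constr:(Gen a g b) end
  end.

Ltac wf_split := lazymatch goal with
  | |- disk _ _ _ => eassumption
  | |- and3 _ _ _ => split; wf_split
  | |- True => exact I
  | |- _ => ob
  end.
Ltac wf := rewrite /=; wf_split.

(** After computation the two lists of layers agree up to the equations between boundary objects in
    the context, which [congruence] supplies. *)
Ltac cohnf := rewrite /= /addpre /addsuf /=;
  match goal with |- eqv _ _ _ ?s ?s' => replace s' with s; [apply: eqv_refl|congruence] end.

Ltac coh := lazymatch goal with |- ?x = ?y =>
  let t := rterm x in let u := rterm y in
  apply: (@coherence _ t u);
    [wf|wf|rewrite /=; congruence|rewrite /=; congruence
    |cohnf] end.

Lemma rho_U (C : doubleCat) (A : Ob C) : rho (pU A) = lam (pU A).
Proof. coh. Qed.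
Lemma rhoI_U (C : doubleCat) (A : Ob C) : rhoI (pU A) = lamI (pU A).
Proof. coh. Qed.

(* α, β and γ applied in turn to a composite of p, q and r: at the left, the
   right and the left in tripL, at the right, the left and the right in tripR. *)
Definition tripL (C : dcData) (p q r p1 q1 q2 r1 p2 q3 : Pr C) (α β γ : Sq C) : Sq C :=
  assocI p q r ·ₛ (α ⊙ₛ sid r) ·ₛ assoc p1 q1 r ·ₛ (sid p1 ⊙ₛ β)
  ·ₛ assocI p1 q2 r1 ·ₛ (γ ⊙ₛ sid r1) ·ₛ assoc p2 q3 r1.

Definition tripR (C : dcData) (p q r q1 r1 q2 p1 q3 r2 : Pr C) (α β γ : Sq C) : Sq C :=
  assoc p q r ·ₛ (sid p ⊙ₛ α) ·ₛ assocI p q1 r1 ·ₛ (β ⊙ₛ sid r1)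
  ·ₛ assoc q2 p1 r1 ·ₛ (sid q2 ⊙ₛ γ) ·ₛ assocI q2 q3 r2.

(** * Slides and whiskerings *)

Section UnitSquares.
Variable C : doubleCat.
Let L := dc_laws C.
Implicit Types φ : Sq C.

Lemma lft_vcompU φ : lft (φ ⊙ₛ sU (bot φ)) = lft φ ⊙ pU (ptgt (lft φ)).
Proof. by rewrite (lft_vcomp L) ?(top_U L) // (lft_U L) (asrc_bot L). Qed.
Lemma rgt_vcompU φ : rgt (φ ⊙ₛ sU (bot φ)) = rgt φ ⊙ pU (ptgt (rgt φ)).
Proof. by rewrite (rgt_vcomp L) ?(top_U L) // (rgt_U L) (atgt_bot L). Qed.
Lemma lft_Uvcomp φ : lft (sU (top φ) ⊙ₛ φ) = pU (psrc (lft φ)) ⊙ lft φ.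
Proof. by rewrite (lft_vcomp L) ?(bot_U L) // (lft_U L) (asrc_top L). Qed.
Lemma rgt_Uvcomp φ : rgt (sU (top φ) ⊙ₛ φ) = pU (psrc (rgt φ)) ⊙ rgt φ.
Proof. by rewrite (rgt_vcomp L) ?(bot_U L) // (rgt_U L) (atgt_top L). Qed.

End UnitSquares.

Section Tensor.
Variable V : monoidalDC.
Let L := dc_laws V.
Implicit Types (m n p M : Pr V) (φ ψ χ : Sq V) (A B : Ob V).

Lemma psrc_tens m n : psrc (m ⊗ n) = psrc m ⊗ₒ psrc n.
Proof. exact: (fpr_src (tens V) (m, n)). Qed.
Lemma ptgt_tens m n : ptgt (m ⊗ n) = ptgt m ⊗ₒ ptgt n.
Proof. exact: (fpr_tgt (tens V) (m, n)). Qed.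
Lemma lft_tens φ ψ : lft (φ ⊗ₛ ψ) = lft φ ⊗ lft ψ.
Proof. exact: (fsq_lft (tens V) (φ, ψ)). Qed.
Lemma rgt_tens φ ψ : rgt (φ ⊗ₛ ψ) = rgt φ ⊗ rgt ψ.
Proof. exact: (fsq_rgt (tens V) (φ, ψ)). Qed.
Lemma top_tens φ ψ : top (φ ⊗ₛ ψ) = top φ ⊗ₐ top ψ.
Proof. exact: (fsq_top (tens V) (φ, ψ)). Qed.
Lemma bot_tens φ ψ : bot (φ ⊗ₛ ψ) = bot φ ⊗ₐ bot ψ.
Proof. exact: (fsq_bot (tens V) (φ, ψ)). Qed.
Lemma aid_tens A B : aid (A ⊗ₒ B) = aid A ⊗ₐ aid B.
Proof. exact: (esym (far_id (tens V) (A, B))). Qed.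
Lemma pU_tens A B : pU (A ⊗ₒ B) = pU A ⊗ pU B.
Proof. exact: (esym (fpr_U (tens V) (A, B))). Qed.
Lemma sU_tens (f g : Ar V) : sU (f ⊗ₐ g) = sU f ⊗ₛ sU g.
Proof. exact: (esym (fsq_U (tens V) (f, g))). Qed.
Lemma sid_tens m n : sid (m ⊗ n) = sid m ⊗ₛ sid n.
Proof. exact: (esym (fsq_id (tens V) (m, n))). Qed.
Lemma procomp_tens m n m' n' : ptgt m = psrc m' -> ptgt n = psrc n' ->
  (m ⊙ m') ⊗ (n ⊙ n') = (m ⊗ n) ⊙ (m' ⊗ n').
Proof. by move=> h k; apply: (fpr_comp (tens V) (m := (m, n)) (n := (m', n'))); congr pair. Qed.
Lemma hcomp_tens φ ψ φ' ψ' : rgt φ = lft φ' -> rgt ψ = lft ψ' ->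
  (φ ⊗ₛ ψ) ·ₛ (φ' ⊗ₛ ψ') = (φ ·ₛ φ') ⊗ₛ (ψ ·ₛ ψ').
Proof.
by move=> h k; symmetry; apply: (fsq_hcomp (tens V) (φ := (φ, ψ)) (ψ := (φ', ψ'))); congr pair.
Qed.
Lemma vcomp_tens φ ψ φ' ψ' : bot φ = top φ' -> bot ψ = top ψ' ->
  (φ ⊗ₛ ψ) ⊙ₛ (φ' ⊗ₛ ψ') = (φ ⊙ₛ φ') ⊗ₛ (ψ ⊙ₛ ψ').
Proof.
by move=> h k; symmetry; apply: (fsq_vcomp (tens V) (φ := (φ, ψ)) (ψ := (φ', ψ'))); congr pair.
Qed.
Lemma assoc_tens m n p m' n' p' : ptgt m = psrc n -> ptgt n = psrc p ->
  ptgt m' = psrc n' -> ptgt n' = psrc p' ->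
  assoc (m ⊗ m') (n ⊗ n') (p ⊗ p') = assoc m n p ⊗ₛ assoc m' n' p'.
Proof.
move=> h k h' k'; symmetry.
by apply: (fsq_assoc (tens V) (m := (m, m')) (n := (n, n')) (p := (p, p'))); congr pair.
Qed.
Lemma assocI_tens m n p m' n' p' : ptgt m = psrc n -> ptgt n = psrc p ->
  ptgt m' = psrc n' -> ptgt n' = psrc p' ->
  assocI (m ⊗ m') (n ⊗ n') (p ⊗ p') = assocI m n p ⊗ₛ assocI m' n' p'.
Proof.
move=> h k h' k'; symmetry.
by apply: (fsq_assocI (tens V) (m := (m, m')) (n := (n, n')) (p := (p, p'))); congr pair.
Qed.
Lemma lam_tens m n : lam (m ⊗ n) = lam m ⊗ₛ lam n.
Proof. exact: (esym (fsq_lam (tens V) (m, n))). Qed.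
Lemma rho_tens m n : rho (m ⊗ n) = rho m ⊗ₛ rho n.
Proof. exact: (esym (fsq_rho (tens V) (m, n))). Qed.
Lemma inverse_tens φ ψ φ' ψ' : inverse φ φ' -> inverse ψ ψ' ->
  inverse (φ ⊗ₛ ψ) (φ' ⊗ₛ ψ').
Proof. by move=> I J; apply: (fsq_inverse (tens V)); apply: inverse_pair. Qed.
Lemma lamI_tens m n : lamI (m ⊗ n) = lamI m ⊗ₛ lamI n.
Proof.
have I := lam_inverse L (m ⊗ n); rewrite lam_tens in I.
by apply: inverse_uniq I _; apply: inverse_tens; apply: (lam_inverse L).
Qed.
Lemma rhoI_tens m n : rhoI (m ⊗ n) = rhoI m ⊗ₛ rhoI n.
Proof.
have I := rho_inverse L (m ⊗ n); rewrite rho_tens in I.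
by apply: inverse_uniq I _; apply: inverse_tens; apply: (rho_inverse L).
Qed.
Lemma disk_tens m n m' n' φ ψ : disk m n φ -> disk m' n' ψ ->
  disk (m ⊗ m') (n ⊗ n') (φ ⊗ₛ ψ).
Proof.
case=> h1 h2 h3 h4 [k1 k2 k3 k4]; split.
- by rewrite lft_tens h1 k1.
- by rewrite rgt_tens h2 k2.
- by rewrite top_tens h3 k3 psrc_tens aid_tens.
- by rewrite bot_tens h4 k4 ptgt_tens aid_tens.
Qed.

Definition tunit : Ob V := fob (munit V) tt.
Lemma pU_tunit : pU tunit = fpr (munit V) tt.
Proof. exact: (esym (fpr_U (munit V) tt)). Qed.
Lemma sid_tunit : sid (pU tunit) = fsq (munit V) tt.
Proof. by rewrite pU_tunit; apply: (esym (fsq_id (munit V) tt)). Qed.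
Lemma aid_tunit : aid tunit = far (munit V) tt.
Proof. exact: (esym (far_id (munit V) tt)). Qed.
(** In the singleton double category the unitor is the identity square, and the unit functor
    preserves both strictly. *)
Lemma lam_tunit : lam (pU tunit) = sid (pU tunit).
Proof. by rewrite sid_tunit pU_tunit; apply: (esym (fsq_lam (munit V) tt)). Qed.
Lemma lamI_tunit : lamI (pU tunit) = sid (pU tunit).
Proof.
have I := lam_inverse L (pU tunit); rewrite lam_tunit in I.
by apply: inverse_uniq I (inverse_id _).
Qed.
Lemma tensI m : pU tunit ⊗ m = m.
Proof. by rewrite pU_tunit; apply: tens_prl. Qed.
Lemma tens_I m : m ⊗ pU tunit = m.
Proof. by rewrite pU_tunit; apply: tens_prr. Qed.
Lemma tensI_sq φ : sid (pU tunit) ⊗ₛ φ = φ.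
Proof. by rewrite sid_tunit; apply: tens_sql. Qed.
Lemma tens_I_sq φ : φ ⊗ₛ sid (pU tunit) = φ.
Proof. by rewrite sid_tunit; apply: tens_sqr. Qed.

Lemma disk_bot_top m m' n n' φ ψ : ptgt m = psrc n -> disk m m' φ -> disk n n' ψ ->
  bot φ = top ψ.
Proof. by move=> h [_ _ _ ->] [_ _ -> _]; rewrite h. Qed.

(** The one-factor part of a slide: [slide m n] is [turn m] tensored with [turnI n], so facts about
    slides reduce to facts about a proarrow passing a unit. *)
Definition turn m := rho m ·ₛ lamI m.
Definition turnI m := lam m ·ₛ rhoI m.

Lemma turn_disk m : disk (m ⊙ pU (ptgt m)) (pU (psrc m) ⊙ m) (turn m).
Proof. by rewrite /turn; dk. Qed.
Lemma turnI_disk m : disk (pU (psrc m) ⊙ m) (m ⊙ pU (ptgt m)) (turnI m).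
Proof. by rewrite /turnI; dk. Qed.
Lemma turn_inverse m : inverse (turn m) (turnI m).
Proof.
apply: inverse_hcomp (rho_inverse L m) (inverse_sym (lam_inverse L m)).
by cmp.
Qed.
Lemma turn_nat φ : (φ ⊙ₛ sU (bot φ)) ·ₛ turn (rgt φ) = turn (lft φ) ·ₛ (sU (top φ) ⊙ₛ φ).
Proof.
have [a1 a2 _ _] := rho_disk L (lft φ); have [b1 b2 _ _] := rho_disk L (rgt φ).
have [c1 c2 _ _] := lamI_disk (lft φ); have [d1 d2 _ _] := lamI_disk (rgt φ).
have [e1 e2 _ _] := lam_disk L (lft φ); have [f1 f2 _ _] := lam_disk L (rgt φ).
have E : φ ·ₛ lamI (rgt φ) = lamI (lft φ) ·ₛ (sU (top φ) ⊙ₛ φ).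
  by apply: inverse_swap (lam_inverse L _) (lam_inverse L _) (lam_nat L φ);
    rewrite ?rgt_Uvcomp.
rewrite /turn -(hcompA L) ?rgt_vcompU ?d1 //.
rewrite (rho_nat L) (hcompA L) ?E ?a2 ?d1 // -(hcompA L) ?lft_Uvcomp ?c1 ?a2 //.
Qed.

Lemma turnI_nat φ : (sU (top φ) ⊙ₛ φ) ·ₛ turnI (rgt φ) = turnI (lft φ) ·ₛ (φ ⊙ₛ sU (bot φ)).
Proof.
have [a1 a2 _ _] := turn_disk (lft φ); have [b1 b2 _ _] := turn_disk (rgt φ).
apply: inverse_swap (turn_inverse _) (turn_inverse _) (turn_nat φ).
- by rewrite rgt_vcompU.
- by rewrite lft_Uvcomp.
Qed.

Lemma slideE m n : slide m n = turn m ⊗ₛ turnI n.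
Proof.
have D1 := rho_disk L m; have D2 := lam_disk L n.
have D3 := lamI_disk m; have D4 := rhoI_disk n.
rewrite /slide sid_tens !hcomp_tens; try cmp.
by rewrite (disk_idr D1) (disk_idr D2).
Qed.

Lemma slideIE m n : slideI m n = turnI m ⊗ₛ turn n.
Proof.
have D1 := lam_disk L m; have D2 := rho_disk L n.
have D3 := rhoI_disk m; have D4 := lamI_disk n.
rewrite /slideI sid_tens !hcomp_tens; try cmp.
by rewrite (disk_idr D1) (disk_idr D2).
Qed.

Lemma slide_disk m n :
  disk (m ⊗ pU (psrc n) ⊙ pU (ptgt m) ⊗ n) (pU (psrc m) ⊗ n ⊙ m ⊗ pU (ptgt n)) (slide m n).
Proof.
rewrite slideE -!procomp_tens ?psrcU ?ptgtU //.
by apply: disk_tens; [apply: turn_disk|apply: turnI_disk].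
Qed.

Lemma slideI_disk m n :
  disk (pU (psrc m) ⊗ n ⊙ m ⊗ pU (ptgt n)) (m ⊗ pU (psrc n) ⊙ pU (ptgt m) ⊗ n) (slideI m n).
Proof.
rewrite slideIE -!procomp_tens ?psrcU ?ptgtU //.
by apply: disk_tens; [apply: turnI_disk|apply: turn_disk].
Qed.

Lemma slide_inverse m n : inverse (slide m n) (slideI m n).
Proof.
rewrite slideE slideIE; apply: inverse_tens; first exact: turn_inverse.
exact: inverse_sym (turn_inverse n).
Qed.

(* Reversing the tensor exchanges slide with slideI and whisker_l with
   whisker_r. *)
Definition revM : monoidalDC.
Proof.
refine {| mdc := V;
  tens := compF (pairF (sndF V V) (fstF V V)) (tens V);
  munit := munit V |} => /=; try by apply: tens_obl || apply: tens_obr.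
all: try by [apply: tens_arl|apply: tens_arr|apply: tens_prl|apply: tens_prr|apply: tens_sql|apply: tens_sqr].
all: move=> *; symmetry; by [apply: tens_obA|apply: tens_arA|apply: tens_prA|apply: tens_sqA].
Defined.

End Tensor.

Ltac vmp := solve [eapply disk_bot_top; [|dk|dk]; ob].

Section Slides.
Variable V : monoidalDC.
Let L := dc_laws V.
Implicit Types (m n p M a b c d : Pr V) (φ ψ χ : Sq V) (A B P Q T X Y : Ob V).

(* Equations between composites of slides and whiskerings are proved by
   gathering both sides into a single tensor φ ⊗ₛ ψ; the equations of the
   components only involve coherators and at most one other disk. *)
Lemma tens_congr φ φ' ψ ψ' : φ = φ' -> ψ = ψ' -> φ ⊗ₛ ψ = φ' ⊗ₛ ψ'.
Proof. by move=> -> ->. Qed.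

Lemma whisker_lE X m n φ : disk m n φ -> whisker_l X φ = sid (pU X ⊙ pU X) ⊗ₛ φ.
Proof.
move=> D; have [h1 h2 _ _] := D; rewrite /whisker_l h1 h2.
have D1 := lamU_disk X; have D2 := lamIU_disk X.
rewrite !hcomp_tens; try cmp.
rewrite (disk_idr D1) (disk_idl D) (disk_idr D).
by rewrite (inv_cancel D1 (lam_inverse L _)).
Qed.

Lemma whisker_rE X m n φ : disk m n φ -> whisker_r φ X = φ ⊗ₛ sid (pU X ⊙ pU X).
Proof.
move=> D; have [h1 h2 _ _] := D; rewrite /whisker_r h1 h2.
have D1 := lamU_disk X; have D2 := lamIU_disk X.
rewrite !hcomp_tens; try cmp.
rewrite (disk_idr D1) (disk_idl D) (disk_idr D).
by rewrite (inv_cancel D1 (lam_inverse L _)).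
Qed.

Ltac tfold := repeat first
  [ rewrite assoc_tens; [|ob|ob|ob|ob]
  | rewrite assocI_tens; [|ob|ob|ob|ob]
  | rewrite hcomp_tens; [|cmp|cmp]
  | rewrite vcomp_tens; [|vmp|vmp] ].

(** Expands the first step of a zigzag at a composite proarrow. The outer factors [lamI (pU P)] and
    [lam (pU Q)] split and merge the whiskered composite; in each tensor factor the equation is one
    between coherators. *)
Lemma slide_comp m m' n A B B' P Q : psrc m = A -> ptgt m = B -> psrc m' = B ->
  ptgt m' = B' -> psrc n = P -> ptgt n = Q ->
  slide (m ⊙ m') n =
  ((sid (m ⊙ m') ⊗ₛ lamI (pU P)) ⊙ₛ sid (pU B' ⊗ n))
  ·ₛ assoc (m ⊗ pU P) (m' ⊗ pU P) (pU B' ⊗ n)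
  ·ₛ (sid (m ⊗ pU P) ⊙ₛ slide m' n)
  ·ₛ assocI (m ⊗ pU P) (pU B ⊗ n) (m' ⊗ pU Q)
  ·ₛ (slide m n ⊙ₛ sid (m' ⊗ pU Q))
  ·ₛ assoc (pU A ⊗ n) (m ⊗ pU Q) (m' ⊗ pU Q)
  ·ₛ (sid (pU A ⊗ n) ⊙ₛ (sid (m ⊙ m') ⊗ₛ lam (pU Q))).
Proof.
move=> h1 h2 h3 h4 h5 h6.
have U1 := @psrcU V; have U2 := @ptgtU V.
have T1 := turn_disk m; have T2 := turn_disk m'; have T3 := turnI_disk n.
rewrite h1 h2 in T1; rewrite h3 h4 in T2; rewrite h5 h6 in T3.
rewrite !slideE !sid_tens; tfold.

apply: tens_congr; rewrite /turn /turnI; coh.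
Qed.

Definition slide2 m a b B A P Q T : Sq V :=
  assocI (m ⊗ pU P) (pU B ⊗ a) (pU B ⊗ b)
  ·ₛ (slide m a ⊙ₛ sid (pU B ⊗ b))
  ·ₛ assoc (pU A ⊗ a) (m ⊗ pU Q) (pU B ⊗ b)
  ·ₛ (sid (pU A ⊗ a) ⊙ₛ slide m b)
  ·ₛ assocI (pU A ⊗ a) (pU A ⊗ b) (m ⊗ pU T).

Lemma slide_whisker_l m a b c d φ A B P Q Q' T :
  psrc m = A -> ptgt m = B -> psrc a = P -> ptgt a = Q -> psrc b = Q -> ptgt b = T ->
  psrc c = P -> ptgt c = Q' -> psrc d = Q' -> ptgt d = T -> disk (a ⊙ b) (c ⊙ d) φ ->
  (sid (m ⊗ pU P) ⊙ₛ whisker_l B φ) ·ₛ slide2 m c d B A P Q' T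
  = slide2 m a b B A P Q T ·ₛ (whisker_l A φ ⊙ₛ sid (m ⊗ pU T)).
Proof.
move=> h1 h2 h3 h4 h5 h6 k3 k4 k5 k6 D.
have U1 := @psrcU V; have U2 := @ptgtU V.
have T1 := turn_disk m; rewrite h1 h2 in T1.
have T3 := turnI_disk a; have T4 := turnI_disk b; rewrite h3 h4 h5 h6 in T3 T4.
have T5 := turnI_disk c; have T6 := turnI_disk d; rewrite k3 k4 k5 k6 in T5 T6.
rewrite /slide2 !(whisker_lE _ D) !slideE !sid_tens; tfold.
apply: tens_congr; rewrite /turn /turnI; coh.
Qed.

(** Carries the whiskering by X inside the expansion of a cap at a composite proarrow; the extra
    factors [lamI (pU X)] and [lam (pU X)] split and merge the unit on X along with σ and τ. *)
Lemma whisker_l_tripL X (p q r p1 q1 q2 r1 p2 q3 y z : Pr V) (α β γ σ τ : Sq V) :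
  ptgt p = psrc q -> ptgt q = psrc r -> ptgt p1 = psrc q1 -> ptgt q1 = psrc r ->
  ptgt p1 = psrc q2 -> ptgt q2 = psrc r1 -> ptgt p2 = psrc q3 -> ptgt q3 = psrc r1 ->
  ptgt p = psrc y -> ptgt p2 = psrc z ->
  disk (p ⊙ q) (p1 ⊙ q1) α -> disk (q1 ⊙ r) (q2 ⊙ r1) β -> disk (p1 ⊙ q2) (p2 ⊙ q3) γ ->
  disk y (q ⊙ r) σ -> disk (q3 ⊙ r1) z τ ->
  whisker_l X ((sid p ⊙ₛ σ) ·ₛ tripL p q r p1 q1 q2 r1 p2 q3 α β γ ·ₛ (sid p2 ⊙ₛ τ))
  = (sid (pU X ⊗ p) ⊙ₛ (lamI (pU X) ⊗ₛ σ))
    ·ₛ tripL (pU X ⊗ p) (pU X ⊗ q) (pU X ⊗ r) (pU X ⊗ p1) (pU X ⊗ q1) (pU X ⊗ q2)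
             (pU X ⊗ r1) (pU X ⊗ p2) (pU X ⊗ q3)
             (whisker_l X α) (whisker_l X β) (whisker_l X γ)
    ·ₛ (sid (pU X ⊗ p2) ⊙ₛ (lam (pU X) ⊗ₛ τ)).
Proof.
move=> h1 h2 h3 h4 h5 h6 h7 h8 h9 h10 D1 D2 D3 D4 D5.
have U1 := @psrcU V; have U2 := @ptgtU V.
rewrite /tripL (@whisker_lE X (p ⊙ y) (p2 ⊙ z)); last by dk.
rewrite (whisker_lE _ D1) (whisker_lE _ D2) (whisker_lE _ D3) !sid_tens; tfold.
apply: tens_congr; coh.
Qed.

Lemma whisker_r_tripR X (p q r q1 r1 q2 p1 q3 r2 y z : Pr V) (α β γ σ τ : Sq V) :
  ptgt p = psrc q -> ptgt q = psrc r -> ptgt p = psrc q1 -> ptgt q1 = psrc r1 ->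
  ptgt q2 = psrc p1 -> ptgt p1 = psrc r1 -> ptgt q2 = psrc q3 -> ptgt q3 = psrc r2 ->
  ptgt y = psrc r -> ptgt z = psrc r2 ->
  disk (q ⊙ r) (q1 ⊙ r1) α -> disk (p ⊙ q1) (q2 ⊙ p1) β -> disk (p1 ⊙ r1) (q3 ⊙ r2) γ ->
  disk y (p ⊙ q) σ -> disk (q2 ⊙ q3) z τ ->
  whisker_r ((σ ⊙ₛ sid r) ·ₛ tripR p q r q1 r1 q2 p1 q3 r2 α β γ ·ₛ (τ ⊙ₛ sid r2)) X
  = ((σ ⊗ₛ lamI (pU X)) ⊙ₛ sid (r ⊗ pU X))
    ·ₛ tripR (p ⊗ pU X) (q ⊗ pU X) (r ⊗ pU X) (q1 ⊗ pU X) (r1 ⊗ pU X) (q2 ⊗ pU X)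
             (p1 ⊗ pU X) (q3 ⊗ pU X) (r2 ⊗ pU X)
             (whisker_r α X) (whisker_r β X) (whisker_r γ X)
    ·ₛ ((τ ⊗ₛ lam (pU X)) ⊙ₛ sid (r2 ⊗ pU X)).
Proof.
move=> h1 h2 h3 h4 h5 h6 h7 h8 h9 h10 D1 D2 D3 D4 D5.
have U1 := @psrcU V; have U2 := @ptgtU V.
rewrite /tripR (@whisker_rE X (y ⊙ r) (z ⊙ r2)); last by dk.
rewrite (whisker_rE _ D1) (whisker_rE _ D2) (whisker_rE _ D3) !sid_tens; tfold.
apply: tens_congr; coh.
Qed.

(** The squares φ and ψ are arbitrary, so coherence does not apply; the two tensor factors are
    naturality of [turn] and of [turnI]. *)
Lemma slide_nat φ ψ :
  ((φ ⊗ₛ sU (top ψ)) ⊙ₛ (sU (bot φ) ⊗ₛ ψ)) ·ₛ slide (rgt φ) (rgt ψ)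
  = slide (lft φ) (lft ψ) ·ₛ ((sU (top φ) ⊗ₛ ψ) ⊙ₛ (φ ⊗ₛ sU (bot ψ))).
Proof.
have e1 : bot φ = top (sU (bot φ)) by rewrite (top_U L).
have e2 : bot (sU (top ψ)) = top ψ by rewrite (bot_U L).
have e3 : bot (sU (top φ)) = top φ by rewrite (bot_U L).
have e4 : bot ψ = top (sU (bot ψ)) by rewrite (top_U L).
rewrite !slideE !vcomp_tens // !hcomp_tens ?turn_nat ?turnI_nat //.
- have [a1 a2 _ _] := turn_disk (lft φ); by rewrite lft_Uvcomp.
- have [a1 a2 _ _] := turnI_disk (lft ψ); by rewrite lft_vcompU.
- have [a1 a2 _ _] := turn_disk (rgt φ); by rewrite rgt_vcompU.
- have [a1 a2 _ _] := turnI_disk (rgt ψ); by rewrite rgt_Uvcomp.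
Qed.

Lemma whisker_l_nat (f : Ar V) a b c d a' b' c' d' φ φ' x y z w :
  disk (a ⊙ b) (c ⊙ d) φ -> disk (a' ⊙ b') (c' ⊙ d') φ' ->
  lft x = a -> rgt x = a' -> lft y = b -> rgt y = b' -> bot x = top y ->
  lft z = c -> rgt z = c' -> lft w = d -> rgt w = d' -> bot z = top w ->
  (x ⊙ₛ y) ·ₛ φ' = φ ·ₛ (z ⊙ₛ w) ->
  ((sU f ⊗ₛ x) ⊙ₛ (sU f ⊗ₛ y)) ·ₛ whisker_l (atgt f) φ'
  = whisker_l (asrc f) φ ·ₛ ((sU f ⊗ₛ z) ⊙ₛ (sU f ⊗ₛ w)).
Proof.
move=> D D' x1 x2 y1 y2 e z1 z2 w1 w2 e' E.
rewrite (whisker_lE _ D) (whisker_lE _ D') !vcomp_tens ?(top_U L) ?(bot_U L) //.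
have [d1 d2 _ _] := D; have [d1' d2' _ _] := D'.
have k : bot (sU f) = top (sU f) by rewrite (top_U L) (bot_U L).
have l1 : lft (sU f ⊙ₛ sU f) = pU (asrc f) ⊙ pU (asrc f) by rewrite (lft_vcomp L) // !(lft_U L).
have l2 : rgt (sU f ⊙ₛ sU f) = pU (atgt f) ⊙ pU (atgt f) by rewrite (rgt_vcomp L) // !(rgt_U L).
rewrite !hcomp_tens ?(lft_id L) ?(rgt_id L) //; last first.
- by rewrite d1' (rgt_vcomp L) // x2 y2.
- by rewrite d2 (lft_vcomp L) // z1 w1.
rewrite E; apply: tens_congr => //.
by rewrite -{1}l2 (sidr L) -l1 (sidl L).
Qed.

Lemma slide_unit_l A n : slide (pU A) n = lam (pU A ⊗ n) ·ₛ rhoI (pU A ⊗ n).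
Proof.
have D1 := lam_disk L n; have D2 := rhoI_disk n.
by rewrite slideE lam_tens rhoI_tens /turn rho_U -rhoI_U hcomp_tens; try cmp.
Qed.

(** A unit turns past a unit trivially, so the whiskering by X can be absorbed into the sliding
    proarrow. *)
Lemma whisker_l_slideI X m n : whisker_l X (slideI m n) = slideI (pU X ⊗ m) n.
Proof.
have T1 := turnI_disk m; have T2 := turnI_disk (pU X); rewrite psrcU ptgtU in T2.
have E : turnI (pU X) = sid (pU X ⊙ pU X).
  by rewrite /turnI; coh.
rewrite (whisker_lE _ (slideI_disk m n)) !slideIE -E -[LHS]tens_sqA.
apply: tens_congr => //.
have D1 := lam_disk L m; have D2 := rhoI_disk m.
by rewrite /turnI lam_tens rhoI_tens hcomp_tens; try cmp.
Qed.

Lemma whisker_r_slide X m n : whisker_r (slide m n) X = slide m (n ⊗ pU X).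
Proof.
have T1 := turnI_disk n; have T2 := turnI_disk (pU X); rewrite psrcU ptgtU in T2.
have E : turnI (pU X) = sid (pU X ⊙ pU X).
  by rewrite /turnI; coh.
rewrite (whisker_rE _ (slide_disk m n)) !slideE -E tens_sqA.
apply: tens_congr => //.
have D1 := lam_disk L n; have D2 := rhoI_disk n.
by rewrite /turnI lam_tens rhoI_tens hcomp_tens; try cmp.
Qed.

(** Since [turn] and [turnI] agree on a unit, a unit in the middle belongs to either factor. This
    reconciles the two ways in which the slide of m past n is reached in the composition law. *)
Lemma slideI_unit_mid X m n : slideI (m ⊗ pU X) n = slideI m (pU X ⊗ n).
Proof.
have D1 := lam_disk L m; have D2 := rhoI_disk m; have D3 := rho_disk L n; have D4 := lamI_disk n.
have E : turn (pU X) = turnI (pU X) by rewrite /turn /turnI; coh.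
have T1 : turnI (m ⊗ pU X) = turnI m ⊗ₛ turnI (pU X).
  by rewrite /turnI lam_tens rhoI_tens hcomp_tens; try cmp.
have T2 : turn (pU X ⊗ n) = turn (pU X) ⊗ₛ turn n.
  by rewrite /turn rho_tens lamI_tens hcomp_tens; try cmp.
by rewrite !slideIE T1 T2 E tens_sqA.
Qed.

End Slides.

(** * Mirror images of the slide lemmas *)

Section SlidesRev.
Variable V : monoidalDC.
Let L := dc_laws V.
Implicit Types (m n p M a b c d : Pr V) (φ ψ χ : Sq V) (A B P Q T X Y : Ob V).

(** Holds by conversion, as do the other transfers along [revM]: its tensor computes to that of V
    with the arguments exchanged, so its [slide m n] is [slideI n m]. *)
Lemma slideI_comp m m' n A B B' P Q : psrc m = A -> ptgt m = B -> psrc m' = B ->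
  ptgt m' = B' -> psrc n = P -> ptgt n = Q ->
  slideI n (m ⊙ m') =
  ((lamI (pU P) ⊗ₛ sid (m ⊙ m')) ⊙ₛ sid (n ⊗ pU B'))
  ·ₛ assoc (pU P ⊗ m) (pU P ⊗ m') (n ⊗ pU B')
  ·ₛ (sid (pU P ⊗ m) ⊙ₛ slideI n m')
  ·ₛ assocI (pU P ⊗ m) (n ⊗ pU B) (pU Q ⊗ m')
  ·ₛ (slideI n m ⊙ₛ sid (pU Q ⊗ m'))
  ·ₛ assoc (n ⊗ pU A) (pU Q ⊗ m) (pU Q ⊗ m')
  ·ₛ (sid (n ⊗ pU A) ⊙ₛ (lam (pU Q) ⊗ₛ sid (m ⊙ m'))).
Proof. exact: (@slide_comp (revM V)). Qed.

Definition slideI2 a b m B A P Q T : Sq V :=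
  assocI (pU P ⊗ m) (a ⊗ pU B) (b ⊗ pU B)
  ·ₛ (slideI a m ⊙ₛ sid (b ⊗ pU B))
  ·ₛ assoc (a ⊗ pU A) (pU Q ⊗ m) (b ⊗ pU B)
  ·ₛ (sid (a ⊗ pU A) ⊙ₛ slideI b m)
  ·ₛ assocI (a ⊗ pU A) (b ⊗ pU A) (pU T ⊗ m).

Lemma slide_whisker_r m a b c d φ A B P Q Q' T :
  psrc m = A -> ptgt m = B -> psrc a = P -> ptgt a = Q -> psrc b = Q -> ptgt b = T ->
  psrc c = P -> ptgt c = Q' -> psrc d = Q' -> ptgt d = T -> disk (a ⊙ b) (c ⊙ d) φ ->
  (sid (pU P ⊗ m) ⊙ₛ whisker_r φ B) ·ₛ slideI2 c d m B A P Q' T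
  = slideI2 a b m B A P Q T ·ₛ (whisker_r φ A ⊙ₛ sid (pU T ⊗ m)).
Proof. exact: (@slide_whisker_l (revM V)). Qed.

Lemma slideI_unit_r A m : slideI m (pU A) = lam (m ⊗ pU A) ·ₛ rhoI (m ⊗ pU A).
Proof. exact: (@slide_unit_l (revM V)). Qed.

End SlidesRev.

(** * Rewriting of layers *)

Ltac chain_solve := lazymatch goal with
  | |- and4 _ _ _ _ => split; chain_solve
  | |- disk _ _ _ => eassumption
  | |- and3 _ _ _ => split; chain_solve
  | |- True => exact I
  | |- _ => ob
  end.

(* Rewrites the layers of [t], found from position [i] on under the context
   [p], [q], into those of [u]. *)
Ltac step i p q t u :=
  lazymatch goal with |- eqv ?A ?a ?b ?s _ =>
    let s1 := eval cbn in (take i s) in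
    let s2 := eval cbn in (drop (i + size (nf t)) s) in
    apply: (@eqv_trans _ A a b _ (s1 ++ map (addctx p q) (nf u) ++ s2));
    [change (eqv A a b (s1 ++ map (addctx p q) (nf t) ++ s2) (s1 ++ map (addctx p q) (nf u) ++ s2));
     apply: (@eqv_step _ A a b s1 s2 p q t u);
       [wf|wf|rewrite /=; congruence|rewrite /=; congruence|rewrite /=
       |rewrite /=; chain_solve|rewrite /=; ob]
    |rewrite /addctx /addpre /addsuf /=] end.

Ltac step_sq i p q x y :=
  let t := rterm x in let u := rterm y in step i p q t u.
Ltac step_eq i p q e := lazymatch type of e with ?x = ?y =>
  step_sq i p q x y; first exact: e end.
(** Interchange is proved by reflexivity: [Vlr t u] and [Vrl t u] have the same [sem] but different
    [nf]. *)
Ltac exch_lr i p q x y :=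
  let t := rterm x in let u := rterm y in
  step i p q (Vlr t u) (Vrl t u); first reflexivity.
Ltac exch_rl i p q x y :=
  let t := rterm x in let u := rterm y in
  step i p q (Vrl t u) (Vlr t u); first reflexivity.

(** * The composition law as a rewriting of layers *)

Section Paste.
Variable C : doubleCat.
Let L := dc_laws C.

Definition typed (m : Pr C) (A B : Ob C) := psrc m = A /\ ptgt m = B.

(* The names are those of the application to proarrows m : A -> B and n : B -> X:
   hPQ is P ⊗ ηQ, eQR is εQ ⊗ R, mQR is m ⊗ Q^* ⊗ R, PmR is P ⊗ m^* ⊗ R and PQm
   is P ⊗ Q^* ⊗ m.  The disks sl, cu, ca, si are the four steps of a zigzag, sw,
   sv and c move m past n^*, m^* past n and m past n, and d1, d2, d3 merge
   whiskered proarrows.  The last two hypotheses say that m slides past the disk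
   ηn, and n past the disk εm. *)
Lemma zigzag_paste (A B X AXX BXX XXX ABX BBX AAX ABB BBB AAB AAA : Ob C)
    (m n hXX hBX hAX hBB hAB hAA eXX eBX eAX eBB eAB eAA
     nXX mXX BnX AnX mBX AmX ABn BBn mBB AmB AAm AAn mnXX AnmX AAmn : Pr C)
    (slnX slmX slmB cunX cumX cumB caAn caAm caBn siAn siAm siBn sw sv c cI
     d1 d1I d2 d2I d3 d3I D1 D2 D3 D4 : Sq C) :
  typed m A B -> typed n B X ->
  typed hXX X XXX -> typed hBX B BXX -> typed hAX A AXX ->
  typed hBB B BBB -> typed hAB A ABB -> typed hAA A AAA ->
  typed eXX XXX X -> typed eBX BBX X -> typed eAX AAX X ->
  typed eBB BBB B -> typed eAB AAB B -> typed eAA AAA A ->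
  typed nXX BXX XXX -> typed mXX AXX BXX -> typed BnX BXX BBX -> typed AnX AXX ABX ->
  typed mBX ABX BBX -> typed AmX ABX AAX -> typed ABn ABB ABX -> typed BBn BBB BBX ->
  typed mBB ABB BBB -> typed AmB ABB AAB -> typed AAm AAA AAB -> typed AAn AAB AAX ->
  typed mnXX AXX XXX -> typed AnmX AXX AAX -> typed AAmn AAA AAX ->
  disk (n ⊙ hXX) (hBX ⊙ nXX) slnX -> disk (m ⊙ hBX) (hAX ⊙ mXX) slmX ->
  disk (m ⊙ hBB) (hAB ⊙ mBB) slmB ->
  disk (nXX ⊙ eXX) (BnX ⊙ eBX) cunX -> disk (mBX ⊙ eBX) (AmX ⊙ eAX) cumX ->
  disk (mBB ⊙ eBB) (AmB ⊙ eAB) cumB ->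
  disk (hAX ⊙ AnX) (hAB ⊙ ABn) caAn -> disk (hAB ⊙ AmB) (hAA ⊙ AAm) caAm ->
  disk (hBX ⊙ BnX) (hBB ⊙ BBn) caBn ->
  disk (AAn ⊙ eAX) (eAB ⊙ n) siAn -> disk (AAm ⊙ eAB) (eAA ⊙ m) siAm ->
  disk (BBn ⊙ eBX) (eBB ⊙ n) siBn ->
  disk (mXX ⊙ BnX) (AnX ⊙ mBX) sw -> disk (ABn ⊙ AmX) (AmB ⊙ AAn) sv ->
  disk (mBB ⊙ BBn) (ABn ⊙ mBX) c -> inverse c cI ->
  disk (mXX ⊙ nXX) mnXX d1 -> inverse d1 d1I ->
  disk (AnX ⊙ AmX) AnmX d2 -> inverse d2 d2I ->
  disk (AAm ⊙ AAn) AAmn d3 -> inverse d3 d3I ->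
  D1 = assoc m n hXX ·ₛ (sid m ⊙ₛ slnX) ·ₛ assocI m hBX nXX ·ₛ (slmX ⊙ₛ sid nXX)
       ·ₛ assoc hAX mXX nXX ·ₛ (sid hAX ⊙ₛ d1) ->
  D2 = (d1I ⊙ₛ sid eXX)
       ·ₛ (assoc mXX nXX eXX ·ₛ (sid mXX ⊙ₛ cunX) ·ₛ assocI mXX BnX eBX ·ₛ (sw ⊙ₛ sid eBX)
           ·ₛ assoc AnX mBX eBX ·ₛ (sid AnX ⊙ₛ cumX) ·ₛ assocI AnX AmX eAX)
       ·ₛ (d2 ⊙ₛ sid eAX) ->
  D3 = (sid hAX ⊙ₛ d2I)
       ·ₛ (assocI hAX AnX AmX ·ₛ (caAn ⊙ₛ sid AmX) ·ₛ assoc hAB ABn AmX ·ₛ (sid hAB ⊙ₛ sv)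
           ·ₛ assocI hAB AmB AAn ·ₛ (caAm ⊙ₛ sid AAn) ·ₛ assoc hAA AAm AAn)
       ·ₛ (sid hAA ⊙ₛ d3) ->
  D4 = (d3I ⊙ₛ sid eAX) ·ₛ assoc AAm AAn eAX ·ₛ (sid AAm ⊙ₛ siAn) ·ₛ assocI AAm eAB n
       ·ₛ (siAm ⊙ₛ sid n) ·ₛ assoc eAA m n ->
  (sid m ⊙ₛ caBn) ·ₛ (assocI m hBB BBn ·ₛ (slmB ⊙ₛ sid BBn) ·ₛ assoc hAB mBB BBn
                      ·ₛ (sid hAB ⊙ₛ c) ·ₛ assocI hAB ABn mBX)
  = (assocI m hBX BnX ·ₛ (slmX ⊙ₛ sid BnX) ·ₛ assoc hAX mXX BnX
     ·ₛ (sid hAX ⊙ₛ sw) ·ₛ assocI hAX AnX mBX) ·ₛ (caAn ⊙ₛ sid mBX) ->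
  (sid ABn ⊙ₛ cumX) ·ₛ (assocI ABn AmX eAX ·ₛ (sv ⊙ₛ sid eAX) ·ₛ assoc AmB AAn eAX
                        ·ₛ (sid AmB ⊙ₛ siAn) ·ₛ assocI AmB eAB n)
  = (assocI ABn mBX eBX ·ₛ (cI ⊙ₛ sid eBX) ·ₛ assoc mBB BBn eBX
     ·ₛ (sid mBB ⊙ₛ siBn) ·ₛ assocI mBB eBB n) ·ₛ (cumB ⊙ₛ sid n) ->
  assocI (m ⊙ n) hXX eXX ·ₛ (D1 ⊙ₛ sid eXX) ·ₛ assoc hAX mnXX eXX ·ₛ (sid hAX ⊙ₛ D2)
  ·ₛ assocI hAX AnmX eAX ·ₛ (D3 ⊙ₛ sid eAX) ·ₛ assoc hAA AAmn eAX ·ₛ (sid hAA ⊙ₛ D4)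
  ·ₛ assocI hAA eAA (m ⊙ n)
  = assoc m n (hXX ⊙ eXX)
    ·ₛ (sid m ⊙ₛ (assocI n hXX eXX ·ₛ (slnX ⊙ₛ sid eXX) ·ₛ assoc hBX nXX eXX
                  ·ₛ (sid hBX ⊙ₛ cunX) ·ₛ assocI hBX BnX eBX ·ₛ (caBn ⊙ₛ sid eBX)
                  ·ₛ assoc hBB BBn eBX ·ₛ (sid hBB ⊙ₛ siBn) ·ₛ assocI hBB eBB n))
    ·ₛ assocI m (hBB ⊙ eBB) n
    ·ₛ ((assocI m hBB eBB ·ₛ (slmB ⊙ₛ sid eBB) ·ₛ assoc hAB mBB eBB
         ·ₛ (sid hAB ⊙ₛ cumB) ·ₛ assocI hAB AmB eAB ·ₛ (caAm ⊙ₛ sid eAB)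
         ·ₛ assoc hAA AAm eAB ·ₛ (sid hAA ⊙ₛ siAm) ·ₛ assocI hAA eAA m) ⊙ₛ sid n)
    ·ₛ assoc (hAA ⊙ eAA) m n.
Proof.
do 29! case=> ? ?.
move=> a1 a2 b2' a3 a5 b5 a6 a8 b6 a9 a10 b9' a4 a7 gc ic g1 i1 g2 i2 g3 i3.
move=> -> -> -> -> K1 K2.
have gcI := disk_inverse gc ic; have g1I := disk_inverse g1 i1.
have g2I := disk_inverse g2 i2; have g3I := disk_inverse g3 i3.
lazymatch goal with |- ?x = ?y =>
  let t := rterm x in let u := rterm y in
  apply: (@coherence _ t u); [wf|wf|rewrite /=; congruence|rewrite /=; congruence|] end.
rewrite /= /addpre /addsuf /=.
(* After cancelling the merges: [slnX slmX cunX sw cumX caAn sv caAm siAn siAm]. *)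
step_sq 2 [:: hAX] [:: eXX] (d1 ·ₛ d1I) (sid (mXX ⊙ nXX)); first exact: inv_cancel g1 i1.
step_sq 5 [:: hAX] [:: eAX] (d2 ·ₛ d2I) (sid (AnX ⊙ AmX)); first exact: inv_cancel g2 i2.
step_sq 8 [:: hAA] [:: eAX] (d3 ·ₛ d3I) (sid (AAm ⊙ AAn)); first exact: inv_cancel g3 i3.
exch_lr 1 (@nil (Pr C)) (@nil (Pr C)) slmX cunX.
exch_rl 4 (@nil (Pr C)) (@nil (Pr C)) caAn cumX.
(* The two exchanges have made [slmX sw caAn] consecutive; sliding m past the disk ηn turns it into
   [caBn slmB c]. *)
step_eq 2 (@nil (Pr C)) [:: eBX] (esym K1).
exch_lr 7 (@nil (Pr C)) (@nil (Pr C)) caAm siAn.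
(* Likewise [cumX sv siAn] becomes [cI siBn cumB], n sliding past the disk εm, and [c] now meets its
   inverse. *)
step_eq 5 [:: hAB] (@nil (Pr C)) K2.
step_sq 4 [:: hAB] [:: eBX] (c ·ₛ cI) (sid (mBB ⊙ BBn)); first exact: inv_cancel gc ic.
(* This last exchange separates [slnX cunX caBn siBn], which is Sn, from [slmB cumB caAm siAm],
   which is Sm. *)
exch_lr 3 (@nil (Pr C)) (@nil (Pr C)) slmB siBn.
exact: eqv_refl.
Qed.
End Paste.

(** * Pasting naturality squares *)

Section NaturalSquares.
Variable C : doubleCat.
Let L := dc_laws C.
Implicit Types (X Y Z P Q c d φ ψ χ : Sq C).

(** The boundary equations are bundled with the commutation, which makes the predicate closed under
    both compositions without further side conditions on · . It is applied with disks [c], [c'] and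
    general squares [X], [Y]. *)
Definition natsq X c c' Y :=
  [/\ rgt X = lft c', rgt c = lft Y, lft X = lft c, rgt Y = rgt c' & X ·ₛ c' = c ·ₛ Y].

Lemma natsq_hcomp X c c' Y d d' Z :
  natsq X c c' Y -> natsq Y d d' Z -> natsq X (c ·ₛ d) (c' ·ₛ d') Z.
Proof.
case=> a1 a2 a3 a4 a5 [b1 b2 b3 b4 b5].
have e : rgt c = lft d by congruence.
have e' : rgt c' = lft d' by congruence.
split; rewrite ?(lft_comp L) ?(rgt_comp L) //.
by rewrite -(hcompA L) // a5 (hcompA L) // b5 (hcompA L).
Qed.

Lemma natsq_vcomp X c c' Y P d d' Q : natsq X c c' Y -> natsq P d d' Q ->
  bot X = top P -> bot c = top d -> bot c' = top d' -> bot Y = top Q ->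
  natsq (X ⊙ₛ P) (c ⊙ₛ d) (c' ⊙ₛ d') (Y ⊙ₛ Q).
Proof.
case=> a1 a2 a3 a4 a5 [b1 b2 b3 b4 b5] e1 e2 e3 e4.
split; rewrite ?(lft_vcomp L) ?(rgt_vcomp L) //; try congruence.
by rewrite -!(interchange L) // a5 b5.
Qed.

Lemma natsq_sid X : natsq X (sid (lft X)) (sid (rgt X)) X.
Proof. by split; rewrite ?(lft_id L) ?(rgt_id L) // (sidl L) (sidr L). Qed.

Lemma sq_composable φ ψ : bot φ = top ψ ->
  ptgt (lft φ) = psrc (lft ψ) /\ ptgt (rgt φ) = psrc (rgt ψ).
Proof. by move=> e; rewrite -(asrc_bot L) -(atgt_bot L) e (asrc_top L) (atgt_top L). Qed.

Lemma natsq_assoc φ ψ χ : bot φ = top ψ -> bot ψ = top χ ->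
  natsq (φ ⊙ₛ ψ ⊙ₛ χ) (assoc (lft φ) (lft ψ) (lft χ)) (assoc (rgt φ) (rgt ψ) (rgt χ))
        (φ ⊙ₛ (ψ ⊙ₛ χ)).
Proof.
move=> e1 e2; have [l1 r1] := sq_composable e1; have [l2 r2] := sq_composable e2.
have [a1 a2 _ _] := assoc_disk L l1 l2; have [b1 b2 _ _] := assoc_disk L r1 r2.
have e3 : bot (φ ⊙ₛ ψ) = top χ by rewrite (bot_vcomp L).
have e4 : bot φ = top (ψ ⊙ₛ χ) by rewrite (top_vcomp L).
split; rewrite ?a1 ?a2 ?b1 ?b2 ?(lft_vcomp L e3) ?(rgt_vcomp L e3) ?(lft_vcomp L e4)
  ?(rgt_vcomp L e4) ?(lft_vcomp L) ?(rgt_vcomp L) //.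
exact: (assoc_nat L).
Qed.

Lemma natsq_inv X c c' Y d d' : natsq X c c' Y -> inverse c d -> inverse c' d' ->
  natsq Y d d' X.
Proof.
case=> a1 a2 a3 a4 a5 I I'; have [i1 i2 _ _] := I; have [j1 j2 _ _] := I'.
by split; rewrite ?i1 ?i2 ?j1 ?j2 //; apply: inverse_swap I' I a5.
Qed.

Lemma natsq_assocI φ ψ χ : bot φ = top ψ -> bot ψ = top χ ->
  natsq (φ ⊙ₛ (ψ ⊙ₛ χ)) (assocI (lft φ) (lft ψ) (lft χ))
        (assocI (rgt φ) (rgt ψ) (rgt χ)) (φ ⊙ₛ ψ ⊙ₛ χ).
Proof.
move=> e1 e2; have [l1 r1] := sq_composable e1; have [l2 r2] := sq_composable e2.
by apply: natsq_inv (natsq_assoc e1 e2) _ _; apply: (assoc_inverse L).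
Qed.

Lemma natsq_lam φ : natsq (sU (top φ) ⊙ₛ φ) (lam (lft φ)) (lam (rgt φ)) φ.
Proof.
have [a1 a2 _ _] := lam_disk L (lft φ); have [b1 b2 _ _] := lam_disk L (rgt φ).
by split; rewrite ?rgt_Uvcomp ?lft_Uvcomp ?(lam_nat L).
Qed.

Lemma natsq_lamI φ : natsq φ (lamI (lft φ)) (lamI (rgt φ)) (sU (top φ) ⊙ₛ φ).
Proof. exact: natsq_inv (natsq_lam φ) (lam_inverse L _) (lam_inverse L _). Qed.

Lemma natsq_rho φ : natsq (φ ⊙ₛ sU (bot φ)) (rho (lft φ)) (rho (rgt φ)) φ.
Proof.
have [a1 a2 _ _] := rho_disk L (lft φ); have [b1 b2 _ _] := rho_disk L (rgt φ).
by split; rewrite ?rgt_vcompU ?lft_vcompU ?(rho_nat L).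
Qed.

Lemma natsq_rhoI φ : natsq φ (rhoI (lft φ)) (rhoI (rgt φ)) (φ ⊙ₛ sU (bot φ)).
Proof. exact: natsq_inv (natsq_rho φ) (rho_inverse L _) (rho_inverse L _). Qed.

Lemma invertible_hcomp φ ψ : rgt φ = lft ψ -> invertible φ -> invertible ψ ->
  invertible (φ ·ₛ ψ).
Proof. by move=> e [φ' I] [ψ' J]; exists (ψ' ·ₛ φ'); apply: inverse_hcomp. Qed.

Lemma invertible_vcomp (m n m' n' : Pr C) φ ψ : ptgt m = psrc n ->
  disk m m' φ -> disk n n' ψ -> invertible φ -> invertible ψ -> invertible (φ ⊙ₛ ψ).
Proof. by move=> h D E [φ' I] [ψ' J]; exists (φ' ⊙ₛ ψ'); apply: inverse_vcomp h D E I J. Qed.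

Lemma invertible_id (m : Pr C) : invertible (sid m).
Proof. by exists (sid m); apply: inverse_id. Qed.

End NaturalSquares.

Section WhiskerDisks.
Variable V : monoidalDC.
Let L := dc_laws V.
Implicit Types (a b c d : Pr V) (φ ψ : Sq V).

Lemma whisker_l_disk X a b c d φ : ptgt a = psrc b -> ptgt c = psrc d ->
  disk (a ⊙ b) (c ⊙ d) φ ->
  disk (pU X ⊗ a ⊙ pU X ⊗ b) (pU X ⊗ c ⊙ pU X ⊗ d) (whisker_l X φ).
Proof.
move=> h k D; rewrite (whisker_lE _ D) -!procomp_tens ?psrcU ?ptgtU //.
by apply: disk_tens => //; apply: disk_id.
Qed.

Lemma whisker_r_disk X a b c d φ : ptgt a = psrc b -> ptgt c = psrc d ->
  disk (a ⊙ b) (c ⊙ d) φ ->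
  disk (a ⊗ pU X ⊙ b ⊗ pU X) (c ⊗ pU X ⊙ d ⊗ pU X) (whisker_r φ X).
Proof.
move=> h k D; rewrite (whisker_rE _ D) -!procomp_tens ?psrcU ?ptgtU //.
by apply: disk_tens => //; apply: disk_id.
Qed.

Lemma whisker_l_inverse X a b φ ψ : disk a b φ -> inverse φ ψ ->
  inverse (whisker_l X φ) (whisker_l X ψ).
Proof.
move=> D I; rewrite (whisker_lE _ D) (whisker_lE _ (disk_inverse D I)).
by apply: inverse_tens => //; apply: inverse_id.
Qed.

Lemma whisker_r_inverse X a b φ ψ : disk a b φ -> inverse φ ψ ->
  inverse (whisker_r φ X) (whisker_r ψ X).
Proof.
move=> D I; rewrite (whisker_rE _ D) (whisker_rE _ (disk_inverse D I)).
by apply: inverse_tens => //; apply: inverse_id.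
Qed.

Lemma natsq_slide φ ψ :
  natsq ((φ ⊗ₛ sU (top ψ)) ⊙ₛ (sU (bot φ) ⊗ₛ ψ)) (slide (lft φ) (lft ψ))
        (slide (rgt φ) (rgt ψ)) ((sU (top φ) ⊗ₛ ψ) ⊙ₛ (φ ⊗ₛ sU (bot ψ))).
Proof.
have [a1 a2 _ _] := slide_disk (lft φ) (lft ψ).
have [b1 b2 _ _] := slide_disk (rgt φ) (rgt ψ).
have e1 : bot (φ ⊗ₛ sU (top ψ)) = top (sU (bot φ) ⊗ₛ ψ).
  by rewrite bot_tens top_tens (bot_U L) (top_U L).
have e2 : bot (sU (top φ) ⊗ₛ ψ) = top (φ ⊗ₛ sU (bot ψ)).
  by rewrite bot_tens top_tens (bot_U L) (top_U L).
split; last exact: slide_nat.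
all: rewrite ?(lft_vcomp L e1) ?(rgt_vcomp L e1) ?(lft_vcomp L e2) ?(rgt_vcomp L e2).
all: rewrite ?a1 ?a2 ?b1 ?b2 ?lft_tens ?rgt_tens ?(lft_U L) ?(rgt_U L).
all: by rewrite ?(asrc_top L) ?(asrc_bot L) ?(atgt_top L) ?(atgt_bot L).
Qed.

Lemma natsq_slideI φ ψ :
  natsq ((sU (top φ) ⊗ₛ ψ) ⊙ₛ (φ ⊗ₛ sU (bot ψ))) (slideI (lft φ) (lft ψ))
        (slideI (rgt φ) (rgt ψ)) ((φ ⊗ₛ sU (top ψ)) ⊙ₛ (sU (bot φ) ⊗ₛ ψ)).
Proof.
by apply: natsq_inv (natsq_slide φ ψ) _ _; apply: slide_inverse.
Qed.

Lemma natsq_whisker_l (f : Ar V) (a b c d a' b' c' d' : Pr V) (φ φ' x y z w : Sq V) :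
  disk (a ⊙ b) (c ⊙ d) φ -> disk (a' ⊙ b') (c' ⊙ d') φ' ->
  lft x = a -> rgt x = a' -> lft y = b -> rgt y = b' -> bot x = top y ->
  lft z = c -> rgt z = c' -> lft w = d -> rgt w = d' -> bot z = top w ->
  (x ⊙ₛ y) ·ₛ φ' = φ ·ₛ (z ⊙ₛ w) ->
  natsq ((sU f ⊗ₛ x) ⊙ₛ (sU f ⊗ₛ y)) (whisker_l (asrc f) φ) (whisker_l (atgt f) φ')
        ((sU f ⊗ₛ z) ⊙ₛ (sU f ⊗ₛ w)).
Proof.
move=> D D' x1 x2 y1 y2 e z1 z2 w1 w2 e' E.
have [l1 r1] := sq_composable e; have [l2 r2] := sq_composable e'.
rewrite x1 x2 y1 y2 in l1 r1; rewrite z1 z2 w1 w2 in l2 r2.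
have [a1 a2 _ _] := whisker_l_disk (asrc f) l1 l2 D.
have [b1 b2 _ _] := whisker_l_disk (atgt f) r1 r2 D'.
have e1 : bot (sU f ⊗ₛ x) = top (sU f ⊗ₛ y) by rewrite bot_tens top_tens (bot_U L) (top_U L) e.
have e2 : bot (sU f ⊗ₛ z) = top (sU f ⊗ₛ w) by rewrite bot_tens top_tens (bot_U L) (top_U L) e'.
split; last exact: (whisker_l_nat f D D' x1 x2 y1 y2 e z1 z2 w1 w2 e' E).
all: rewrite ?(lft_vcomp L e1) ?(rgt_vcomp L e1) ?(lft_vcomp L e2) ?(rgt_vcomp L e2).
all: by rewrite ?a1 ?a2 ?b1 ?b2 ?lft_tens ?rgt_tens ?(lft_U L) ?(rgt_U L) ?x1 ?x2 ?y1 ?y2 ?z1 ?z2 ?w1 ?w2.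
Qed.

End WhiskerDisks.

Lemma natsq_whisker_r (V : monoidalDC) (f : Ar V) (a b c d a' b' c' d' : Pr V)
    (φ φ' x y z w : Sq V) :
  disk (a ⊙ b) (c ⊙ d) φ -> disk (a' ⊙ b') (c' ⊙ d') φ' ->
  lft x = a -> rgt x = a' -> lft y = b -> rgt y = b' -> bot x = top y ->
  lft z = c -> rgt z = c' -> lft w = d -> rgt w = d' -> bot z = top w ->
  (x ⊙ₛ y) ·ₛ φ' = φ ·ₛ (z ⊙ₛ w) ->
  natsq ((x ⊗ₛ sU f) ⊙ₛ (y ⊗ₛ sU f)) (whisker_r φ (asrc f)) (whisker_r φ' (atgt f))
        ((z ⊗ₛ sU f) ⊙ₛ (w ⊗ₛ sU f)).
Proof. exact: (@natsq_whisker_l (revM V)). Qed.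

(** * Zigzags *)

Section Duality.
Variables (V : monoidalDC) (E : doubleCat) (F : functor E V) (G : functor (reflectDC E) V).
Let L := dc_laws V.

(* Caps for functors F and G in place of the identity and ( )^*, with the unit
   proarrow on I removed from their disks.  In this form caps are stable under
   reversing the tensor of V and reflecting E, up to inversion of the disks. *)
Record capData := CapData {
  cap_ob : Ob E -> Pr V;  cap_ar : Ar E -> Sq V;  cap_dk : Pr E -> Sq V;
  cap_src A : psrc (cap_ob A) = tunit V;
  cap_tgt A : ptgt (cap_ob A) = fob G A ⊗ₒ fob F A;
  cap_lft f : lft (cap_ar f) = cap_ob (asrc f);
  cap_rgt f : rgt (cap_ar f) = cap_ob (atgt f);
  cap_top f : top (cap_ar f) = aid (tunit V);
  cap_bot f : bot (cap_ar f) = far G f ⊗ₐ far F f;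
  cap_disk m : disk (cap_ob (ptgt m) ⊙ (fpr G m ⊗ pU (fob F (ptgt m))))
                    (cap_ob (psrc m) ⊙ (pU (fob G (psrc m)) ⊗ fpr F m)) (cap_dk m);
  cap_invertible m : invertible (cap_dk m);
  cap_id A : cap_ar (aid A) = sid (cap_ob A);
  cap_acomp f g : atgt f = asrc g -> cap_ar (f ·ₐ g) = cap_ar f ·ₛ cap_ar g;
  cap_pU A : cap_dk (pU A) = sid (cap_ob A ⊙ pU (fob G A ⊗ₒ fob F A));
  cap_procomp m n : ptgt m = psrc n ->
    let A := psrc m in let B := ptgt m in let X := ptgt n in
    cap_dk (m ⊙ n)
    = (sid (cap_ob X) ⊙ₛ (sid (fpr G n ⊙ fpr G m) ⊗ₛ lamI (pU (fob F X))))
      ·ₛ tripL (cap_ob X) (fpr G n ⊗ pU (fob F X)) (fpr G m ⊗ pU (fob F X))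
               (cap_ob B) (pU (fob G B) ⊗ fpr F n) (fpr G m ⊗ pU (fob F B))
               (pU (fob G A) ⊗ fpr F n) (cap_ob A) (pU (fob G A) ⊗ fpr F m)
               (cap_dk n) (slideI (fpr G m) (fpr F n)) (cap_dk m)
      ·ₛ (sid (cap_ob A) ⊙ₛ (lam (pU (fob G A)) ⊗ₛ sid (fpr F m ⊙ fpr F n)));
  cap_sq φ :
    (cap_ar (bot φ) ⊙ₛ (fsq G φ ⊗ₛ sU (far F (bot φ)))) ·ₛ cap_dk (rgt φ)
    = cap_dk (lft φ) ·ₛ (cap_ar (top φ) ⊙ₛ (sU (far G (top φ)) ⊗ₛ fsq F φ))
}.

Record cupData := CupData {
  cup_ob : Ob E -> Pr V;  cup_ar : Ar E -> Sq V;  cup_dk : Pr E -> Sq V;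
  cup_src A : psrc (cup_ob A) = fob F A ⊗ₒ fob G A;
  cup_tgt A : ptgt (cup_ob A) = tunit V;
  cup_lft f : lft (cup_ar f) = cup_ob (asrc f);
  cup_rgt f : rgt (cup_ar f) = cup_ob (atgt f);
  cup_top f : top (cup_ar f) = far F f ⊗ₐ far G f;
  cup_bot f : bot (cup_ar f) = aid (tunit V);
  cup_disk m : disk (fpr F m ⊗ pU (fob G (ptgt m)) ⊙ cup_ob (ptgt m))
                    (pU (fob F (psrc m)) ⊗ fpr G m ⊙ cup_ob (psrc m)) (cup_dk m);
  cup_invertible m : invertible (cup_dk m);
  cup_id A : cup_ar (aid A) = sid (cup_ob A);
  cup_acomp f g : atgt f = asrc g -> cup_ar (f ·ₐ g) = cup_ar f ·ₛ cup_ar g;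
  cup_pU A : cup_dk (pU A) = sid (pU (fob F A ⊗ₒ fob G A) ⊙ cup_ob A);
  cup_procomp m n : ptgt m = psrc n ->
    let A := psrc m in let B := ptgt m in let X := ptgt n in
    cup_dk (m ⊙ n)
    = ((sid (fpr F m ⊙ fpr F n) ⊗ₛ lamI (pU (fob G X))) ⊙ₛ sid (cup_ob X))
      ·ₛ tripR (fpr F m ⊗ pU (fob G X)) (fpr F n ⊗ pU (fob G X)) (cup_ob X)
               (pU (fob F B) ⊗ fpr G n) (cup_ob B) (pU (fob F A) ⊗ fpr G n)
               (fpr F m ⊗ pU (fob G B)) (pU (fob F A) ⊗ fpr G m) (cup_ob A)
               (cup_dk n) (slide (fpr F m) (fpr G n)) (cup_dk m)
      ·ₛ ((lam (pU (fob F A)) ⊗ₛ sid (fpr G n ⊙ fpr G m)) ⊙ₛ sid (cup_ob A));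
  cup_sq φ :
    ((fsq F φ ⊗ₛ sU (far G (bot φ))) ⊙ₛ cup_ar (bot φ)) ·ₛ cup_dk (rgt φ)
    = cup_dk (lft φ) ·ₛ ((sU (far F (top φ)) ⊗ₛ fsq G φ) ⊙ₛ cup_ar (top φ))
}.

Variables (eta : capData) (eps : cupData).
Implicit Types (m n : Pr E) (f g : Ar E) (P Q R : Ob E).

Definition zig_ob (A : Ob E) : Pr V :=
  (pU (fob F A) ⊗ cap_ob eta A) ⊙ (cup_ob eps A ⊗ pU (fob F A)).

Definition zig_ar (f : Ar E) : Sq V :=
  (sU (far F f) ⊗ₛ cap_ar eta f) ⊙ₛ (cup_ar eps f ⊗ₛ sU (far F f)).

Definition zig_pr (m : Pr E) : Sq V :=
  let A := fob F (psrc m) in let B := fob F (ptgt m) in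
  let A' := fob G (psrc m) in let B' := fob G (ptgt m) in
  let etaA := cap_ob eta (psrc m) in let etaB := cap_ob eta (ptgt m) in
  let epsA := cup_ob eps (psrc m) in let epsB := cup_ob eps (ptgt m) in
  assocI (fpr F m) (pU B ⊗ etaB) (epsB ⊗ pU B)
  ·ₛ (slide (fpr F m) etaB ⊙ₛ sid (epsB ⊗ pU B))
  ·ₛ assoc (pU A ⊗ etaB) (fpr F m ⊗ pU B' ⊗ pU B) (epsB ⊗ pU B)
  ·ₛ (sid (pU A ⊗ etaB) ⊙ₛ whisker_r (cup_dk eps m) B)
  ·ₛ assocI (pU A ⊗ etaB) (pU A ⊗ fpr G m ⊗ pU B) (epsA ⊗ pU B)
  ·ₛ (whisker_l A (cap_dk eta m) ⊙ₛ sid (epsA ⊗ pU B))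
  ·ₛ assoc (pU A ⊗ etaA) (pU A ⊗ pU A' ⊗ fpr F m) (epsA ⊗ pU B)
  ·ₛ (sid (pU A ⊗ etaA) ⊙ₛ slideI epsA (fpr F m))
  ·ₛ assocI (pU A ⊗ etaA) (epsA ⊗ pU A) (fpr F m).

(* Proarrows between the objects FP, FP ⊗ GQ ⊗ FR and FR occurring in zigzags *)
Local Notation T P Q R := (fob F P ⊗ₒ fob G Q ⊗ₒ fob F R).
Local Notation h P Q := (pU (fob F P) ⊗ cap_ob eta Q).
Local Notation e Q R := (cup_ob eps Q ⊗ pU (fob F R)).
Local Notation wl m Q R := (fpr F m ⊗ pU (fob G Q) ⊗ pU (fob F R)).
Local Notation wm P m R := (pU (fob F P) ⊗ fpr G m ⊗ pU (fob F R)).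
Local Notation wr P Q m := (pU (fob F P) ⊗ pU (fob G Q) ⊗ fpr F m).

Lemma tens_ob_unit A : A ⊗ₒ tunit V = A.
Proof. exact: tens_obr. Qed.

Lemma tens_unit_ob A : tunit V ⊗ₒ A = A.
Proof. exact: tens_obl. Qed.

Lemma psrc_F m : psrc (fpr F m) = fob F (psrc m).
Proof. exact: fpr_src. Qed.
Lemma ptgt_F m : ptgt (fpr F m) = fob F (ptgt m).
Proof. exact: fpr_tgt. Qed.
Lemma psrc_G (m : Pr E) : psrc (fpr G m) = fob G (ptgt m).
Proof. exact: (fpr_src G m). Qed.
Lemma ptgt_G (m : Pr E) : ptgt (fpr G m) = fob G (psrc m).
Proof. exact: (fpr_tgt G m). Qed.

Definition bdyE := (psrc_tens, ptgt_tens, psrcU, ptgtU, cap_src, cap_tgt, cup_src, cup_tgt,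
  psrc_F, ptgt_F, psrc_G, ptgt_G, tens_ob_unit, tens_unit_ob).

Lemma typed_h P Q : typed (h P Q) (fob F P) (T P Q Q).
Proof. by split; rewrite !bdyE // tens_obA. Qed.
Lemma typed_e Q R : typed (e Q R) (T Q Q R) (fob F R).
Proof. by split; rewrite !bdyE. Qed.
Lemma typed_wl m Q R : typed (wl m Q R) (T (psrc m) Q R) (T (ptgt m) Q R).
Proof. by split; rewrite !bdyE. Qed.
Lemma typed_wm P m R : typed (wm P m R) (T P (ptgt m) R) (T P (psrc m) R).
Proof. by split; rewrite !bdyE. Qed.
Lemma typed_wr P Q m : typed (wr P Q m) (T P Q (psrc m)) (T P Q (ptgt m)).
Proof. by split; rewrite !bdyE. Qed.

Lemma slide_h m Q : disk (fpr F m ⊙ h (ptgt m) Q) (h (psrc m) Q ⊙ wl m Q Q)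
  (slide (fpr F m) (cap_ob eta Q)).
Proof.
have := slide_disk (fpr F m) (cap_ob eta Q).
by rewrite !bdyE tens_I pU_tens -tens_prA.
Qed.

Lemma slideI_e Q m : disk (wr Q Q m ⊙ e Q (ptgt m)) (e Q (psrc m) ⊙ fpr F m)
  (slideI (cup_ob eps Q) (fpr F m)).
Proof.
have := slideI_disk (cup_ob eps Q) (fpr F m).
by rewrite !bdyE tensI pU_tens.
Qed.

Lemma cup_whisker m R : disk (wl m (ptgt m) R ⊙ e (ptgt m) R) (wm (psrc m) m R ⊙ e (psrc m) R)
  (whisker_r (cup_dk eps m) (fob F R)).
Proof. by apply: whisker_r_disk (cup_disk eps m); rewrite !bdyE. Qed.

Lemma cap_whisker P m : disk (h P (ptgt m) ⊙ wm P m (ptgt m)) (h P (psrc m) ⊙ wr P (psrc m) m)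
  (whisker_l (fob F P) (cap_dk eta m)).
Proof. by rewrite !tens_prA; apply: whisker_l_disk (cap_disk eta m); rewrite !bdyE. Qed.

Lemma zig_ob_src A : psrc (zig_ob A) = fob F A.
Proof.
have [h1 h2] := typed_h A A; have [e1 e2] := typed_e A A.
by rewrite (psrc_comp L) ?h2.
Qed.

Lemma zig_ob_tgt A : ptgt (zig_ob A) = fob F A.
Proof.
have [h1 h2] := typed_h A A; have [e1 e2] := typed_e A A.
by rewrite (ptgt_comp L) ?h2.
Qed.

Lemma zig_ar_composable f :
  bot (sU (far F f) ⊗ₛ cap_ar eta f) = top (cup_ar eps f ⊗ₛ sU (far F f)).
Proof. by rewrite bot_tens top_tens (bot_U L) (top_U L) cap_bot cup_top tens_arA. Qed.

Lemma aid_tens_ar (f : Ar V) : aid (tunit V) ⊗ₐ f = f.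
Proof. by rewrite aid_tunit; apply: tens_arl. Qed.

Lemma tens_aid_ar (f : Ar V) : f ⊗ₐ aid (tunit V) = f.
Proof. by rewrite aid_tunit; apply: tens_arr. Qed.

Lemma zig_ar_bdy f : [/\ lft (zig_ar f) = zig_ob (asrc f), rgt (zig_ar f) = zig_ob (atgt f),
  top (zig_ar f) = far F f & bot (zig_ar f) = far F f].
Proof.
have k := zig_ar_composable f.
split; rewrite ?(lft_vcomp L k) ?(rgt_vcomp L k) ?(top_vcomp L k) ?(bot_vcomp L k).
- by rewrite !lft_tens !(lft_U L) cap_lft cup_lft far_src.
- by rewrite !rgt_tens !(rgt_U L) cap_rgt cup_rgt far_tgt.
- by rewrite top_tens (top_U L) cap_top tens_aid_ar.
- by rewrite bot_tens (bot_U L) cup_bot aid_tens_ar.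
Qed.

Lemma zig_ar_id A : zig_ar (aid A) = sid (zig_ob A).
Proof.
have [h1 h2] := typed_h A A; have [e1 e2] := typed_e A A.
by rewrite /zig_ar cap_id cup_id far_id (sU_id L) -!sid_tens (vcomp_id L) ?h2.
Qed.

Lemma zig_ar_comp f g : atgt f = asrc g -> zig_ar (f ·ₐ g) = zig_ar f ·ₛ zig_ar g.
Proof.
move=> k; have k' : atgt (far F f) = asrc (far F g) by rewrite far_src far_tgt k.
rewrite /zig_ar cap_acomp // cup_acomp // far_comp // (sU_comp L) //.
have k1 : rgt (sU (far F f)) = lft (sU (far F g)) by rewrite (lft_U L) (rgt_U L) k'.
have k2 : rgt (cap_ar eta f) = lft (cap_ar eta g) by rewrite cap_lft cap_rgt k.
have k3 : rgt (cup_ar eps f) = lft (cup_ar eps g) by rewrite cup_lft cup_rgt k.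
rewrite -!hcomp_tens // (interchange L) ?rgt_tens ?lft_tens ?k1 ?k2 ?k3 //.
- exact: zig_ar_composable.
- exact: zig_ar_composable.
Qed.

Lemma zig_pr_spec m : disk (fpr F m ⊙ zig_ob (ptgt m)) (zig_ob (psrc m) ⊙ fpr F m) (zig_pr m)
  /\ invertible (zig_pr m).
Proof.
have [t1 t2] : typed (fpr F m) _ _ := conj (psrc_F m) (ptgt_F m).
have [t3 t4] := typed_h (ptgt m) (ptgt m); have [t5 t6] := typed_h (psrc m) (ptgt m).
have [t7 t8] := typed_h (psrc m) (psrc m); have [t9 t10] := typed_e (ptgt m) (ptgt m).
have [t11 t12] := typed_e (psrc m) (ptgt m); have [t13 t14] := typed_e (psrc m) (psrc m).
have [t15 t16] := typed_wl m (ptgt m) (ptgt m); have [t17 t18] := typed_wm (psrc m) m (ptgt m).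
have [t19 t20] := typed_wr (psrc m) (psrc m) m.
have D1 := slide_h m (ptgt m); have D2 := cup_whisker m (ptgt m).
have D3 := cap_whisker (psrc m) m; have D4 := slideI_e (psrc m) m.
have I1 : invertible (slide (fpr F m) (cap_ob eta (ptgt m))).
  by eexists; apply: slide_inverse.
have I2 : invertible (whisker_r (cup_dk eps m) (fob F (ptgt m))).
  by have [φ I] := cup_invertible eps m; eexists; apply: whisker_r_inverse (cup_disk eps m) I.
have I3 : invertible (whisker_l (fob F (psrc m)) (cap_dk eta m)).
  by have [φ I] := cap_invertible eta m; eexists; apply: whisker_l_inverse (cap_disk eta m) I.
have I4 : invertible (slideI (cup_ob eps (psrc m)) (fpr F m)).
  by eexists; apply: inverse_sym; apply: slide_inverse.
split; first by rewrite /zig_pr; dk.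
rewrite /zig_pr; repeat (apply: invertible_hcomp; [cmp| |]).
all: try by eexists; (apply: (assoc_inverse L); ob) || (apply: inverse_sym; apply: (assoc_inverse L); ob).
- by apply: (invertible_vcomp _ D1 (disk_id _)) => //; [ob|apply: invertible_id].
- by apply: (invertible_vcomp _ (disk_id _) D2) => //; [ob|apply: invertible_id].
- by apply: (invertible_vcomp _ D3 (disk_id _)) => //; [ob|apply: invertible_id].
- by apply: (invertible_vcomp _ (disk_id _) D4) => //; [ob|apply: invertible_id].
Qed.

(** At a unit every step degenerates: the whiskered disks of cup and cap become identities and the
    two slides become coherators, so coherence finishes. *)
Lemma zig_pr_pU A : zig_pr (pU A) = lam (zig_ob A) ·ₛ sid (zig_ob A) ·ₛ rhoI (zig_ob A).
Proof.
have [t1 t2] := typed_h A A; have [t3 t4] := typed_e A A.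
have W1 : whisker_r (cup_dk eps (pU A)) (fob F A)
    = sid (pU (T A A A) ⊙ e A A).
  rewrite cup_pU (whisker_rE _ (disk_id _)) -sid_tens procomp_tens ?bdyE ?tens_unit_ob //.
  by rewrite -pU_tens.
have W2 : whisker_l (fob F A) (cap_dk eta (pU A)) = sid (h A A ⊙ pU (T A A A)).
  rewrite cap_pU (whisker_lE _ (disk_id _)) -sid_tens procomp_tens ?bdyE ?tens_ob_unit //.
  by rewrite -pU_tens tens_obA.
rewrite /zig_pr !psrcU !ptgtU W1 W2 !fpr_U !slide_unit_l !slideI_unit_r -!pU_tens.
rewrite /zig_ob; coh.
Qed.

Lemma asrc_F f : asrc (far F f) = fob F (asrc f). Proof. exact: far_src. Qed.
Lemma atgt_F f : atgt (far F f) = fob F (atgt f). Proof. exact: far_tgt. Qed.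
Lemma asrc_G f : asrc (far G f) = fob G (asrc f). Proof. exact: (far_src G f). Qed.
Lemma atgt_G f : atgt (far G f) = fob G (atgt f). Proof. exact: (far_tgt G f). Qed.
Lemma lft_G (φ : Sq E) : lft (fsq G φ) = fpr G (lft φ). Proof. exact: (fsq_lft G φ). Qed.
Lemma rgt_G (φ : Sq E) : rgt (fsq G φ) = fpr G (rgt φ). Proof. exact: (fsq_rgt G φ). Qed.
Lemma top_G (φ : Sq E) : top (fsq G φ) = far G (bot φ). Proof. exact: (fsq_top G φ). Qed.
Lemma bot_G (φ : Sq E) : bot (fsq G φ) = far G (top φ). Proof. exact: (fsq_bot G φ). Qed.

Let LE := dc_laws E.
Definition sqE := (lft_tens, rgt_tens, top_tens, bot_tens, (lft_U L, rgt_U L, top_U L, bot_U L),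
  (cap_lft, cap_rgt, cap_top, cap_bot), (cup_lft, cup_rgt, cup_top, cup_bot),
  (asrc_F, atgt_F, asrc_G, atgt_G), (lft_G, rgt_G, top_G, bot_G),
  (fsq_lft F, fsq_rgt F, fsq_top F, fsq_bot F),
  (asrc_top LE, atgt_top LE, asrc_bot LE, atgt_bot LE), (aid_tens_ar, tens_aid_ar)).

(** Each of the nine factors of [zig_pr] is natural: [N1] to [N4] treat the four steps, [S1] to [S4]
    the identities standing next to them, [A1] to [A5] the associators. *)
Lemma zig_sq φ :
  (fsq F φ ⊙ₛ zig_ar (bot φ)) ·ₛ zig_pr (rgt φ) = zig_pr (lft φ) ·ₛ (zig_ar (top φ) ⊙ₛ fsq F φ).
Proof.
suff [] : natsq (fsq F φ ⊙ₛ zig_ar (bot φ)) (zig_pr (lft φ)) (zig_pr (rgt φ))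
                (zig_ar (top φ) ⊙ₛ fsq F φ) by [].
(* The caps and cups have an identity on I as top or bottom arrow; the unit square that it
   contributes to a slide is absorbed strictly by the tensor. *)
have unitI : sU (aid (tunit V)) = sid (pU (tunit V)) by rewrite (sU_id L).
pose x := fsq F φ; pose sf := sU (far F (top φ)); pose sg := sU (far F (bot φ)).
pose sf' := sU (far G (top φ)); pose sg' := sU (far G (bot φ)).
pose hf := cap_ar eta (top φ); pose hg := cap_ar eta (bot φ).
pose ef := cup_ar eps (top φ); pose eg := cup_ar eps (bot φ).
have k1 : bot x = top (sg ⊗ₛ hg) by rewrite !sqE.
have k2 : bot (sg ⊗ₛ hg) = top (eg ⊗ₛ sg) by rewrite !sqE tens_arA.
have k3 : bot (sf ⊗ₛ hg) = top (x ⊗ₛ sg' ⊗ₛ sg) by rewrite !sqE tens_arA.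
have k4 : bot (x ⊗ₛ sg' ⊗ₛ sg) = top (eg ⊗ₛ sg) by rewrite !sqE.
have k5 : bot (sf ⊗ₛ hg) = top (sf ⊗ₛ fsq G φ ⊗ₛ sg) by rewrite !sqE tens_arA.
have k6 : bot (sf ⊗ₛ fsq G φ ⊗ₛ sg) = top (ef ⊗ₛ sg) by rewrite !sqE.
have k7 : bot (sf ⊗ₛ hf) = top (sf ⊗ₛ sf' ⊗ₛ x) by rewrite !sqE tens_arA.
have k8 : bot (sf ⊗ₛ sf' ⊗ₛ x) = top (ef ⊗ₛ sg) by rewrite !sqE.
have k9 : bot (sf ⊗ₛ hf) = top (ef ⊗ₛ sf) by rewrite !sqE tens_arA.
have k10 : bot (ef ⊗ₛ sf) = top x by rewrite !sqE.
have N1 : natsq (x ⊙ₛ (sg ⊗ₛ hg)) (slide (fpr F (lft φ)) (cap_ob eta (ptgt (lft φ))))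
    (slide (fpr F (rgt φ)) (cap_ob eta (ptgt (rgt φ)))) ((sf ⊗ₛ hg) ⊙ₛ (x ⊗ₛ sg' ⊗ₛ sg)).
  by have := natsq_slide x hg; rewrite !sqE unitI tens_I_sq sU_tens -tens_sqA.
have N2 : natsq ((x ⊗ₛ sg' ⊗ₛ sg) ⊙ₛ (eg ⊗ₛ sg))
    (whisker_r (cup_dk eps (lft φ)) (fob F (ptgt (lft φ))))
    (whisker_r (cup_dk eps (rgt φ)) (fob F (ptgt (rgt φ))))
    ((sf ⊗ₛ fsq G φ ⊗ₛ sg) ⊙ₛ (ef ⊗ₛ sg)).
  have := @natsq_whisker_r V (far F (bot φ)) _ _ _ _ _ _ _ _ _ _ (x ⊗ₛ sg') eg
    (sf ⊗ₛ fsq G φ) ef (cup_disk eps (lft φ)) (cup_disk eps (rgt φ)).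
  by rewrite !sqE; apply=> //; apply: cup_sq.
have N3 : natsq ((sf ⊗ₛ hg) ⊙ₛ (sf ⊗ₛ fsq G φ ⊗ₛ sg))
    (whisker_l (fob F (psrc (lft φ))) (cap_dk eta (lft φ)))
    (whisker_l (fob F (psrc (rgt φ))) (cap_dk eta (rgt φ)))
    ((sf ⊗ₛ hf) ⊙ₛ (sf ⊗ₛ sf' ⊗ₛ x)).
  have := @natsq_whisker_l V (far F (top φ)) _ _ _ _ _ _ _ _ _ _ hg (fsq G φ ⊗ₛ sg)
    hf (sf' ⊗ₛ x) (cap_disk eta (lft φ)) (cap_disk eta (rgt φ)).
  by rewrite !sqE !tens_sqA; apply=> //; apply: cap_sq.
have N4 : natsq ((sf ⊗ₛ sf' ⊗ₛ x) ⊙ₛ (ef ⊗ₛ sg))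
    (slideI (cup_ob eps (psrc (lft φ))) (fpr F (lft φ)))
    (slideI (cup_ob eps (psrc (rgt φ))) (fpr F (rgt φ))) ((ef ⊗ₛ sf) ⊙ₛ x).
  by have := natsq_slideI ef x; rewrite !sqE unitI tensI_sq sU_tens.
have SD (a : Pr V) : disk a a (sid a) := disk_id a.
have B1 m : bot (slide (fpr F m) (cap_ob eta (ptgt m))) = top (sid (e (ptgt m) (ptgt m))).
  apply: (disk_bot_top _ (slide_h m _) (SD _)).
  by rewrite (ptgt_comp L) !bdyE // tens_obA.
have B2 m : bot (sid (h (psrc m) (ptgt m))) = top (whisker_r (cup_dk eps m) (fob F (ptgt m))).
  apply: (disk_bot_top _ (SD _) (cup_whisker m _)).
  by rewrite (psrc_comp L) !bdyE // tens_obA.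
have B3 m : bot (whisker_l (fob F (psrc m)) (cap_dk eta m)) = top (sid (e (psrc m) (ptgt m))).
  apply: (disk_bot_top _ (cap_whisker _ m) (SD _)).
  by rewrite (ptgt_comp L) !bdyE // tens_obA.
have B4 m : bot (sid (h (psrc m) (psrc m))) = top (slideI (cup_ob eps (psrc m)) (fpr F m)).
  apply: (disk_bot_top _ (SD _) (slideI_e _ m)).
  by rewrite (psrc_comp L) !bdyE // tens_obA.
have S1 : natsq (eg ⊗ₛ sg) (sid (e (ptgt (lft φ)) (ptgt (lft φ))))
    (sid (e (ptgt (rgt φ)) (ptgt (rgt φ)))) (eg ⊗ₛ sg).
  by have := natsq_sid (eg ⊗ₛ sg); rewrite !sqE.
have S2 : natsq (sf ⊗ₛ hg) (sid (h (psrc (lft φ)) (ptgt (lft φ))))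
    (sid (h (psrc (rgt φ)) (ptgt (rgt φ)))) (sf ⊗ₛ hg).
  by have := natsq_sid (sf ⊗ₛ hg); rewrite !sqE.
have S3 : natsq (ef ⊗ₛ sg) (sid (e (psrc (lft φ)) (ptgt (lft φ))))
    (sid (e (psrc (rgt φ)) (ptgt (rgt φ)))) (ef ⊗ₛ sg).
  by have := natsq_sid (ef ⊗ₛ sg); rewrite !sqE.
have S4 : natsq (sf ⊗ₛ hf) (sid (h (psrc (lft φ)) (psrc (lft φ))))
    (sid (h (psrc (rgt φ)) (psrc (rgt φ)))) (sf ⊗ₛ hf).
  by have := natsq_sid (sf ⊗ₛ hf); rewrite !sqE.
rewrite /zig_pr /zig_ar -/x -/sf -/sg -/hf -/hg -/ef -/eg.
have A1 := natsq_assocI k1 k2; have A2 := natsq_assoc k3 k4.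
have A3 := natsq_assocI k5 k6; have A4 := natsq_assoc k7 k8; have A5 := natsq_assocI k9 k10.
rewrite !sqE in A1 A2 A3 A4 A5.
(* Composites are bracketed to the left, so the factors are peeled off from the last one
   backwards. *)
apply: natsq_hcomp A5.
apply: natsq_hcomp (natsq_vcomp S4 N4 _ (B4 _) (B4 _) _);
  last first; [by rewrite (top_vcomp L)|by rewrite (top_vcomp L)|].
apply: natsq_hcomp A4.
apply: natsq_hcomp (natsq_vcomp N3 S3 _ (B3 _) (B3 _) _);
  last first; [by rewrite (bot_vcomp L)|by rewrite (bot_vcomp L)|].
apply: natsq_hcomp A3.
apply: natsq_hcomp (natsq_vcomp S2 N2 _ (B2 _) (B2 _) _);
  last first; [by rewrite (top_vcomp L)|by rewrite (top_vcomp L)|].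
apply: natsq_hcomp A2.
apply: natsq_hcomp (natsq_vcomp N1 S1 _ (B1 _) (B1 _) _);
  last first; [by rewrite (bot_vcomp L)|by rewrite (bot_vcomp L)|].
exact: A1.
Qed.

(** * Zigzags at a composite proarrow *)

Section Composite.
Variables m n : Pr E.
Hypothesis mn : ptgt m = psrc n.
Local Notation A := (psrc m).
Local Notation B := (ptgt m).
Local Notation X := (ptgt n).

Lemma composable_F : ptgt (fpr F m) = psrc (fpr F n).
Proof. by rewrite !bdyE mn. Qed.

Lemma composable_G : ptgt (fpr G n) = psrc (fpr G m).
Proof. by rewrite !bdyE mn. Qed.

(** This disk and those of [merge_m] and [merge_r] play the roles of [d1], [d2] and [d3] in
    [zigzag_paste]. *)
Lemma merge_l Q R :
  disk (wl m Q R ⊙ wl n Q R) ((fpr F m ⊙ fpr F n) ⊗ pU (fob G Q) ⊗ pU (fob F R))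
       (sid (fpr F m ⊙ fpr F n) ⊗ₛ lam (pU (fob G Q)) ⊗ₛ lam (pU (fob F R))) /\
  inverse (sid (fpr F m ⊙ fpr F n) ⊗ₛ lam (pU (fob G Q)) ⊗ₛ lam (pU (fob F R)))
          (sid (fpr F m ⊙ fpr F n) ⊗ₛ lamI (pU (fob G Q)) ⊗ₛ lamI (pU (fob F R))).
Proof.
have q := composable_F; split.
  rewrite -!procomp_tens ?bdyE ?mn //.
  by do !apply: disk_tens; first [exact: disk_id|exact: lamU_disk].
by do !apply: inverse_tens; first [exact: inverse_id|exact: (lam_inverse L)].
Qed.

Lemma merge_m P R :
  disk (wm P n R ⊙ wm P m R) (pU (fob F P) ⊗ (fpr G n ⊙ fpr G m) ⊗ pU (fob F R))
       (lam (pU (fob F P)) ⊗ₛ sid (fpr G n ⊙ fpr G m) ⊗ₛ lam (pU (fob F R))) /\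
  inverse (lam (pU (fob F P)) ⊗ₛ sid (fpr G n ⊙ fpr G m) ⊗ₛ lam (pU (fob F R)))
          (lamI (pU (fob F P)) ⊗ₛ sid (fpr G n ⊙ fpr G m) ⊗ₛ lamI (pU (fob F R))).
Proof.
have q := composable_G; split.
  rewrite -!procomp_tens ?bdyE ?mn //.
  by do !apply: disk_tens; first [exact: disk_id|exact: lamU_disk].
by do !apply: inverse_tens; first [exact: inverse_id|exact: (lam_inverse L)].
Qed.

Lemma merge_r P Q :
  disk (wr P Q m ⊙ wr P Q n) (pU (fob F P) ⊗ pU (fob G Q) ⊗ (fpr F m ⊙ fpr F n))
       (lam (pU (fob F P)) ⊗ₛ lam (pU (fob G Q)) ⊗ₛ sid (fpr F m ⊙ fpr F n)) /\
  inverse (lam (pU (fob F P)) ⊗ₛ lam (pU (fob G Q)) ⊗ₛ sid (fpr F m ⊙ fpr F n))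
          (lamI (pU (fob F P)) ⊗ₛ lamI (pU (fob G Q)) ⊗ₛ sid (fpr F m ⊙ fpr F n)).
Proof.
have q := composable_F; split.
  rewrite -!procomp_tens ?bdyE ?mn //.
  by do !apply: disk_tens; first [exact: disk_id|exact: lamU_disk].
by do !apply: inverse_tens; first [exact: inverse_id|exact: (lam_inverse L)].
Qed.

(** The equation for [D1] in [zigzag_paste]. The cap starts at I, whose unitor is an identity, so
    the initial splitting in [slide_comp] disappears; in [slideI_procomp], which is the equation for
    [D4], the final merge does. *)
Lemma slide_procomp :
  slide (fpr F m ⊙ fpr F n) (cap_ob eta X)
  = assoc (fpr F m) (fpr F n) (h X X)
    ·ₛ (sid (fpr F m) ⊙ₛ slide (fpr F n) (cap_ob eta X))
    ·ₛ assocI (fpr F m) (h B X) (wl n X X)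
    ·ₛ (slide (fpr F m) (cap_ob eta X) ⊙ₛ sid (wl n X X))
    ·ₛ assoc (h A X) (wl m X X) (wl n X X)
    ·ₛ (sid (h A X) ⊙ₛ (sid (fpr F m ⊙ fpr F n) ⊗ₛ lam (pU (fob G X)) ⊗ₛ lam (pU (fob F X)))).
Proof.
have q : ptgt (fpr F m) = psrc (fpr F n) by rewrite !bdyE mn.
rewrite (slide_comp (A := fob F A) (B := fob F B) (B' := fob F X) (P := tunit V)
  (Q := fob G X ⊗ₒ fob F X)); try by rewrite !bdyE ?mn.
rewrite !tens_I lamI_tunit tens_I_sq pU_tens lam_tens -!tens_prA -!tens_sqA.
have [h1 h2] := typed_h X X.
have q' : ptgt (fpr F n) = psrc (h X X) by rewrite h1 !bdyE.
rewrite (vcomp_id L); last by ob.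
have D := assoc_disk L q q'; have [l _ _ _] := D.
by rewrite (disk_idl D).
Qed.

Lemma slideI_procomp :
  slideI (cup_ob eps A) (fpr F m ⊙ fpr F n)
  = ((lamI (pU (fob F A)) ⊗ₛ lamI (pU (fob G A)) ⊗ₛ sid (fpr F m ⊙ fpr F n)) ⊙ₛ sid (e A X))
    ·ₛ assoc (wr A A m) (wr A A n) (e A X)
    ·ₛ (sid (wr A A m) ⊙ₛ slideI (cup_ob eps A) (fpr F n))
    ·ₛ assocI (wr A A m) (e A B) (fpr F n)
    ·ₛ (slideI (cup_ob eps A) (fpr F m) ⊙ₛ sid (fpr F n))
    ·ₛ assoc (e A A) (fpr F m) (fpr F n).
Proof.
have q : ptgt (fpr F m) = psrc (fpr F n) by rewrite !bdyE mn.
rewrite (slideI_comp (A := fob F A) (B := fob F B) (B' := fob F X)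
  (P := fob F A ⊗ₒ fob G A) (Q := tunit V)); try by rewrite !bdyE ?mn.
rewrite !tensI lam_tunit tensI_sq pU_tens lamI_tens.
have [h1 h2] := typed_e A A.
have q' : ptgt (e A A) = psrc (fpr F m) by rewrite h2 !bdyE.
rewrite (vcomp_id L); last by ob.
have D1 := slideI_e A m; have [h3 h4] := typed_e A B; have [h5 h6] := typed_wr A A m.
have D2 := slideI_e A n; rewrite -mn in D2; have [h7 h8] := typed_e A X.
have [h9 h10] := typed_wr A A n; rewrite -mn in h9.
have [k1 k2] : typed (fpr F m) _ _ := conj (psrc_F m) (ptgt_F m).
have [D3 I3] := merge_r A A; have D4 := disk_inverse D3 I3.
have k3 : ptgt (pU (fob F A) ⊗ pU (fob G A) ⊗ (fpr F m ⊙ fpr F n)) = psrc (e A X).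
  by have [_ <-] := disk_bdy D3; rewrite (ptgt_comp L); congruence.
rewrite -[X in _ = _ ·ₛ X](disk_idr (assoc_disk L q' q)) [LHS](hcompA L) //; cmp.
Qed.

(** The equation for [D2]: the composition axiom of the cup, whiskered, with [whisker_r_slide]
    turning its middle disk into a slide of whiskered proarrows. *)
Lemma cup_whisker_procomp :
  whisker_r (cup_dk eps (m ⊙ n)) (fob F X)
  = ((sid (fpr F m ⊙ fpr F n) ⊗ₛ lamI (pU (fob G X)) ⊗ₛ lamI (pU (fob F X))) ⊙ₛ sid (e X X))
    ·ₛ tripR (wl m X X) (wl n X X) (e X X) (wm B n X) (e B X) (wm A n X) (wl m B X)
             (wm A m X) (e A X) (whisker_r (cup_dk eps n) (fob F X))
             (slide (fpr F m) (fpr G n ⊗ pU (fob F X))) (whisker_r (cup_dk eps m) (fob F X))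
    ·ₛ ((lam (pU (fob F A)) ⊗ₛ sid (fpr G n ⊙ fpr G m) ⊗ₛ lam (pU (fob F X))) ⊙ₛ sid (e A X)).
Proof.
have q1 : ptgt (fpr F m) = psrc (fpr F n) by rewrite !bdyE mn.
have q2 : ptgt (fpr G n) = psrc (fpr G m) by rewrite !bdyE mn.
have Dn := cup_disk eps n; rewrite -mn in Dn; have Dm := cup_disk eps m.
have Ds := slide_disk (fpr F m) (fpr G n); rewrite !bdyE -mn in Ds.
rewrite cup_procomp // (whisker_r_tripR (y := (fpr F m ⊙ fpr F n) ⊗ pU (fob G X))
  (z := pU (fob F A) ⊗ (fpr G n ⊙ fpr G m)) _ _ _ _ _ _ _ _ _ _ _ Dn Ds Dm).
- by rewrite whisker_r_slide.
all: try by rewrite ?bdyE ?(ptgt_comp L q1) ?(psrc_comp L q2) ?(ptgt_comp L q2) ?bdyE ?mn.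
- rewrite -procomp_tens ?bdyE ?mn //.
  by apply: disk_tens; [exact: disk_id|exact: lamIU_disk].
- rewrite -procomp_tens ?bdyE ?mn //.
  by apply: disk_tens; [exact: lamU_disk|exact: disk_id].
Qed.

(** The equation for [D3], obtained in the same way from the cap and [whisker_l_slideI]. *)
Lemma cap_whisker_procomp :
  whisker_l (fob F A) (cap_dk eta (m ⊙ n))
  = (sid (h A X) ⊙ₛ (lamI (pU (fob F A)) ⊗ₛ sid (fpr G n ⊙ fpr G m) ⊗ₛ lamI (pU (fob F X))))
    ·ₛ tripL (h A X) (wm A n X) (wm A m X) (h A B) (wr A B n) (wm A m B) (wr A A n)
             (h A A) (wr A A m) (whisker_l (fob F A) (cap_dk eta n))
             (slideI (pU (fob F A) ⊗ fpr G m) (fpr F n)) (whisker_l (fob F A) (cap_dk eta m))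
    ·ₛ (sid (h A A) ⊙ₛ (lam (pU (fob F A)) ⊗ₛ lam (pU (fob G A)) ⊗ₛ sid (fpr F m ⊙ fpr F n))).
Proof.
have q1 := composable_F; have q2 := composable_G.
have Dn := cap_disk eta n; rewrite -mn in Dn; have Dm := cap_disk eta m.
have Ds := slideI_disk (fpr G m) (fpr F n); rewrite !bdyE -mn in Ds.
rewrite cap_procomp // (whisker_l_tripL (y := (fpr G n ⊙ fpr G m) ⊗ pU (fob F X))
  (z := pU (fob G A) ⊗ (fpr F m ⊙ fpr F n)) _ _ _ _ _ _ _ _ _ _ _ Dn Ds Dm).
- by rewrite whisker_l_slideI -!tens_prA -!tens_sqA.
all: try by rewrite ?bdyE ?(ptgt_comp L q1) ?(psrc_comp L q1) ?(psrc_comp L q2) ?bdyE ?mn.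
- rewrite -procomp_tens ?bdyE ?mn //.
  by apply: disk_tens; [exact: disk_id|exact: lamIU_disk].
- rewrite -procomp_tens ?bdyE ?mn //.
  by apply: disk_tens; [exact: lamU_disk|exact: disk_id].
Qed.

Lemma zig_procomp :
  zig_pr (m ⊙ n)
  = assoc (fpr F m) (fpr F n) (zig_ob X)
    ·ₛ (sid (fpr F m) ⊙ₛ zig_pr n)
    ·ₛ assocI (fpr F m) (zig_ob B) (fpr F n)
    ·ₛ (zig_pr m ⊙ₛ sid (fpr F n))
    ·ₛ assoc (zig_ob A) (fpr F m) (fpr F n).
Proof.
have q1 := composable_F; have q2 := composable_G.
have [h1 h2 h3 h4] : [/\ psrc (m ⊙ n) = A, ptgt (m ⊙ n) = X,
    fpr F (m ⊙ n) = fpr F m ⊙ fpr F n & fpr G (m ⊙ n) = fpr G n ⊙ fpr G m].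
  split; [exact: (psrc_comp LE)|exact: (ptgt_comp LE)|exact: fpr_comp|].
  by rewrite -(fpr_comp G).
rewrite /zig_pr h1 h2 h3 h4 -mn /zig_ob.
have [M1 J1] := merge_l X X; have [M2 J2] := merge_m A X; have [M3 J3] := merge_r A A.
have Dc := slide_disk (fpr F m) (pU (fob G B) ⊗ fpr F n).
have Ic := slide_inverse (fpr F m) (pU (fob G B) ⊗ fpr F n).
have Dsw := slide_disk (fpr F m) (fpr G n ⊗ pU (fob F X)).
have Dsv := slideI_disk (pU (fob F A) ⊗ fpr G m) (fpr F n).
rewrite !bdyE -mn ?pU_tens -?tens_prA in Dc Dsw Dsv.
have Tm : typed (fpr F m) (fob F A) (fob F B) by split; rewrite !bdyE.
have Tn : typed (fpr F n) (fob F B) (fob F X) by split; rewrite !bdyE ?mn.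
have Wl Q R : typed (wl n Q R) (T B Q R) (T X Q R) by rewrite mn; apply: typed_wl.
have Wm P R : typed (wm P n R) (T P X R) (T P B R) by rewrite mn; apply: typed_wm.
have Wr P Q : typed (wr P Q n) (T P Q B) (T P Q X) by rewrite mn; apply: typed_wr.
have S1 := slide_h n X; have S2 := cup_whisker n X; have S3 P := cap_whisker P n.
have S4 Q := slideI_e Q n; rewrite -mn in S1 S2 S3 S4.
have Tmn1 : typed ((fpr F m ⊙ fpr F n) ⊗ pU (fob G X) ⊗ pU (fob F X)) (T A X X) (T X X X).
  by split; rewrite !bdyE ?(psrc_comp L q1) ?(ptgt_comp L q1) !bdyE.
have Tmn2 : typed (pU (fob F A) ⊗ (fpr G n ⊙ fpr G m) ⊗ pU (fob F X)) (T A X X) (T A A X).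
  by split; rewrite !bdyE ?(psrc_comp L q2) ?(ptgt_comp L q2) !bdyE.
have Tmn3 : typed (pU (fob F A) ⊗ pU (fob G A) ⊗ (fpr F m ⊙ fpr F n)) (T A A A) (T A A X).
  by split; rewrite !bdyE ?(psrc_comp L q1) ?(ptgt_comp L q1) !bdyE.
have K := zigzag_paste Tm Tn (typed_h X X) (typed_h B X) (typed_h A X) (typed_h B B)
  (typed_h A B) (typed_h A A) (typed_e X X) (typed_e B X) (typed_e A X) (typed_e B B)
  (typed_e A B) (typed_e A A) (Wl X X) (typed_wl m X X) (Wm B X) (Wm A X) (typed_wl m B X)
  (typed_wm A m X) (Wr A B) (Wr B B) (typed_wl m B B) (typed_wm A m B) (typed_wr A A m)
  (Wr A A) Tmn1 Tmn2 Tmn3 S1 (slide_h m X) (slide_h m B) S2 (cup_whisker m X)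
  (cup_whisker m B) (S3 A) (cap_whisker A m) (S3 B) (S4 A) (slideI_e A m) (S4 B)
  Dsw Dsv Dc Ic M1 J1 M2 J2 M3 J3 slide_procomp cup_whisker_procomp cap_whisker_procomp
  slideI_procomp.
have Dn := cap_disk eta n; rewrite -mn in Dn.
apply: K.
(* The proarrow m slides past the disk of η at n. *)
- have := @slide_whisker_l V (fpr F m) _ _ _ _ _ (fob F A) (fob F B) (tunit V)
    (fob G X ⊗ₒ fob F X) (fob G B ⊗ₒ fob F B) (fob G B ⊗ₒ fob F X)
    _ _ _ _ _ _ _ _ _ _ Dn.
  rewrite /slide2 !tens_I !pU_tens -!tens_prA; apply; by rewrite !bdyE ?mn.
(* The proarrow n slides past the disk of ε at m. The slide arising here carries the unit on G B
   next to m, whereas [c] was chosen with this unit next to n; [slideI_unit_mid] identifies the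
   two. *)
- have := @slide_whisker_r V (fpr F n) _ _ _ _ _ (fob F B) (fob F X) (fob F A ⊗ₒ fob G B)
    (fob F B ⊗ₒ fob G B) (fob F A ⊗ₒ fob G A) (tunit V) _ _ _ _ _ _ _ _ _ _ (cup_disk eps m).
  rewrite /slideI2 slideI_unit_mid !tensI !pU_tens; apply; by rewrite !bdyE ?mn.
Qed.
End Composite.

(** Transparent, so that the descriptions of the components in the theorem hold by conversion. *)
Definition zigzag : natTrans F F.
Proof.
refine (@NatTrans E V F F zig_ob zig_ar zig_pr zig_ob_src zig_ob_tgt _ _ _ _ _ _ zig_ar_id
  zig_ar_comp zig_pr_pU zig_procomp zig_sq).
- by move=> f; case: (zig_ar_bdy f).
- by move=> f; case: (zig_ar_bdy f).
- by move=> f; case: (zig_ar_bdy f).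
- by move=> f; case: (zig_ar_bdy f).
- by move=> m; case: (zig_pr_spec m).
- by move=> m; case: (zig_pr_spec m).
Defined.

End Duality.

(** * Dinaturality with the unit proarrow removed *)

Section DinaturalPaste.
Variable C : doubleCat.
Let L := dc_laws C.

(** The constant functor at I contributes only copies of U_I and their unitors to the composition
    axiom, and coherence discards them. The disks [s], [w], [z] stand for the splitting, exchange
    and merging of the other functor. *)
Lemma cap_paste (I A B X M N P : Ob C)
    (hX hB hA nX mX Bn mB An Am Y Z : Pr C) (dm dn dmn s w z : Sq C) :
  typed hX I X -> typed hB I B -> typed hA I A -> typed nX X M -> typed mX M N ->
  typed Bn B M -> typed mB B P -> typed An P N -> typed Am A P ->
  typed Y X N -> typed Z A N ->
  disk (pU I ⊙ hX ⊙ nX) (pU I ⊙ hB ⊙ Bn) dn -> disk (pU I ⊙ hB ⊙ mB) (pU I ⊙ hA ⊙ Am) dm ->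
  disk Y (nX ⊙ mX) s -> disk (Bn ⊙ mX) (mB ⊙ An) w -> disk (Am ⊙ An) Z z ->
  dmn = (lamI (pU I) ⊙ₛ sid hX ⊙ₛ s)
    ·ₛ nest (pU I) (pU I) hX nX mX
    ·ₛ (sid (pU I) ⊙ₛ dn ⊙ₛ sid mX)
    ·ₛ unnest (pU I) (pU I) hB Bn mX
    ·ₛ ((lam (pU I) ·ₛ lamI (pU I)) ⊙ₛ sid hB ⊙ₛ w)
    ·ₛ nest (pU I) (pU I) hB mB An
    ·ₛ (sid (pU I) ⊙ₛ dm ⊙ₛ sid An)
    ·ₛ unnest (pU I) (pU I) hA Am An
    ·ₛ (lam (pU I) ⊙ₛ sid hA ⊙ₛ z) ->
  (lamI hX ⊙ₛ sid Y) ·ₛ dmn ·ₛ (lam hA ⊙ₛ sid Z)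
  = (sid hX ⊙ₛ s)
    ·ₛ tripL hX nX mX hB Bn mB An hA Am
         ((lamI hX ⊙ₛ sid nX) ·ₛ dn ·ₛ (lam hB ⊙ₛ sid Bn)) w
         ((lamI hB ⊙ₛ sid mB) ·ₛ dm ·ₛ (lam hA ⊙ₛ sid Am))
    ·ₛ (sid hA ⊙ₛ z).
Proof.
do 11! case=> ? ?; move=> D1 D2 D3 D4 D5 ->; rewrite /tripL /nest /unnest.
coh.
Qed.

Lemma cup_paste (I A B X M N P : Ob C)
    (eX eB eA nX mX Bn mB An Am Y Z : Pr C) (dm dn dmn s w z : Sq C) :
  typed eX X I -> typed eB B I -> typed eA A I -> typed nX M X -> typed mX N M ->
  typed Bn M B -> typed mB P B -> typed An N P -> typed Am P A ->
  typed Y N X -> typed Z N A ->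
  disk (nX ⊙ eX ⊙ pU I) (Bn ⊙ eB ⊙ pU I) dn -> disk (mB ⊙ eB ⊙ pU I) (Am ⊙ eA ⊙ pU I) dm ->
  disk Y (mX ⊙ nX) s -> disk (mX ⊙ Bn) (An ⊙ mB) w -> disk (An ⊙ Am) Z z ->
  dmn = (s ⊙ₛ sid eX ⊙ₛ lamI (pU I))
    ·ₛ nest mX nX eX (pU I) (pU I)
    ·ₛ (sid mX ⊙ₛ dn ⊙ₛ sid (pU I))
    ·ₛ unnest mX Bn eB (pU I) (pU I)
    ·ₛ (w ⊙ₛ sid eB ⊙ₛ (lam (pU I) ·ₛ lamI (pU I)))
    ·ₛ nest An mB eB (pU I) (pU I)
    ·ₛ (sid An ⊙ₛ dm ⊙ₛ sid (pU I))
    ·ₛ unnest An Am eA (pU I) (pU I)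
    ·ₛ (z ⊙ₛ sid eA ⊙ₛ lam (pU I)) ->
  rhoI (Y ⊙ eX) ·ₛ dmn ·ₛ rho (Z ⊙ eA)
  = (s ⊙ₛ sid eX)
    ·ₛ tripR mX nX eX Bn eB An mB Am eA
         (rhoI (nX ⊙ eX) ·ₛ dn ·ₛ rho (Bn ⊙ eB)) w
         (rhoI (mB ⊙ eB) ·ₛ dm ·ₛ rho (Am ⊙ eA))
    ·ₛ (z ⊙ₛ sid eA).
Proof.
do 11! case=> ? ?; move=> D1 D2 D3 D4 D5 ->; rewrite /tripR /nest /unnest.
coh.
Qed.

End DinaturalPaste.

(** * The zigzags of a cap and a cup *)

Section FromDinatural.
Variables (C : monoidalDC) (star : monoidalFunctor (reflectM C) C).
Let L := dc_laws C.
Local Notation G := (mfun star : functor (reflectDC C) C).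
Local Notation U := (pU (tunit C)).

(** All splitting, exchange and merging squares of the constant functor are built from
    [fsq (munit C) tt]; this lemma and the next give it the shapes expected by [cap_paste] and
    [cup_paste]. *)
Lemma munit_sq : fsq (munit C) tt = lam U.
Proof. by rewrite lam_tunit sid_tunit. Qed.

Lemma munit_sqI : fsq (munit C) tt = lamI U.
Proof. by rewrite lamI_tunit sid_tunit. Qed.

Lemma star_pU A : fpr G (pU A) = pU (fob G A).
Proof. exact: (fpr_U G A). Qed.

Lemma star_sid (m : Pr C) : fsq G (sid m) = sid (fpr G m).
Proof. exact: (fsq_id G m). Qed.

Lemma star_procomp (m n : Pr C) : ptgt m = psrc n -> fpr G (m ⊙ n) = fpr G n ⊙ fpr G m.
Proof. by move=> h; rewrite -(fpr_comp G). Qed.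

(** The domain of ( )^* is the reflection, in which the two unitors are exchanged. *)
Lemma star_rho (m : Pr C) : fsq G (rho m) = lam (fpr G m).
Proof. exact: (fsq_lam G m). Qed.

Lemma star_lam (m : Pr C) : fsq G (lam m) = rho (fpr G m).
Proof. exact: (fsq_rho G m). Qed.

Lemma star_lamI (m : Pr C) : fsq G (lamI m) = rhoI (fpr G m).
Proof.
have I := fsq_inverse G (rho_inverse (dc_laws (reflectDC C)) m).
have {}I : inverse (rho (fpr G m)) (fsq G (lamI m)) by rewrite -star_lam.
exact: inverse_uniq I (rho_inverse L _).
Qed.

(** The left-hand side is the exchange square [dswap] of [star_tens], which is thus a slide of a
    proarrow past a starred one. *)
Lemma star_swap (m n : Pr C) :
  (fsq G (rho m) ⊗ₛ rho n) ·ₛ (fsq G (lamI m) ⊗ₛ lamI n) = slideI (fpr G m) n.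
Proof.
have D1 := lam_disk L (fpr G m); have D2 := rhoI_disk (fpr G m).
have D3 := rho_disk L n; have D4 := lamI_disk n.
by rewrite star_rho star_lamI slideIE hcomp_tens; try cmp.
Qed.

Lemma swap_star (m n : Pr C) :
  (rho m ⊗ₛ fsq G (rho n)) ·ₛ (lamI m ⊗ₛ fsq G (lamI n)) = slide m (fpr G n).
Proof.
have D1 := lam_disk L (fpr G n); have D2 := rhoI_disk (fpr G n).
have D3 := rho_disk L m; have D4 := lamI_disk m.
by rewrite star_rho star_lamI slideE hcomp_tens; try cmp.
Qed.

Section Cap.
Variable eta : cap star.
Implicit Types (A B : Ob C) (m n : Pr C) (f : Ar C) (φ : Sq C).

Lemma dn_cap_disk m :
  disk (U ⊙ dn_ob eta (ptgt m) ⊙ (fpr G m ⊗ pU (ptgt m)))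
       (U ⊙ dn_ob eta (psrc m) ⊙ (pU (fob G (psrc m)) ⊗ m)) (dn_pr eta m).
Proof. by rewrite pU_tunit -star_pU; apply: (dn_pr_disk eta m). Qed.

Lemma eta_src A : psrc (dn_ob eta A) = tunit C.
Proof. exact: (dn_ob_src eta A). Qed.

Lemma eta_tgt A : ptgt (dn_ob eta A) = fob G A ⊗ₒ A.
Proof. exact: (dn_ob_tgt eta A). Qed.

Lemma psrc_star m : psrc (fpr G m) = fob G (ptgt m).
Proof. exact: (fpr_src G m). Qed.

Lemma ptgt_star m : ptgt (fpr G m) = fob G (psrc m).
Proof. exact: (fpr_tgt G m). Qed.

Lemma lam_eta_disk A : disk (U ⊙ dn_ob eta A) (dn_ob eta A) (lam (dn_ob eta A)).
Proof. by have := lam_disk L (dn_ob eta A); rewrite eta_src. Qed.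

Lemma lamI_eta_disk A : disk (dn_ob eta A) (U ⊙ dn_ob eta A) (lamI (dn_ob eta A)).
Proof. by have := lamI_disk (dn_ob eta A); rewrite eta_src. Qed.

Definition etaE := (psrc_tens, ptgt_tens, @psrcU C, @ptgtU C, eta_src, eta_tgt, psrc_star, ptgt_star).

Lemma cap_pr_spec m :
  disk (dn_ob eta (ptgt m) ⊙ (fpr G m ⊗ pU (ptgt m)))
       (dn_ob eta (psrc m) ⊙ (pU (fob G (psrc m)) ⊗ m)) (cap_pr eta m) /\
  invertible (cap_pr eta m).
Proof.
have D := dn_cap_disk m.
have D1 := lamI_eta_disk (ptgt m); have D2 := lam_eta_disk (psrc m).
have q1 : ptgt (dn_ob eta (ptgt m)) = psrc (fpr G m ⊗ pU (ptgt m)) by rewrite !etaE.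
have q2 : ptgt (U ⊙ dn_ob eta (psrc m)) = psrc (pU (fob G (psrc m)) ⊗ m).
  by rewrite (ptgt_comp L) !etaE.
have E1 := disk_vcomp q1 D1 (disk_id _); have E2 := disk_vcomp q2 D2 (disk_id _).
split; first exact: disk_hcomp (disk_hcomp E1 D) E2.
apply: invertible_hcomp; first exact: disk_cmp (disk_hcomp E1 D) E2.
  apply: invertible_hcomp; [exact: disk_cmp E1 D| |exact: (dn_pr_inv eta m)].
  apply: invertible_vcomp q1 D1 (disk_id _) _ (invertible_id _).
  by exists (lam (dn_ob eta (ptgt m))); apply/inverse_sym/(lam_inverse L).
apply: invertible_vcomp q2 D2 (disk_id _) _ (invertible_id _).
by exists (lamI (dn_ob eta (psrc m))); apply: (lam_inverse L).
Qed.

Lemma cap_pr_pU A : cap_pr eta (pU A) = sid (dn_ob eta A ⊙ pU (fob G A ⊗ₒ A)).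
Proof.
have h1 := eta_src A; have h2 := eta_tgt A.
rewrite /cap_pr !ptgtU !psrcU dn_pr_U /star_pr /star_ob star_pU -pU_tens /dob /= -/(tunit C).
coh.
Qed.

Lemma cap_pr_procomp m n : ptgt m = psrc n ->
  let A := psrc m in let B := ptgt m in let X := ptgt n in
  cap_pr eta (m ⊙ n)
  = (sid (dn_ob eta X) ⊙ₛ (sid (fpr G n ⊙ fpr G m) ⊗ₛ lamI (pU X)))
    ·ₛ tripL (dn_ob eta X) (fpr G n ⊗ pU X) (fpr G m ⊗ pU X)
             (dn_ob eta B) (pU (fob G B) ⊗ n) (fpr G m ⊗ pU B)
             (pU (fob G A) ⊗ n) (dn_ob eta A) (pU (fob G A) ⊗ m)
             (cap_pr eta n) (slideI (fpr G m) n) (cap_pr eta m)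
    ·ₛ (sid (dn_ob eta A) ⊙ₛ (lam (pU (fob G A)) ⊗ₛ sid (m ⊙ n))).
Proof.
move=> mn A B X.
have [h1 h2] : psrc (m ⊙ n) = A /\ ptgt (m ⊙ n) = X.
  by split; [exact: (psrc_comp L)|exact: (ptgt_comp L)].
have Dn := dn_cap_disk n; have Dm := dn_cap_disk m; rewrite -mn in Dn.
have q1 : ptgt (fpr G n) = psrc (fpr G m) by rewrite !etaE mn.
rewrite /cap_pr h1 h2 -mn -/A -/B -/X /star_pr /star_ob star_procomp //.
apply: (cap_paste (I := tunit C) (A := fob G A ⊗ₒ A) (B := fob G B ⊗ₒ B) (X := fob G X ⊗ₒ X)
  (M := fob G B ⊗ₒ X) (N := fob G A ⊗ₒ X) (P := fob G A ⊗ₒ B)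
  (dm := dn_pr eta m) (dn := dn_pr eta n) (w := slideI (fpr G m) n)
  _ _ _ _ _ _ _ _ _ _ _ Dn Dm).
all: rewrite /A /B /X.
all: try by split; rewrite ?etaE ?(psrc_comp L) ?(ptgt_comp L) ?etaE ?mn.
- rewrite -procomp_tens ?etaE ?mn //.
  by apply: disk_tens; [exact: disk_id|exact: lamIU_disk].
- by have := slideI_disk (fpr G m) n; rewrite !etaE mn.
- rewrite -procomp_tens ?etaE ?mn //.
  by apply: disk_tens; [exact: lamU_disk|exact: disk_id].
- rewrite (dn_pr_comp eta mn).
  (* What remains is to recognise the structural squares of the axiom [dn_pr_comp] as those of
     [cap_paste]. *)
  have -> : dsplit_r (constI C) (ptgt n) m n = lamI U by exact: munit_sqI.
  have -> : dmerge_l (constI C) m n (psrc m) = lam U by exact: munit_sq.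
  have -> : dswap (constI C) m n = lam U ·ₛ lamI U by rewrite -munit_sqI -munit_sq.
  have -> : dsplit_l (star_tens star) m n (ptgt n) = sid (fpr G n ⊙ fpr G m) ⊗ₛ lamI (pU (ptgt n)).
    by rewrite -star_procomp // -star_sid.
  have -> : dmerge_r (star_tens star) (psrc m) m n = lam (pU (fob G (psrc m))) ⊗ₛ sid (m ⊙ n).
    by rewrite -rho_U -star_pU -star_lam.
  have -> : dswap (star_tens star) n m = slideI (fpr G m) n by exact: star_swap.
  by rewrite /dpr /dob /= -!pU_tunit !star_pU.
Qed.

Lemma asrc_star f : asrc (far G f) = fob G (asrc f). Proof. exact: (far_src G f). Qed.
Lemma atgt_star f : atgt (far G f) = fob G (atgt f). Proof. exact: (far_tgt G f). Qed.
Lemma lft_star φ : lft (fsq G φ) = fpr G (lft φ). Proof. exact: (fsq_lft G φ). Qed.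
Lemma rgt_star φ : rgt (fsq G φ) = fpr G (rgt φ). Proof. exact: (fsq_rgt G φ). Qed.
Lemma top_star φ : top (fsq G φ) = far G (bot φ). Proof. exact: (fsq_top G φ). Qed.
Lemma bot_star φ : bot (fsq G φ) = far G (top φ). Proof. exact: (fsq_bot G φ). Qed.
Lemma eta_lft f : lft (dn_ar eta f) = dn_ob eta (asrc f). Proof. exact: dn_ar_lft. Qed.
Lemma eta_rgt f : rgt (dn_ar eta f) = dn_ob eta (atgt f). Proof. exact: dn_ar_rgt. Qed.
Lemma eta_top f : top (dn_ar eta f) = aid (tunit C).
Proof. by rewrite aid_tunit; apply: (dn_ar_top eta f). Qed.
Lemma eta_bot f : bot (dn_ar eta f) = far G f ⊗ₐ f. Proof. exact: (dn_ar_bot eta f). Qed.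

Definition starE := (asrc_star, atgt_star, lft_star, rgt_star, top_star, bot_star,
  eta_lft, eta_rgt, eta_top, eta_bot,
  (@lft_tens C, @rgt_tens C, @top_tens C, @bot_tens C, lft_U L, rgt_U L, top_U L, bot_U L),
  (asrc_top L, atgt_top L, asrc_bot L, atgt_bot L, asrc_id L, atgt_id L)).

Lemma cap_pr_sq φ :
  (dn_ar eta (bot φ) ⊙ₛ (fsq G φ ⊗ₛ sU (bot φ))) ·ₛ cap_pr eta (rgt φ)
  = cap_pr eta (lft φ) ·ₛ (dn_ar eta (top φ) ⊙ₛ (sU (far G (top φ)) ⊗ₛ φ)).
Proof.
set hg := dn_ar eta (bot φ); set hf := dn_ar eta (top φ).
set y0 := fsq G φ ⊗ₛ sU (bot φ); set y1 := sU (far G (top φ)) ⊗ₛ φ.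
suff [] : natsq (hg ⊙ₛ y0) (cap_pr eta (lft φ)) (cap_pr eta (rgt φ)) (hf ⊙ₛ y1) by [].
have k0 : bot hg = top y0 by rewrite !starE.
have k1 : bot hf = top y1 by rewrite !starE.
have kg : bot (sU (aid (tunit C))) = top hg by rewrite !starE.
have kf : bot (sU (aid (tunit C))) = top hf by rewrite !starE.
have kg0 : bot (sU (aid (tunit C)) ⊙ₛ hg) = top y0 by rewrite (bot_vcomp L).
have kf1 : bot (sU (aid (tunit C)) ⊙ₛ hf) = top y1 by rewrite (bot_vcomp L).
(* The dinaturality square; naturality of the unitors then removes the unit square on I at both
   ends. *)
have N : natsq (sU (aid (tunit C)) ⊙ₛ hg ⊙ₛ y0) (dn_pr eta (lft φ)) (dn_pr eta (rgt φ))
               (sU (aid (tunit C)) ⊙ₛ hf ⊙ₛ y1).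
  have [a1 a2 _ _] := dn_cap_disk (lft φ); have [b1 b2 _ _] := dn_cap_disk (rgt φ).
  split; last first.
    have := dn_sq eta φ.
    have s1 : fsq (munit C) tt = sU (aid (tunit C)) by rewrite (sU_id L) sid_tunit.
    by rewrite /dsq /= s1 (fsq_U G).
  1-4: rewrite ?(lft_vcomp L kg0) ?(rgt_vcomp L kg0) ?(lft_vcomp L kf1) ?(rgt_vcomp L kf1).
  1-4: rewrite ?(lft_vcomp L kg) ?(rgt_vcomp L kg) ?(lft_vcomp L kf) ?(rgt_vcomp L kf).
  1-4: by rewrite ?a1 ?a2 ?b1 ?b2 !starE.
have S0 := natsq_sid y0; have S1 := natsq_sid y1.
have L0 := natsq_lamI hg; have L1 := natsq_lam hf.
rewrite /hg !starE -/hg in L0; rewrite /hf !starE -/hf in L1.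
rewrite /y0 !starE -/y0 in S0; rewrite /y1 !starE -/y1 in S1.
have b0 m : bot (lamI (dn_ob eta (ptgt m))) = top (sid (fpr G m ⊗ pU (ptgt m))).
  by apply: (disk_bot_top _ (lamI_disk _) (disk_id _)); rewrite !etaE.
have b1 m : bot (lam (dn_ob eta (psrc m))) = top (sid (pU (fob G (psrc m)) ⊗ m)).
  by apply: (disk_bot_top _ (lam_disk L _) (disk_id _)); rewrite (ptgt_comp L) !etaE.
rewrite /cap_pr; apply: natsq_hcomp (natsq_hcomp _ N) _.
- exact: natsq_vcomp L0 S0 k0 (b0 _) (b0 _) kg0.
- exact: natsq_vcomp L1 S1 kf1 (b1 _) (b1 _) k1.
Qed.
End Cap.

Section Cup.
Variable eps : cup star.
Implicit Types (A B : Ob C) (m n : Pr C) (f : Ar C) (φ : Sq C).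

Lemma dn_cup_disk m :
  disk (m ⊗ pU (fob G (ptgt m)) ⊙ dn_ob eps (ptgt m) ⊙ U)
       (pU (psrc m) ⊗ fpr G m ⊙ dn_ob eps (psrc m) ⊙ U) (dn_pr eps m).
Proof. by rewrite pU_tunit -star_pU; apply: (dn_pr_disk eps m). Qed.

Lemma eps_src A : psrc (dn_ob eps A) = A ⊗ₒ fob G A.
Proof. exact: (dn_ob_src eps A). Qed.

Lemma eps_tgt A : ptgt (dn_ob eps A) = tunit C.
Proof. exact: (dn_ob_tgt eps A). Qed.

Definition epsE :=
  (psrc_tens, ptgt_tens, @psrcU C, @ptgtU C, eps_src, eps_tgt, psrc_star, ptgt_star).

Lemma rho_eps_disk (p : Pr C) A : ptgt p = A ⊗ₒ fob G A ->
  disk (p ⊙ dn_ob eps A ⊙ U) (p ⊙ dn_ob eps A) (rho (p ⊙ dn_ob eps A)).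
Proof.
move=> h; have := rho_disk L (p ⊙ dn_ob eps A).
by rewrite (ptgt_comp L) ?eps_src // eps_tgt.
Qed.

Lemma rhoI_eps_disk (p : Pr C) A : ptgt p = A ⊗ₒ fob G A ->
  disk (p ⊙ dn_ob eps A) (p ⊙ dn_ob eps A ⊙ U) (rhoI (p ⊙ dn_ob eps A)).
Proof. by move=> h; apply: disk_inverse (rho_eps_disk h) (rho_inverse L _). Qed.

Lemma cup_pr_spec m :
  disk (m ⊗ pU (fob G (ptgt m)) ⊙ dn_ob eps (ptgt m))
       (pU (psrc m) ⊗ fpr G m ⊙ dn_ob eps (psrc m)) (cup_pr eps m) /\
  invertible (cup_pr eps m).
Proof.
have D := dn_cup_disk m.
have q1 : ptgt (m ⊗ pU (fob G (ptgt m))) = ptgt m ⊗ₒ fob G (ptgt m) by rewrite !epsE.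
have q2 : ptgt (pU (psrc m) ⊗ fpr G m) = psrc m ⊗ₒ fob G (psrc m) by rewrite !epsE.
have E1 := rhoI_eps_disk q1; have E2 := rho_eps_disk q2.
split; first exact: disk_hcomp (disk_hcomp E1 D) E2.
apply: invertible_hcomp; first exact: disk_cmp (disk_hcomp E1 D) E2.
  apply: invertible_hcomp; [exact: disk_cmp E1 D| |exact: (dn_pr_inv eps m)].
  by eexists; apply/inverse_sym/(rho_inverse L).
by eexists; apply: (rho_inverse L).
Qed.

Lemma cup_pr_pU A : cup_pr eps (pU A) = sid (pU (A ⊗ₒ fob G A) ⊙ dn_ob eps A).
Proof.
have h1 := eps_src A; have h2 := eps_tgt A.
rewrite /cup_pr !ptgtU !psrcU dn_pr_U /star_pr /star_ob star_pU -pU_tens /dob /= -/(tunit C).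
coh.
Qed.

Lemma cup_pr_procomp m n : ptgt m = psrc n ->
  let A := psrc m in let B := ptgt m in let X := ptgt n in
  cup_pr eps (m ⊙ n)
  = ((sid (m ⊙ n) ⊗ₛ lamI (pU (fob G X))) ⊙ₛ sid (dn_ob eps X))
    ·ₛ tripR (m ⊗ pU (fob G X)) (n ⊗ pU (fob G X)) (dn_ob eps X)
             (pU B ⊗ fpr G n) (dn_ob eps B) (pU A ⊗ fpr G n)
             (m ⊗ pU (fob G B)) (pU A ⊗ fpr G m) (dn_ob eps A)
             (cup_pr eps n) (slide m (fpr G n)) (cup_pr eps m)
    ·ₛ ((lam (pU A) ⊗ₛ sid (fpr G n ⊙ fpr G m)) ⊙ₛ sid (dn_ob eps A)).
Proof.
move=> mn A B X.
have [h1 h2] : psrc (m ⊙ n) = A /\ ptgt (m ⊙ n) = X.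
  by split; [exact: (psrc_comp L)|exact: (ptgt_comp L)].
have Dn := dn_cup_disk n; have Dm := dn_cup_disk m; rewrite -mn in Dn.
have q1 : ptgt (fpr G n) = psrc (fpr G m) by rewrite !epsE mn.
rewrite /cup_pr h1 h2 -mn -/A -/B -/X /star_pr /star_ob star_procomp //.
apply: (cup_paste (I := tunit C) (A := A ⊗ₒ fob G A) (B := B ⊗ₒ fob G B) (X := X ⊗ₒ fob G X)
  (M := B ⊗ₒ fob G X) (N := A ⊗ₒ fob G X) (P := A ⊗ₒ fob G B)
  (dm := dn_pr eps m) (dn := dn_pr eps n) (w := slide m (fpr G n))
  _ _ _ _ _ _ _ _ _ _ _ Dn Dm).
all: rewrite /A /B /X.
all: try by split; rewrite ?epsE ?(psrc_comp L) ?(ptgt_comp L) ?epsE ?mn.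
- rewrite -procomp_tens ?epsE ?mn //.
  by apply: disk_tens; [exact: disk_id|exact: lamIU_disk].
- by have := slide_disk m (fpr G n); rewrite !epsE mn.
- rewrite -procomp_tens ?epsE ?mn //.
  by apply: disk_tens; [exact: lamU_disk|exact: disk_id].
- rewrite (dn_pr_comp eps mn).
  have -> : dsplit_l (constI C) m n (ptgt n) = lamI U by exact: munit_sqI.
  have -> : dmerge_r (constI C) (psrc m) m n = lam U by exact: munit_sq.
  have -> : dswap (constI C) n m = lam U ·ₛ lamI U by rewrite -munit_sqI -munit_sq.
  have -> : dsplit_r (tens_star star) (ptgt n) m n = sid (m ⊙ n) ⊗ₛ lamI (pU (fob G (ptgt n))).
    by rewrite -rhoI_U -star_pU -star_lamI.
  have -> : dmerge_l (tens_star star) m n (psrc m) = lam (pU (psrc m)) ⊗ₛ sid (fpr G n ⊙ fpr G m).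
    by rewrite -star_procomp // -star_sid.
  have -> : dswap (tens_star star) m n = slide m (fpr G n) by exact: swap_star.
  by rewrite /dpr /dob /= -!pU_tunit !star_pU.
Qed.

Lemma eps_lft f : lft (dn_ar eps f) = dn_ob eps (asrc f). Proof. exact: dn_ar_lft. Qed.
Lemma eps_rgt f : rgt (dn_ar eps f) = dn_ob eps (atgt f). Proof. exact: dn_ar_rgt. Qed.
Lemma eps_top f : top (dn_ar eps f) = f ⊗ₐ far G f. Proof. exact: (dn_ar_top eps f). Qed.
Lemma eps_bot f : bot (dn_ar eps f) = aid (tunit C).
Proof. by rewrite aid_tunit; apply: (dn_ar_bot eps f). Qed.

Definition epsarE := (asrc_star, atgt_star, lft_star, rgt_star, top_star, bot_star,
  eps_lft, eps_rgt, eps_top, eps_bot,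
  (@lft_tens C, @rgt_tens C, @top_tens C, @bot_tens C, lft_U L, rgt_U L, top_U L, bot_U L),
  (asrc_top L, atgt_top L, asrc_bot L, atgt_bot L, asrc_id L, atgt_id L)).

Lemma cup_pr_sq φ :
  ((φ ⊗ₛ sU (far G (bot φ))) ⊙ₛ dn_ar eps (bot φ)) ·ₛ cup_pr eps (rgt φ)
  = cup_pr eps (lft φ) ·ₛ ((sU (top φ) ⊗ₛ fsq G φ) ⊙ₛ dn_ar eps (top φ)).
Proof.
set hg := dn_ar eps (bot φ); set hf := dn_ar eps (top φ).
set y0 := φ ⊗ₛ sU (far G (bot φ)); set y1 := sU (top φ) ⊗ₛ fsq G φ.
suff [] : natsq (y0 ⊙ₛ hg) (cup_pr eps (lft φ)) (cup_pr eps (rgt φ)) (y1 ⊙ₛ hf) by [].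
have k0 : bot y0 = top hg by rewrite !epsarE.
have k1 : bot y1 = top hf by rewrite !epsarE.
have kg : bot (y0 ⊙ₛ hg) = aid (tunit C) by rewrite (bot_vcomp L) // !epsarE.
have kf : bot (y1 ⊙ₛ hf) = aid (tunit C) by rewrite (bot_vcomp L) // !epsarE.
have kg0 : bot (y0 ⊙ₛ hg) = top (sU (aid (tunit C))) by rewrite kg (top_U L).
have kf1 : bot (y1 ⊙ₛ hf) = top (sU (aid (tunit C))) by rewrite kf (top_U L).
have N : natsq (y0 ⊙ₛ hg ⊙ₛ sU (aid (tunit C))) (dn_pr eps (lft φ)) (dn_pr eps (rgt φ))
               (y1 ⊙ₛ hf ⊙ₛ sU (aid (tunit C))).
  have [a1 a2 _ _] := dn_cup_disk (lft φ); have [b1 b2 _ _] := dn_cup_disk (rgt φ).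
  split; last first.
    have := dn_sq eps φ.
    have s1 : fsq (munit C) tt = sU (aid (tunit C)) by rewrite (sU_id L) sid_tunit.
    by rewrite /dsq /= s1 !(fsq_U G).
  1-4: rewrite ?(lft_vcomp L kg0) ?(rgt_vcomp L kg0) ?(lft_vcomp L kf1) ?(rgt_vcomp L kf1).
  1-4: rewrite ?(lft_vcomp L k0) ?(rgt_vcomp L k0) ?(lft_vcomp L k1) ?(rgt_vcomp L k1).
  1-4: by rewrite ?a1 ?a2 ?b1 ?b2 !epsarE.
have L0 := natsq_rhoI (y0 ⊙ₛ hg); have L1 := natsq_rho (y1 ⊙ₛ hf).
rewrite kg (lft_vcomp L k0) (rgt_vcomp L k0) /y0 /hg !epsarE -/hg -/y0 in L0.
rewrite kf (lft_vcomp L k1) (rgt_vcomp L k1) /y1 /hf !epsarE -/hf -/y1 in L1.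
by rewrite /cup_pr; apply: natsq_hcomp (natsq_hcomp L0 N) L1.
Qed.
End Cup.

Definition capData_of_cap (eta : cap star) : capData (idF C) G.
Proof.
refine (@CapData C C (idF C) G (dn_ob eta) (dn_ar eta) (cap_pr eta) (eta_src eta) (eta_tgt eta)
  (eta_lft eta) (eta_rgt eta) (eta_top eta) (eta_bot eta) _ _ (dn_ar_id eta)
  (@dn_ar_comp _ _ _ _ eta) (cap_pr_pU eta) (cap_pr_procomp eta) (cap_pr_sq eta)).
- by move=> m; case: (cap_pr_spec eta m).
- by move=> m; case: (cap_pr_spec eta m).
Defined.

Definition cupData_of_cup (eps : cup star) : cupData (idF C) G.
Proof.
refine (@CupData C C (idF C) G (dn_ob eps) (dn_ar eps) (cup_pr eps) (eps_src eps) (eps_tgt eps)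
  (eps_lft eps) (eps_rgt eps) (eps_top eps) (eps_bot eps) _ _ (dn_ar_id eps)
  (@dn_ar_comp _ _ _ _ eps) (cup_pr_pU eps) (cup_pr_procomp eps) (cup_pr_sq eps)).
- by move=> m; case: (cup_pr_spec eps m).
- by move=> m; case: (cup_pr_spec eps m).
Defined.
End FromDinatural.

(** * Inverses of threefold composites *)

Lemma inverse_eq (C : dcData) (φ ψ ψ' : Sq C) : inverse φ ψ -> ψ = ψ' -> inverse φ ψ'.
Proof. by move=> I <-. Qed.

Ltac inv_build := lazymatch goal with
  | |- inverse (_ ·ₛ _) _ => eapply inverse_hcomp; [cmp|inv_build|inv_build]
  | |- inverse (_ ⊙ₛ _) _ => eapply inverse_vcomp; [|dk|dk|inv_build|inv_build]; ob
  | |- inverse (sid _) _ => exact: inverse_id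
  | |- inverse (assoc _ _ _) _ => apply: (assoc_inverse (dc_laws _)); ob
  | |- inverse (assocI _ _ _) _ =>
      apply: inverse_sym; apply: (assoc_inverse (dc_laws _)); ob
  | |- _ => eassumption
  end.
(** The inverse is first synthesised factor by factor as an existential variable and then compared
    with the stated one by reassociation. *)
Ltac inv := eapply inverse_eq; [inv_build|hA; reflexivity].

Section InverseTrips.
Variable C : doubleCat.
Let L := dc_laws C.

(** The pattern left, right, left is a palindrome, hence preserved by inversion; this makes the
    composition axiom of a cap stable under inverting its disks. *)
Lemma inverse_tripL (p q r p1 q1 q2 r1 p2 q3 Y Z : Pr C) (α β γ α' β' γ' σ τ σ' τ' : Sq C) :
  ptgt p = psrc q -> ptgt q = psrc r -> ptgt p1 = psrc q1 -> ptgt q1 = psrc r ->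
  ptgt p1 = psrc q2 -> ptgt q2 = psrc r1 -> ptgt p2 = psrc q3 -> ptgt q3 = psrc r1 ->
  ptgt p = psrc Y -> ptgt p2 = psrc Z ->
  disk (p ⊙ q) (p1 ⊙ q1) α -> disk (q1 ⊙ r) (q2 ⊙ r1) β -> disk (p1 ⊙ q2) (p2 ⊙ q3) γ ->
  disk Y (q ⊙ r) σ -> disk (q3 ⊙ r1) Z τ ->
  inverse α α' -> inverse β β' -> inverse γ γ' -> inverse σ σ' -> inverse τ τ' ->
  inverse ((sid p ⊙ₛ σ) ·ₛ tripL p q r p1 q1 q2 r1 p2 q3 α β γ ·ₛ (sid p2 ⊙ₛ τ))
          ((sid p2 ⊙ₛ τ') ·ₛ tripL p2 q3 r1 p1 q2 q1 r p q γ' β' α' ·ₛ (sid p ⊙ₛ σ')).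
Proof.
move=> h1 h2 h3 h4 h5 h6 h7 h8 h9 h10 D1 D2 D3 D4 D5 I1 I2 I3 I4 I5; rewrite /tripL.
have D1' := disk_inverse D1 I1; have D2' := disk_inverse D2 I2; have D3' := disk_inverse D3 I3.
have D4' := disk_inverse D4 I4; have D5' := disk_inverse D5 I5.
inv.
Qed.

Lemma inverse_tripR (p q r q1 r1 q2 p1 q3 r2 Y Z : Pr C) (α β γ α' β' γ' σ τ σ' τ' : Sq C) :
  ptgt p = psrc q -> ptgt q = psrc r -> ptgt p = psrc q1 -> ptgt q1 = psrc r1 ->
  ptgt q2 = psrc p1 -> ptgt p1 = psrc r1 -> ptgt q2 = psrc q3 -> ptgt q3 = psrc r2 ->
  ptgt Y = psrc r -> ptgt Z = psrc r2 ->
  disk (q ⊙ r) (q1 ⊙ r1) α -> disk (p ⊙ q1) (q2 ⊙ p1) β -> disk (p1 ⊙ r1) (q3 ⊙ r2) γ ->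
  disk Y (p ⊙ q) σ -> disk (q2 ⊙ q3) Z τ ->
  inverse α α' -> inverse β β' -> inverse γ γ' -> inverse σ σ' -> inverse τ τ' ->
  inverse ((σ ⊙ₛ sid r) ·ₛ tripR p q r q1 r1 q2 p1 q3 r2 α β γ ·ₛ (τ ⊙ₛ sid r2))
          ((τ' ⊙ₛ sid r2) ·ₛ tripR q2 q3 r2 p1 r1 p q1 q r γ' β' α' ·ₛ (σ' ⊙ₛ sid r)).
Proof.
move=> h1 h2 h3 h4 h5 h6 h7 h8 h9 h10 D1 D2 D3 D4 D5 I1 I2 I3 I4 I5; rewrite /tripR.
have D1' := disk_inverse D1 I1; have D2' := disk_inverse D2 I2; have D3' := disk_inverse D3 I3.
have D4' := disk_inverse D4 I4; have D5' := disk_inverse D5 I5.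
inv.
Qed.
End InverseTrips.

(** A double reflection has the cells of E definitionally, but as a record it is not convertible to
    E, so a functor is needed to read F as defined on it. *)
Definition unreflect (E : doubleCat) : functor (reflectDC (reflectDC E)) E.
Proof.
by refine {| fob (A : Ob (reflectDC (reflectDC E))) := A : Ob E;
             far (f : Ar (reflectDC (reflectDC E))) := f : Ar E;
             fpr (m : Pr (reflectDC (reflectDC E))) := m : Pr E;
             fsq (φ : Sq (reflectDC (reflectDC E))) := φ : Sq E |}.
Defined.

(** * The second zigzag by symmetry *)

Section Flip.
Variables (V : monoidalDC) (E : doubleCat) (F : functor E V) (G : functor (reflectDC E) V).
Let L := dc_laws V.
Variable (eta : capData F G) (eps : cupData F G).
Variables (etaI epsI : Pr E -> Sq V).
Hypothesis etaIP : forall m, inverse (cap_dk eta m) (etaI m).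
Hypothesis epsIP : forall m, inverse (cup_dk eps m) (epsI m).
Implicit Types (m n : Pr E) (f g : Ar E) (φ : Sq E).

Lemma etaI_pU A : etaI (pU A) = sid (cap_ob eta A ⊙ pU (fob G A ⊗ₒ fob F A)).
Proof. by have := etaIP (pU A); rewrite cap_pU => I; apply: inverse_uniq I (inverse_id _). Qed.

Lemma epsI_pU A : epsI (pU A) = sid (pU (fob F A ⊗ₒ fob G A) ⊙ cup_ob eps A).
Proof. by have := epsIP (pU A); rewrite cup_pU => I; apply: inverse_uniq I (inverse_id _). Qed.

Lemma etaI_procomp m n : ptgt m = psrc n ->
  etaI (m ⊙ n) =
  (sid (cap_ob eta (psrc m)) ⊙ₛ (lamI (pU (fob G (psrc m))) ⊗ₛ sid (fpr F m ⊙ fpr F n)))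
  ·ₛ tripL (cap_ob eta (psrc m)) (pU (fob G (psrc m)) ⊗ fpr F m) (pU (fob G (psrc m)) ⊗ fpr F n)
       (cap_ob eta (ptgt m)) (fpr G m ⊗ pU (fob F (ptgt m))) (pU (fob G (ptgt m)) ⊗ fpr F n)
       (fpr G m ⊗ pU (fob F (ptgt n))) (cap_ob eta (ptgt n)) (fpr G n ⊗ pU (fob F (ptgt n)))
       (etaI m) (slide (fpr G m) (fpr F n)) (etaI n)
  ·ₛ (sid (cap_ob eta (ptgt n)) ⊙ₛ (sid (fpr G n ⊙ fpr G m) ⊗ₛ lam (pU (fob F (ptgt n))))).
Proof.
move=> mn; apply: (inverse_uniq (etaIP _)); rewrite cap_procomp //.
have q1 : ptgt (fpr F m) = psrc (fpr F n) by rewrite !(bdyE F G) mn.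
have q2 : ptgt (fpr G n) = psrc (fpr G m) by rewrite !(bdyE F G) mn.
have Dm := cap_disk eta m; have Dn := cap_disk eta n; rewrite -mn in Dn.
have Ds := slideI_disk (fpr G m) (fpr F n); rewrite !(bdyE F G) -mn in Ds.
have Is := inverse_sym (slide_inverse (fpr G m) (fpr F n)).
apply: (inverse_tripL (Y := (fpr G n ⊙ fpr G m) ⊗ pU (fob F (ptgt n)))
  (Z := pU (fob G (psrc m)) ⊗ (fpr F m ⊙ fpr F n)) _ _ _ _ _ _ _ _ _ _ Dn Ds Dm).
all: try by rewrite ?(bdyE F G) ?(psrc_comp L) ?(bdyE F G) ?mn.
- rewrite -procomp_tens ?(bdyE F G) ?mn //.
  by apply: disk_tens; [exact: disk_id|exact: lamIU_disk].
- rewrite -procomp_tens ?(bdyE F G) ?mn //.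
  by apply: disk_tens; [exact: lamU_disk|exact: disk_id].
- by apply: inverse_tens; [exact: inverse_id|exact: inverse_sym (lam_inverse L _)].
- by apply: inverse_tens; [exact: (lam_inverse L _)|exact: inverse_id].
Qed.

Lemma etaI_sq φ :
  (cap_ar eta (top φ) ⊙ₛ (sU (far G (top φ)) ⊗ₛ fsq F φ)) ·ₛ etaI (rgt φ)
  = etaI (lft φ) ·ₛ (cap_ar eta (bot φ) ⊙ₛ (fsq G φ ⊗ₛ sU (far F (bot φ)))).
Proof.
have [a1 a2 _ _] := cap_disk eta (lft φ); have [b1 b2 _ _] := cap_disk eta (rgt φ).
have k0 : bot (cap_ar eta (top φ)) = top (sU (far G (top φ)) ⊗ₛ fsq F φ).
  by rewrite !(sqE F G).
have k1 : bot (cap_ar eta (bot φ)) = top (fsq G φ ⊗ₛ sU (far F (bot φ))).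
  by rewrite !(sqE F G).
apply: inverse_swap (etaIP _) (etaIP _) (cap_sq eta φ).
- by rewrite b1 (rgt_vcomp L k1) !(sqE F G).
- by rewrite a2 (lft_vcomp L k0) !(sqE F G).
Qed.

(** In the reversed tensor, I -> GA ⊗ FA reads as I -> FA ⊗ GA, a cap for the pair with G in first
    place. Its disks must then run from the side of F to that of G, which is the direction of
    [etaI]. *)
Definition flip_cap :
  @capData (revM V) (reflectDC E) G (compF (unreflect E) F).
Proof.
refine (@CapData (revM V) (reflectDC E) G (compF (unreflect E) F) (cap_ob eta) (cap_ar eta) etaI
  (cap_src eta) (cap_tgt eta) (cap_lft eta) (cap_rgt eta) (cap_top eta) (cap_bot eta)
  _ _ (cap_id eta) (@cap_acomp _ _ _ _ eta) etaI_pU _ etaI_sq).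
- by move=> m; apply: disk_inverse (cap_disk eta m) (etaIP m).
- by move=> m; exists (cap_dk eta m); apply: inverse_sym.
(* The composite of m and n in the reflection is n ⊙ m in E. *)
- move=> m n h A B X; rewrite /B h; exact: (@etaI_procomp n m (esym h)).
Defined.

Lemma epsI_procomp m n : ptgt m = psrc n ->
  epsI (m ⊙ n) =
  ((lamI (pU (fob F (psrc m))) ⊗ₛ sid (fpr G n ⊙ fpr G m)) ⊙ₛ sid (cup_ob eps (psrc m)))
  ·ₛ tripR (pU (fob F (psrc m)) ⊗ fpr G n) (pU (fob F (psrc m)) ⊗ fpr G m)
       (cup_ob eps (psrc m)) (fpr F m ⊗ pU (fob G (ptgt m))) (cup_ob eps (ptgt m))
       (fpr F m ⊗ pU (fob G (ptgt n))) (pU (fob F (ptgt m)) ⊗ fpr G n)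
       (fpr F n ⊗ pU (fob G (ptgt n))) (cup_ob eps (ptgt n))
       (epsI m) (slideI (fpr F m) (fpr G n)) (epsI n)
  ·ₛ ((sid (fpr F m ⊙ fpr F n) ⊗ₛ lam (pU (fob G (ptgt n)))) ⊙ₛ sid (cup_ob eps (ptgt n))).
Proof.
move=> mn; apply: (inverse_uniq (epsIP _)); rewrite cup_procomp //.
have q1 : ptgt (fpr F m) = psrc (fpr F n) by rewrite !(bdyE F G) mn.
have q2 : ptgt (fpr G n) = psrc (fpr G m) by rewrite !(bdyE F G) mn.
have Dm := cup_disk eps m; have Dn := cup_disk eps n; rewrite -mn in Dn.
have Ds := slide_disk (fpr F m) (fpr G n); rewrite !(bdyE F G) -mn in Ds.
have Is := slide_inverse (fpr F m) (fpr G n).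
apply: (inverse_tripR (Y := (fpr F m ⊙ fpr F n) ⊗ pU (fob G (ptgt n)))
  (Z := pU (fob F (psrc m)) ⊗ (fpr G n ⊙ fpr G m)) _ _ _ _ _ _ _ _ _ _ Dn Ds Dm).
all: try by rewrite ?(bdyE F G) ?(ptgt_comp L) ?(bdyE F G) ?mn.
- rewrite -procomp_tens ?(bdyE F G) ?mn //.
  by apply: disk_tens; [exact: disk_id|exact: lamIU_disk].
- rewrite -procomp_tens ?(bdyE F G) ?mn //.
  by apply: disk_tens; [exact: lamU_disk|exact: disk_id].
- by apply: inverse_tens; [exact: inverse_id|exact: inverse_sym (lam_inverse L _)].
- by apply: inverse_tens; [exact: (lam_inverse L _)|exact: inverse_id].
Qed.

Lemma epsI_sq φ :
  ((sU (far F (top φ)) ⊗ₛ fsq G φ) ⊙ₛ cup_ar eps (top φ)) ·ₛ epsI (rgt φ)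
  = epsI (lft φ) ·ₛ ((fsq F φ ⊗ₛ sU (far G (bot φ))) ⊙ₛ cup_ar eps (bot φ)).
Proof.
have [a1 a2 _ _] := cup_disk eps (lft φ); have [b1 b2 _ _] := cup_disk eps (rgt φ).
have k0 : bot (sU (far F (top φ)) ⊗ₛ fsq G φ) = top (cup_ar eps (top φ)).
  by rewrite !(sqE F G).
have k1 : bot (fsq F φ ⊗ₛ sU (far G (bot φ))) = top (cup_ar eps (bot φ)).
  by rewrite !(sqE F G).
apply: inverse_swap (epsIP _) (epsIP _) (cup_sq eps φ).
- by rewrite b1 (rgt_vcomp L k1) !(sqE F G).
- by rewrite a2 (lft_vcomp L k0) !(sqE F G).
Qed.

Definition flip_cup :
  @cupData (revM V) (reflectDC E) G (compF (unreflect E) F).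
Proof.
refine (@CupData (revM V) (reflectDC E) G (compF (unreflect E) F) (cup_ob eps) (cup_ar eps) epsI
  (cup_src eps) (cup_tgt eps) (cup_lft eps) (cup_rgt eps) (cup_top eps) (cup_bot eps)
  _ _ (cup_id eps) (@cup_acomp _ _ _ _ eps) epsI_pU _ epsI_sq).
- by move=> m; apply: disk_inverse (cup_disk eps m) (epsIP m).
- by move=> m; exists (cup_dk eps m); apply: inverse_sym.
- move=> m n h A B X; rewrite /B h; exact: (@epsI_procomp n m (esym h)).
Defined.

(** The lax disk of Z for general F and G; with F the identity and the data of η and ε it computes
    to [zigzagZ_pr]. *)
Definition cozigzag_pr m : Sq V :=
  let A := fob F (psrc m) in let B := fob F (ptgt m) in
  let A' := fob G (psrc m) in let B' := fob G (ptgt m) in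
  let etaA := cap_ob eta (psrc m) in let etaB := cap_ob eta (ptgt m) in
  let epsA := cup_ob eps (psrc m) in let epsB := cup_ob eps (ptgt m) in
  assoc (etaB ⊗ pU B') (pU B' ⊗ epsB) (fpr G m)
  ·ₛ (sid (etaB ⊗ pU B') ⊙ₛ slideI (fpr G m) epsB)
  ·ₛ assocI (etaB ⊗ pU B') (fpr G m ⊗ pU B ⊗ pU B') (pU A' ⊗ epsB)
  ·ₛ (whisker_r (cap_dk eta m) B' ⊙ₛ sid (pU A' ⊗ epsB))
  ·ₛ assoc (etaA ⊗ pU B') (pU A' ⊗ fpr F m ⊗ pU B') (pU A' ⊗ epsB)
  ·ₛ (sid (etaA ⊗ pU B') ⊙ₛ whisker_l A' (cup_dk eps m))
  ·ₛ assocI (etaA ⊗ pU B') (pU A' ⊗ pU A ⊗ fpr G m) (pU A' ⊗ epsA)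
  ·ₛ (slide etaA (fpr G m) ⊙ₛ sid (pU A' ⊗ epsA))
  ·ₛ assoc (fpr G m) (etaA ⊗ pU A') (pU A' ⊗ epsA).

(** Read backwards, the factors of the flipped zigzag are the inverses of those of [cozigzag_pr], up
    to associativity of the tensor. *)
Lemma cozigzag_inverse m : inverse (cozigzag_pr m) (zig_pr flip_cap flip_cup m).
Proof.
have Tm : typed (fpr G m) (fob G (ptgt m)) (fob G (psrc m)) by split; rewrite !(bdyE F G).
pose A := fob F (psrc m); pose B := fob F (ptgt m).
pose A' := fob G (psrc m); pose B' := fob G (ptgt m).
pose etaA := cap_ob eta (psrc m); pose etaB := cap_ob eta (ptgt m).
pose epsA := cup_ob eps (psrc m); pose epsB := cup_ob eps (ptgt m).
have [t1 t2] : typed (fpr G m) B' A' := Tm.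
(* By conversion: reversing the tensor exchanges [slide] with [slideI] and [whisker_l] with
   [whisker_r], while the associators of V are unchanged. *)
have -> : zig_pr flip_cap flip_cup m =
    assocI (fpr G m) (etaA ⊗ pU A') (pU A' ⊗ epsA)
    ·ₛ (slideI etaA (fpr G m) ⊙ₛ sid (pU A' ⊗ epsA))
    ·ₛ assoc (etaA ⊗ pU B') (pU A' ⊗ (pU A ⊗ fpr G m)) (pU A' ⊗ epsA)
    ·ₛ (sid (etaA ⊗ pU B') ⊙ₛ whisker_l A' (epsI m))
    ·ₛ assocI (etaA ⊗ pU B') (pU A' ⊗ (fpr F m ⊗ pU B')) (pU A' ⊗ epsB)
    ·ₛ (whisker_r (etaI m) B' ⊙ₛ sid (pU A' ⊗ epsB))
    ·ₛ assoc (etaB ⊗ pU B') (fpr G m ⊗ (pU B ⊗ pU B')) (pU A' ⊗ epsB)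
    ·ₛ (sid (etaB ⊗ pU B') ⊙ₛ slide (fpr G m) epsB)
    ·ₛ assocI (etaB ⊗ pU B') (pU B' ⊗ epsB) (fpr G m) by [].
rewrite /cozigzag_pr -/A -/B -/A' -/B' -/etaA -/etaB -/epsA -/epsB -!tens_prA.
have [h1 h2] : typed (etaB ⊗ pU B') B' (B' ⊗ₒ B ⊗ₒ B') by split; rewrite !(bdyE F G).
have [h3 h4] : typed (etaA ⊗ pU B') B' (A' ⊗ₒ A ⊗ₒ B') by split; rewrite !(bdyE F G).
have [h5 h6] : typed (etaA ⊗ pU A') A' (A' ⊗ₒ A ⊗ₒ A') by split; rewrite !(bdyE F G).
have [h7 h8] : typed (pU B' ⊗ epsB) (B' ⊗ₒ B ⊗ₒ B') B' by split; rewrite !(bdyE F G) // tens_obA.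
have [h9 h10] : typed (pU A' ⊗ epsB) (A' ⊗ₒ B ⊗ₒ B') A' by split; rewrite !(bdyE F G) // tens_obA.
have [h11 h12] : typed (pU A' ⊗ epsA) (A' ⊗ₒ A ⊗ₒ A') A' by split; rewrite !(bdyE F G) // tens_obA.
have [h13 h14] : typed (fpr G m ⊗ pU B ⊗ pU B') (B' ⊗ₒ B ⊗ₒ B') (A' ⊗ₒ B ⊗ₒ B').
  by split; rewrite !(bdyE F G).
have [h15 h16] : typed (pU A' ⊗ fpr F m ⊗ pU B') (A' ⊗ₒ A ⊗ₒ B') (A' ⊗ₒ B ⊗ₒ B').
  by split; rewrite !(bdyE F G).
have [h17 h18] : typed (pU A' ⊗ pU A ⊗ fpr G m) (A' ⊗ₒ A ⊗ₒ B') (A' ⊗ₒ A ⊗ₒ A').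
  by split; rewrite !(bdyE F G).
have D1 : disk (pU B' ⊗ epsB ⊙ fpr G m) (fpr G m ⊗ pU B ⊗ pU B' ⊙ pU A' ⊗ epsB)
    (slideI (fpr G m) epsB).
  by have := slideI_disk (fpr G m) epsB; rewrite !(bdyE F G) tens_I pU_tens -tens_prA.
have D2 : disk (etaB ⊗ pU B' ⊙ fpr G m ⊗ pU B ⊗ pU B')
    (etaA ⊗ pU B' ⊙ pU A' ⊗ fpr F m ⊗ pU B') (whisker_r (cap_dk eta m) B').
  by apply: whisker_r_disk (cap_disk eta m); rewrite !(bdyE F G).
have D3 : disk (pU A' ⊗ fpr F m ⊗ pU B' ⊙ pU A' ⊗ epsB)
    (pU A' ⊗ pU A ⊗ fpr G m ⊙ pU A' ⊗ epsA) (whisker_l A' (cup_dk eps m)).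
  by rewrite !tens_prA; apply: whisker_l_disk (cup_disk eps m); rewrite !(bdyE F G).
have D4 : disk (etaA ⊗ pU B' ⊙ pU A' ⊗ pU A ⊗ fpr G m) (fpr G m ⊙ etaA ⊗ pU A')
    (slide etaA (fpr G m)).
  by have := slide_disk etaA (fpr G m); rewrite !(bdyE F G) tensI pU_tens.
have I1 := inverse_sym (slide_inverse (fpr G m) epsB).
have I2 := whisker_r_inverse B' (cap_disk eta m) (etaIP m).
have I3 := whisker_l_inverse A' (cup_disk eps m) (epsIP m).
have I4 := slide_inverse etaA (fpr G m).
have D1' := disk_inverse D1 I1; have D2' := disk_inverse D2 I2.
have D3' := disk_inverse D3 I3; have D4' := disk_inverse D4 I4.
inv.
Qed.

End Flip.

(** [invertible] is a mere existence statement, whereas the flipped cap and cup need inverses as a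
    function of the proarrow; hence the description operator. *)
Lemma inverse_choice (C : doubleCat) (T : Type) (φ : T -> Sq C) :
  (forall t, invertible (φ t)) -> exists ψ, forall t, inverse (φ t) (ψ t).
Proof.
move=> h; exists (fun t => proj1_sig (constructive_indefinite_description _ (h t))) => t.
exact: proj2_sig (constructive_indefinite_description _ (h t)).
Qed.

Theorem proposition4p3 (C : monoidalDC)
    (star : monoidalFunctor (reflectM C) C) (eta : cap star) (eps : cup star) :
  (exists S : natTrans (idF C) (idF C),
     (forall A : Ob C,
        nt_ob S A = (pU A ⊗ dn_ob eta A) ⊙ (dn_ob eps A ⊗ pU A)) /\
     (forall f : Ar C,
        nt_ar S f = (sU f ⊗ₛ dn_ar eta f) ⊙ₛ (dn_ar eps f ⊗ₛ sU f)) /\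
     (forall m : Pr C, nt_pr S m = zigzagS_pr eta eps m)) /\
  (exists Z : natTrans star star,
     (forall A : Ob C,
        nt_ob Z A = (dn_ob eta A ⊗ pU (star_ob star A))
                    ⊙ (pU (star_ob star A) ⊗ dn_ob eps A)) /\
     (forall f : Ar C,
        nt_ar Z f = (dn_ar eta f ⊗ₛ sU (star_ar star f))
                    ⊙ₛ (sU (star_ar star f) ⊗ₛ dn_ar eps f)) /\
     (forall m : Pr C, inverse (zigzagZ_pr eta eps m) (nt_pr Z m))).
Proof.
split; first by exists (zigzag (capData_of_cap eta) (cupData_of_cup eps)).
have [etaI etaIP] := inverse_choice (cap_invertible (capData_of_cap eta)).
have [epsI epsIP] := inverse_choice (cup_invertible (cupData_of_cup eps)).
(* The flipped data have ( )^* on the reflection of C in the place of the identity, so their zigzag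
   is a transformation from ( )^* to itself. *)
exists (zigzag (flip_cap etaIP) (flip_cup epsIP)); split=> //; split=> // m.
exact: (cozigzag_inverse etaIP epsIP m).
Qed.
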